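(* Let $n,k$ be integers with $n+1\le k<2n-1$. Then every Lipschitz map $\beta:S^k\to S^n\subset\mathbb{R}^{n+1}$ extends to a Lipschitz map $D^{k+1}\to\mathbb{R}^{n+1}$ whose derivative has rank at most $n$ almost everywhere.
   Context: $S^n$ is the unit sphere in $\mathbb{R}^{n+1}$, $D^{k+1}$ the closed unit ball in $\mathbb{R}^{k+1}$ with boundary $S^k$. Lipschitz maps between Euclidean domains are differentiable almost everywhere (Rademacher). *)

(* Defs.v *)
(* classical reals. Points of R^m are represented as
   functions nat -> R of which only the coordinates 0..m-1 are used. *)
From Stdlib Require Import Reals.
Open Scope R_scope.

Fixpoint vsum (m : nat) (f : nat -> R) : R :=
  match m with
  | O => 0
  | S m' => vsum m' f + f m'
  end.

Definition vec := nat -> R.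

Definition vadd (x y : vec) : vec := fun i => x i + y i.
Definition vsub (x y : vec) : vec := fun i => x i - y i.

Definition norm (m : nat) (x : vec) : R := sqrt (vsum m (fun i => x i ^ 2)).
Definition dist (m : nat) (x y : vec) : R := norm m (vsub x y).

Definition sphere (n : nat) (x : vec) : Prop := norm (S n) x = 1.
Definition ball (k1 : nat) (x : vec) : Prop := norm k1 x <= 1.

Definition lipschitz_on (p q : nat) (A : vec -> Prop) (f : vec -> vec) : Prop :=
  exists L : R, forall x y, A x -> A y -> dist q (f x) (f y) <= L * dist p x y.

Definition mat := nat -> nat -> R.
Definition mapply (p : nat) (M : mat) (h : vec) : vec :=
  fun i => vsum p (fun j => M i j * h j).

Definition has_derivative (p q : nat) (f : vec -> vec) (x : vec) (M : mat) : Prop :=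
  forall eps, 0 < eps -> exists delta, 0 < delta /\
    forall h, norm p h < delta ->
      norm q (vsub (vsub (f (vadd x h)) (f x)) (mapply p M h)) <= eps * norm p h.

Definition lin_indep (q r : nat) (w : nat -> vec) : Prop :=
  forall c : nat -> R,
    (forall i, (i < q)%nat -> vsum r (fun j => c j * w j i) = 0) ->
    forall j, (j < r)%nat -> c j = 0.

Definition rank_le (p q : nat) (M : mat) (r : nat) : Prop :=
  ~ exists v : nat -> vec, lin_indep q (S r) (fun j => mapply p M (v j)).

Definition null_set (m : nat) (N : vec -> Prop) : Prop :=
  forall eps, 0 < eps -> exists a b : nat -> vec,
    (forall j i, a j i <= b j i) /\
    (forall x, N x -> exists j, forall i, (i < m)%nat -> a j i <= x i <= b j i) /\
    (forall J, vsum J (fun j =>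
        List.fold_right Rmult 1 (List.map (fun i => b j i - a j i) (List.seq 0 m))) <= eps).

(* Main.v *)
(** Let [beta : S^k -> S^n]. Since [k < 2n-1], the preimages of two opposite points of [S^n] can be separated by an equator of
    [S^k] after sliding along the meridians of a generic axis (Freudenthal), so [beta] is homotopic, through maps avoiding 0,
    to a map of the form [(x,t) |-> (g x, t)] from the boundary of a cube of dimension [k+1] to the boundary of a cube of
    dimension [n+1]. Such a homotopy fills a collar of the ball by a map into [S^n], which has rank at most [n].
    The cube is then filled as in Kaufman's example. Cutting both cubes along the last axis, [(x,t) |-> (g x, t)] maps each half
    of the source to a half of the target; after a rotation of the axes, the source of each half contains a smaller cube on
    whose boundary the map is a rescaled copy of [(x,t) |-> (g x, t)], while the rest of the half goes to the boundary
    of the half of the target. Iterating in these smaller cubes, the target shrinks by a factor [lam] with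
    [lam^(n+1) = 1/2]; as [k > n], two cubes of ratio [lam] fit disjointly into the source, so the limit is Lipschitz,
    takes values in finitely many hyperplanes near every point outside a Cantor set, and that set is null. *)
Require Import Defs.
From Stdlib Require Import Reals Lra Lia List Arith Cantor ClassicalEpsilon Classical.
From Coquelicot Require Import Rcomplements Rbar Lim_seq Compactness.
(* The libraries above also export constants named [norm], [dist] and [ball]. *)
Import Defs.
Open Scope R_scope.

(** * Sums, sup norm and Euclidean norm *)

(** As [beta] is only Lipschitz, general position is obtained by counting instead of regular values:
    at mesh 1/q a thickened fibre of a suitable direction needs O(q^(k-n)) cells, and pairs of cells
    with a mixing factor number O(q^(2(k-n)+1)), fewer than the q^k directions of the axis for q
    large, precisely when k+1 < 2n. The boundary map is approximated by piecewise smooth maps that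
    stop changing on compact parts of the open ball, so derivatives are only taken at finite stages.
    Iteration threatens the Lipschitz bound. Source and target maps therefore contract by the same
    ratio in weighted sup norms, and points on different sides of the boundary of a hole are
    compared through a boundary point, where the estimate does not depend on the generation. The
    shell around each hole is filled by a homotopy that turns the axes; compactness bounds its
    argument away from 0 before [g] is known, and [g] is then built without zeros beyond that bound.
    At the end a radial retraction makes the rank small for one of two reasons: the image lies on
    the sphere at x, or near x it lies in finitely many hyperplanes. *)

Lemma eqb_ne i j : i <> j -> Nat.eqb i j = false.
Proof. apply Nat.eqb_neq. Qed.

Lemma vsum_ext m f g : (forall i, (i < m)%nat -> f i = g i) -> vsum m f = vsum m g.
Proof. induction m; simpl; intros H; [easy|]. rewrite IHm, H; auto. Qed.

Lemma vsum_plus m f g : vsum m (fun i => f i + g i) = vsum m f + vsum m g.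
Proof. induction m; simpl; [lra|]. rewrite IHm; lra. Qed.

Lemma vsum_scal m c f : vsum m (fun i => c * f i) = c * vsum m f.
Proof. induction m; simpl; [lra|]. rewrite IHm; lra. Qed.

Lemma vsum_le m f g : (forall i, (i < m)%nat -> f i <= g i) -> vsum m f <= vsum m g.
Proof. induction m; simpl; intros H; [lra|]. assert (vsum m f <= vsum m g) by auto. assert (f m <= g m) by auto. lra. Qed.

Lemma vsum_const m c : vsum m (fun _ => c) = INR m * c.
Proof. induction m; [simpl; lra|]. simpl vsum. rewrite IHm, S_INR; lra. Qed.

Lemma vsum_nonneg m f : (forall i, (i < m)%nat -> 0 <= f i) -> 0 <= vsum m f.
Proof. intros H. replace 0 with (vsum m (fun _ => 0)) by (rewrite vsum_const; lra). now apply vsum_le. Qed.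

Lemma vsum_abs m f : Rabs (vsum m f) <= vsum m (fun i => Rabs (f i)).
Proof.
  induction m; simpl; [rewrite Rabs_R0; lra|].
  pose proof (Rabs_triang (vsum m f) (f m)). lra.
Qed.

Lemma vsum_abs_le m f d : (forall i, (i < m)%nat -> Rabs (f i) <= d) -> Rabs (vsum m f) <= INR m * d.
Proof.
  intros H. eapply Rle_trans; [apply vsum_abs|]. rewrite <- vsum_const. now apply vsum_le.
Qed.

Lemma vsum_ge_term m f i : (forall j, (j < m)%nat -> 0 <= f j) -> (i < m)%nat -> f i <= vsum m f.
Proof.
  induction m; intros H Hi; [lia|]. simpl.
  assert (0 <= vsum m f) by (apply vsum_nonneg; auto).
  destruct (Nat.eq_dec i m) as [->|]; [lra|].
  assert (f i <= vsum m f) by (apply IHm; auto; lia).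
  assert (0 <= f m) by auto. lra.
Qed.

Lemma vsum_single m i f :
  (i < m)%nat -> (forall j, (j < m)%nat -> j <> i -> f j = 0) -> vsum m f = f i.
Proof.
  induction m; intros Hi H; [lia|]. simpl.
  destruct (Nat.eq_dec i m) as [->|].
  - rewrite (vsum_ext m f (fun _ => 0)); [rewrite vsum_const; lra|]. intros j Hj. apply H; lia.
  - rewrite IHm, (H m); [lra| lia | auto | lia | intros; apply H; lia].
Qed.

Lemma vsum_swap p q (f : nat -> nat -> R) :
  vsum p (fun i => vsum q (fun j => f i j)) = vsum q (fun j => vsum p (fun i => f i j)).
Proof.
  induction p; simpl; [now rewrite vsum_const, Rmult_0_r|].
  rewrite IHp, <- vsum_plus. reflexivity.
Qed.

(** Clamping and all grid arguments are coordinatewise, so estimates are made in the sup norm; it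
    differs from the Euclidean norm by at most a factor [m], which Lipschitz constants absorb. *)
Fixpoint supn (m : nat) (x : vec) : R :=
  match m with O => 0 | S m' => Rmax (supn m' x) (Rabs (x m')) end.

Lemma supn_nonneg m x : 0 <= supn m x.
Proof. induction m; simpl; [lra|]. eapply Rle_trans; [apply IHm|apply Rmax_l]. Qed.

Lemma supn_ge m x i : (i < m)%nat -> Rabs (x i) <= supn m x.
Proof.
  induction m; intros H; [lia|]. simpl.
  destruct (Nat.eq_dec i m) as [->|]; [apply Rmax_r|].
  eapply Rle_trans; [apply IHm; lia|apply Rmax_l].
Qed.

Lemma supn_le m x d : 0 <= d -> (forall i, (i < m)%nat -> Rabs (x i) <= d) -> supn m x <= d.
Proof. induction m; simpl; intros Hd H; [easy|]. apply Rmax_lub; auto. Qed.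

Lemma supn_lt m x d : 0 < d -> (forall i, (i < m)%nat -> Rabs (x i) < d) -> supn m x < d.
Proof. induction m; simpl; intros Hd H; [easy|]. apply Rmax_lub_lt; auto. Qed.

Lemma supn_ext m x y : (forall i, (i < m)%nat -> x i = y i) -> supn m x = supn m y.
Proof. induction m; simpl; intros H; [easy|]. rewrite IHm, H; auto. Qed.

Lemma supn_mono m x y : (forall i, (i < m)%nat -> Rabs (x i) <= Rabs (y i)) -> supn m x <= supn m y.
Proof.
  intros H. apply supn_le; [apply supn_nonneg|]. intros i Hi.
  eapply Rle_trans; [now apply H|now apply supn_ge].
Qed.

Lemma supn_scal m c x : supn m (fun i => c * x i) = Rabs c * supn m x.
Proof.
  induction m; simpl; [lra|]. rewrite IHm, Rabs_mult.
  rewrite RmaxRmult; [easy|apply Rabs_pos].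
Qed.

Lemma supn_attained m x : (0 < m)%nat -> exists i, (i < m)%nat /\ Rabs (x i) = supn m x.
Proof.
  induction m; intros H; [lia|]. simpl.
  destruct (Rle_dec (supn m x) (Rabs (x m))) as [h|h].
  - exists m; split; [lia|]. now rewrite Rmax_right.
  - rewrite Rmax_left by lra. destruct m as [|m].
    + simpl in h. pose proof (Rabs_pos (x O)). lra.
    + destruct IHm as [i [Hi Hx]]; [lia|]. exists i; split; [lia|easy].
Qed.

Definition sdist (m : nat) (x y : vec) : R := supn m (vsub x y).

Lemma sdist_ge m x y i : (i < m)%nat -> Rabs (x i - y i) <= sdist m x y.
Proof. intros H. apply (supn_ge m (vsub x y) i H). Qed.

Lemma sdist_le m x y d : 0 <= d -> (forall i, (i < m)%nat -> Rabs (x i - y i) <= d) -> sdist m x y <= d.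
Proof. intros Hd H. now apply supn_le. Qed.

Lemma sdist_nonneg m x y : 0 <= sdist m x y.
Proof. apply supn_nonneg. Qed.

Lemma sdist_sym m x y : sdist m x y = sdist m y x.
Proof.
  apply Rle_antisym; apply sdist_le; try apply sdist_nonneg;
    intros i Hi; rewrite Rabs_minus_sym; now apply sdist_ge.
Qed.

Lemma sdist_tri m x y z : sdist m x z <= sdist m x y + sdist m y z.
Proof.
  apply sdist_le.
  - pose proof (sdist_nonneg m x y); pose proof (sdist_nonneg m y z); lra.
  - intros i Hi. pose proof (sdist_ge m x y i Hi). pose proof (sdist_ge m y z i Hi).
    replace (x i - z i) with ((x i - y i) + (y i - z i)) by ring.
    pose proof (Rabs_triang (x i - y i) (y i - z i)). lra.
Qed.

Lemma supn_sdist m x y : supn m x <= supn m y + sdist m x y.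
Proof.
  apply supn_le.
  - pose proof (supn_nonneg m y); pose proof (sdist_nonneg m x y); lra.
  - intros i Hi. pose proof (supn_ge m y i Hi). pose proof (sdist_ge m x y i Hi).
    replace (x i) with (y i + (x i - y i)) by ring.
    pose proof (Rabs_triang (y i) (x i - y i)). lra.
Qed.

Lemma sdist_eq0 m x y : sdist m x y = 0 -> forall i, (i < m)%nat -> x i = y i.
Proof.
  intros H i Hi. pose proof (sdist_ge m x y i Hi) as Hd. rewrite H in Hd.
  pose proof (Rabs_pos (x i - y i)).
  assert (Rabs (x i - y i) = 0) by lra. destruct (Req_dec (x i - y i) 0); [lra|].
  now apply Rabs_no_R0 in H2.
Qed.

Lemma sdist_same m x y : (forall i, (i < m)%nat -> x i = y i) -> sdist m x y = 0.
Proof.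
  intros H. apply Rle_antisym; [|apply sdist_nonneg]. apply sdist_le; [lra|].
  intros i Hi. rewrite (H i Hi), Rminus_diag, Rabs_R0. lra.
Qed.

Definition sq (m : nat) (x : vec) : R := vsum m (fun i => x i ^ 2).

Lemma sq_nonneg m x : 0 <= sq m x.
Proof. apply vsum_nonneg. intros; apply pow2_ge_0. Qed.

Lemma norm_sq m x : norm m x * norm m x = sq m x.
Proof. apply sqrt_sqrt, sq_nonneg. Qed.

Lemma norm_nonneg m x : 0 <= norm m x.
Proof. apply sqrt_pos. Qed.

Lemma norm_ge m x i : (i < m)%nat -> Rabs (x i) <= norm m x.
Proof.
  intros Hi. unfold norm. rewrite <- sqrt_Rsqr_abs. apply sqrt_le_1_alt.
  replace (Rsqr (x i)) with (x i ^ 2) by (unfold Rsqr; ring).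
  apply (vsum_ge_term m (fun i => x i ^ 2)); [intros; apply pow2_ge_0|easy].
Qed.

Lemma supn_le_norm m x : supn m x <= norm m x.
Proof. apply supn_le; [apply norm_nonneg|apply norm_ge]. Qed.

Lemma sq_le m x d : (forall i, (i < m)%nat -> Rabs (x i) <= d) -> sq m x <= INR m * d ^ 2.
Proof.
  intros H. rewrite <- vsum_const. apply vsum_le. intros i Hi. specialize (H i Hi).
  rewrite <- (pow2_abs (x i)). apply pow_incr. split; [apply Rabs_pos|easy].
Qed.

Lemma norm_le_supn m x : norm m x <= INR m * supn m x.
Proof.
  pose proof (supn_nonneg m x). destruct m as [|m].
  - simpl. unfold norm; simpl. rewrite sqrt_0. lra.
  - apply Rsqr_incr_0_var.
    + unfold Rsqr. rewrite norm_sq. eapply Rle_trans; [apply (sq_le _ _ (supn (S m) x))|].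
      * intros; now apply supn_ge.
      * assert (1 <= INR (S m)) by (rewrite S_INR; pose proof (pos_INR m); lra).
        assert (0 <= supn (S m) x ^ 2) by apply pow2_ge_0. nra.
    + apply Rmult_le_pos; [apply pos_INR|easy].
Qed.

Lemma sdist_dist m x y : sdist m x y <= dist m x y.
Proof. apply supn_le_norm. Qed.

Lemma dist_sdist m x y : dist m x y <= INR m * sdist m x y.
Proof. apply norm_le_supn. Qed.

Lemma norm_1_sq m x : norm m x = 1 <-> sq m x = 1.
Proof.
  split; intros H.
  - rewrite <- norm_sq, H. ring.
  - unfold norm. fold (sq m x). rewrite H. apply sqrt_1.
Qed.

Lemma sq_scal m c x : sq m (fun i => c * x i) = c ^ 2 * sq m x.
Proof. unfold sq. rewrite <- vsum_scal. apply vsum_ext. intros; ring. Qed.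

Lemma sq_ext m x y : (forall i, (i < m)%nat -> x i = y i) -> sq m x = sq m y.
Proof. intros H. apply vsum_ext. intros; now rewrite H. Qed.

Lemma norm_ext m x y : (forall i, (i < m)%nat -> x i = y i) -> norm m x = norm m y.
Proof. intros H. unfold norm. f_equal. now apply sq_ext. Qed.

Lemma sq_supn m x : (supn m x) ^ 2 <= sq m x.
Proof.
  rewrite <- norm_sq. pose proof (supn_le_norm m x). pose proof (supn_nonneg m x). nra.
Qed.

Lemma sq_lip m x y d : (forall i, (i < m)%nat -> Rabs (x i) <= d) -> (forall i, (i < m)%nat -> Rabs (y i) <= d) ->
  Rabs (sq m x - sq m y) <= INR m * (2 * d) * sdist m x y.
Proof.
  intros Hx Hy. unfold sq.
  replace (vsum m (fun i => x i ^ 2) - vsum m (fun i => y i ^ 2))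
    with (vsum m (fun i => (x i + y i) * (x i - y i))).
  - rewrite Rmult_assoc. apply vsum_abs_le. intros i Hi. rewrite Rabs_mult.
    apply Rmult_le_compat; try apply Rabs_pos; [|now apply sdist_ge].
    pose proof (Rabs_triang (x i) (y i)). specialize (Hx i Hi); specialize (Hy i Hi). lra.
  - replace (vsum m (fun i => (x i + y i) * (x i - y i)))
      with (vsum m (fun i => x i ^ 2 + (-1) * y i ^ 2)).
    + rewrite vsum_plus, vsum_scal. lra.
    + apply vsum_ext; intros; ring.
Qed.

(** * Null sets *)

(** Base-[Q] digits number the cells of a grid with [Q] cells per axis by the naturals below
    [Q ^ m], so that cells can be listed and counted. *)
Fixpoint dig (Q b i : nat) : nat :=
  match i with O => b mod Q | S i' => dig Q (b / Q) i' end.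

Lemma dig_lt Q b i : (0 < Q)%nat -> (dig Q b i < Q)%nat.
Proof.
  intros HQ. revert b; induction i; intros b; simpl; [|apply IHi].
  apply Nat.mod_upper_bound; lia.
Qed.

Lemma dig_inj Q m b b' : (0 < Q)%nat -> (b < Q ^ m)%nat -> (b' < Q ^ m)%nat ->
  (forall i, (i < m)%nat -> dig Q b i = dig Q b' i) -> b = b'.
Proof.
  intros HQ. revert b b'; induction m; intros b b' Hb Hb' H; [simpl in *; lia|].
  rewrite (Nat.div_mod_eq b Q), (Nat.div_mod_eq b' Q).
  assert (b mod Q = b' mod Q) as -> by (apply (H O); lia).
  rewrite (IHm (b / Q)%nat (b' / Q)%nat); [easy| | |].
  - apply Nat.Div0.div_lt_upper_bound. now rewrite <- Nat.pow_succ_r'.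
  - apply Nat.Div0.div_lt_upper_bound. now rewrite <- Nat.pow_succ_r'.
  - intros i Hi. apply (H (S i)); lia.
Qed.

Lemma dig_ex Q m (d : nat -> nat) : (0 < Q)%nat -> (forall i, (i < m)%nat -> (d i < Q)%nat) ->
  exists b, (b < Q ^ m)%nat /\ forall i, (i < m)%nat -> dig Q b i = d i.
Proof.
  intros HQ. revert d; induction m; intros d Hd; [exists O; simpl; split; lia|].
  destruct (IHm (fun i => d (S i))) as [b [Hb H]]; [intros; apply Hd; lia|].
  exists (d O + b * Q)%nat. assert (H0 : (d O < Q)%nat) by (apply Hd; lia). split.
  - rewrite Nat.pow_succ_r'. nia.
  - intros [|i] Hi; simpl.
    + now rewrite Nat.Div0.mod_add, Nat.mod_small.
    + rewrite Nat.div_add, (Nat.div_small _ _ H0) by lia. apply H; lia.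
Qed.

Lemma unit_cell_ex Q s : (0 < Q)%nat -> 0 <= s <= INR Q ->
  exists d, (d < Q)%nat /\ INR d <= s <= INR d + 1.
Proof.
  induction Q as [|Q IH]; intros HQ Hs; [lia|]. rewrite S_INR in Hs.
  destruct (Rle_dec (INR Q) s).
  - exists Q; split; [lia|lra].
  - destruct Q as [|Q]; [simpl in *; lra|]. destruct IH as [d [Hd H]]; [lia|lra|].
    exists d; split; [lia|easy].
Qed.

(** Centre of a cell of side 2/Q in the cube [-1,1]^m. *)
Definition gridpt (Q b : nat) : vec := fun i => -1 + (2 * INR (dig Q b i) + 1) / INR Q.

Lemma grid_cover m Q x : (0 < Q)%nat -> supn m x <= 1 ->
  exists b, (b < Q ^ m)%nat /\ forall i, (i < m)%nat -> Rabs (x i - gridpt Q b i) <= / INR Q.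
Proof.
  intros HQ Hx. assert (HQR : 0 < INR Q) by (apply lt_0_INR; lia).
  assert (H : forall i, (i < m)%nat ->
     exists d, (d < Q)%nat /\ Rabs (x i - (-1 + (2 * INR d + 1) / INR Q)) <= / INR Q).
  { intros i Hi. assert (Hxi : Rabs (x i) <= 1) by (eapply Rle_trans; [apply (supn_ge m x i Hi)|exact Hx]).
    apply Rabs_le_between in Hxi.
    destruct (unit_cell_ex Q ((x i + 1) / 2 * INR Q) HQ) as [d [Hd H]].
    { assert (0 <= (x i + 1) / 2 <= 1) by lra. split; nra. }
    exists d; split; [easy|].
    replace (x i - (-1 + (2 * INR d + 1) / INR Q))
      with ((2 * ((x i + 1) / 2 * INR Q - INR d) - 1) * / INR Q) by (field; lra).
    rewrite Rabs_mult, (Rabs_pos_eq (/ INR Q)) by (left; now apply Rinv_0_lt_compat).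
    rewrite <- (Rmult_1_l (/ INR Q)) at 2. apply Rmult_le_compat_r; [left; now apply Rinv_0_lt_compat|].
    apply Rabs_le. lra. }
  set (d := fun i => match excluded_middle_informative (i < m)%nat with
    | left h => proj1_sig (constructive_indefinite_description _ (H i h)) | _ => O end).
  assert (Hd : forall i, (i < m)%nat -> (d i < Q)%nat /\
     Rabs (x i - (-1 + (2 * INR (d i) + 1) / INR Q)) <= / INR Q).
  { intros i Hi. unfold d. destruct (excluded_middle_informative (i < m)%nat); [|easy].
    apply (proj2_sig (constructive_indefinite_description _ (H i l))). }
  destruct (dig_ex Q m d HQ) as [b [Hb Hdig]]; [apply Hd|].
  exists b; split; [easy|]. intros i Hi. unfold gridpt. rewrite Hdig; [now apply Hd|easy].
Qed.

Definition boxvol (m : nat) (a b : vec) : R :=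
  fold_right Rmult 1 (map (fun i => b i - a i) (seq 0 m)).

Lemma boxvol_const m a b c : (forall i, b i - a i = c) -> boxvol m a b = c ^ m.
Proof.
  intros H. unfold boxvol. generalize O. induction m; intros s; simpl; [easy|]. now rewrite H, IHm.
Qed.

Lemma boxvol_nonneg m a b : (forall i, a i <= b i) -> 0 <= boxvol m a b.
Proof.
  intros H. unfold boxvol. generalize O. induction m; intros s; simpl; [lra|].
  apply Rmult_le_pos; [|apply IHm]. specialize (H s). lra.
Qed.

Lemma null_subset m (N N' : vec -> Prop) : (forall x, N x -> N' x) -> null_set m N' -> null_set m N.
Proof.
  intros H HN eps He. destruct (HN eps He) as [a [b [H1 [H2 H3]]]].
  exists a, b; repeat split; auto.
Qed.

(** The finite cover is completed to a sequence by degenerate boxes; their volume 0^m vanishes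
    because [m] is positive. *)
Lemma null_cubes m (N : vec -> Prop) : (0 < m)%nat ->
  (forall eps, 0 < eps -> exists (cnt : nat) (c : nat -> vec) (r : R), 0 <= r /\
     (forall x, N x -> exists j, (j < cnt)%nat /\ forall i, (i < m)%nat -> Rabs (x i - c j i) <= r) /\
     INR cnt * (2 * r) ^ m <= eps) ->
  null_set m N.
Proof.
  intros Hm H eps He. destruct (H eps He) as [cnt [c [r [Hr [H1 H2]]]]].
  exists (fun j => if Nat.ltb j cnt then fun i => c j i - r else fun _ => 0),
    (fun j => if Nat.ltb j cnt then fun i => c j i + r else fun _ => 0).
  split; [|split].
  - intros j i. destruct (Nat.ltb j cnt); lra.
  - intros x Hx. destruct (H1 x Hx) as [j [Hj Hc]]. exists j. intros i Hi.
    apply Nat.ltb_lt in Hj. rewrite Hj. specialize (Hc i Hi). apply Rabs_le_between in Hc. lra.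
  - intros J. eapply Rle_trans; [|apply H2].
    eapply Rle_trans; [apply (vsum_le J _ (fun j => if Nat.ltb j cnt then (2 * r) ^ m else 0))|].
    + intros j _. apply Req_le.
      match goal with |- fold_right Rmult 1 (map (fun i => ?b i - ?a i) (seq 0 m)) = _ => change (boxvol m a b = if Nat.ltb j cnt then (2 * r) ^ m else 0) end.
      destruct (Nat.ltb j cnt).
      * apply boxvol_const. intros; ring.
      * rewrite (boxvol_const m _ _ 0) by (intros; ring). apply pow_i; lia.
    + assert (Hp : 0 <= (2 * r) ^ m) by (apply pow_le; lra).
      assert (G : forall J, vsum J (fun j => if Nat.ltb j cnt then (2 * r) ^ m else 0) <= INR (Nat.min J cnt) * (2 * r) ^ m).
      { induction J0; simpl vsum; [simpl; lra|].
        destruct (Nat.ltb_spec J0 cnt).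
        - rewrite !Nat.min_l in * by lia. rewrite S_INR. lra.
        - rewrite !Nat.min_r in * by lia. lra. }
      eapply Rle_trans; [apply G|]. apply Rmult_le_compat_r; [easy|]. apply le_INR; lia.
Qed.

Lemma cantor_inj p q : Cantor.to_nat p = Cantor.to_nat q -> p = q.
Proof. intros H. rewrite <- (Cantor.cancel_of_to p), H. apply Cantor.cancel_of_to. Qed.

(** The k-th set is covered with total volume eps/2^(k+1), and the boxes are enumerated along the
    Cantor pairing. *)
Lemma null_union m (N : nat -> vec -> Prop) :
  (forall k, null_set m (N k)) -> null_set m (fun x => exists k, N k x).
Proof.
  intros H eps He.
  assert (He' : forall k, 0 < eps * (/ 2) ^ (S k)).
  { intros k. apply Rmult_lt_0_compat; [easy|apply pow_lt; lra]. }
  set (P := fun k (ab : (nat -> vec) * (nat -> vec)) =>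
    (forall j i, fst ab j i <= snd ab j i) /\
    (forall x, N k x -> exists j, forall i, (i < m)%nat -> fst ab j i <= x i <= snd ab j i) /\
    (forall J, vsum J (fun j => boxvol m (fst ab j) (snd ab j)) <= eps * (/ 2) ^ (S k))).
  assert (HP : forall k, exists ab, P k ab).
  { intros k. destruct (H k _ (He' k)) as [a [b [H1 [H2 H3]]]]. now exists (a, b). }
  set (ab := fun k => proj1_sig (constructive_indefinite_description _ (HP k))).
  assert (Hab : forall k, P k (ab k)).
  { intros k. apply (proj2_sig (constructive_indefinite_description _ (HP k))). }
  clearbody ab.
  exists (fun j => fst (ab (fst (Cantor.of_nat j))) (snd (Cantor.of_nat j))),
    (fun j => snd (ab (fst (Cantor.of_nat j))) (snd (Cantor.of_nat j))).
  split; [|split].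
  - intros j i. apply Hab.
  - intros x [k Hx]. destruct (proj1 (proj2 (Hab k)) x Hx) as [j Hj].
    exists (Cantor.to_nat (k, j)). rewrite Cantor.cancel_of_to. exact Hj.
  - intros J. set (v := fun k i => boxvol m (fst (ab k) i) (snd (ab k) i)).
    assert (Hv : forall k i, 0 <= v k i) by (intros k i; apply boxvol_nonneg, Hab).
    change (vsum J (fun j => v (fst (Cantor.of_nat j)) (snd (Cantor.of_nat j))) <= eps).
    (* [chi] places each volume at the index given by the pairing. The pairing dominates both of its
       arguments, so the first [J] boxes all come from the square [J] by [J], and the sums over [k],
       [i] and [j] can be interchanged. *)
    set (chi := fun k i j : nat => if Nat.eqb (Cantor.to_nat (k, i)) j then v k i else 0).
    rewrite (vsum_ext J _ (fun j => vsum J (fun k => vsum J (fun i => chi k i j)))).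
    2:{ intros j Hj. destruct (Cantor.of_nat j) as [k i] eqn:E. simpl.
      assert (Hki : Cantor.to_nat (k, i) = j) by (rewrite <- E; apply Cantor.cancel_to_of).
      pose proof (Cantor.to_nat_non_decreasing k i). rewrite Hki in *.
      rewrite (vsum_single J k); [|lia|].
      - rewrite (vsum_single J i); [|lia|].
        + unfold chi. now rewrite Hki, Nat.eqb_refl.
        + intros i' _ Hne. unfold chi. destruct (Nat.eqb_spec (Cantor.to_nat (k, i')) j); [|easy].
          rewrite <- e in Hki. apply cantor_inj in Hki. congruence.
      - intros k' _ Hne. rewrite <- (Rmult_0_r (INR J)), <- vsum_const. apply vsum_ext. intros i' _.
        unfold chi. destruct (Nat.eqb_spec (Cantor.to_nat (k', i')) j); [|easy].
        rewrite <- e in Hki. apply cantor_inj in Hki. congruence. }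
    rewrite vsum_swap.
    eapply Rle_trans; [apply (vsum_le J _ (fun k => eps * (/ 2) ^ S k))|].
    + intros k _. rewrite vsum_swap. eapply Rle_trans; [|apply (proj2 (proj2 (Hab k)) J)].
      apply vsum_le. intros i _. change (vsum J (fun j => chi k i j) <= v k i).
      destruct (le_lt_dec J (Cantor.to_nat (k, i))).
      * rewrite (vsum_ext J _ (fun _ => 0)), vsum_const; [rewrite Rmult_0_r; apply Hv|].
        intros j Hj. unfold chi. destruct (Nat.eqb_spec (Cantor.to_nat (k, i)) j); [lia|easy].
      * rewrite (vsum_single J (Cantor.to_nat (k, i))); [|easy|].
        -- unfold chi. rewrite Nat.eqb_refl. lra.
        -- intros j _ Hne. unfold chi. destruct (Nat.eqb_spec (Cantor.to_nat (k, i)) j); [lia|easy].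
    + assert (G : vsum J (fun k => eps * (/ 2) ^ S k) = eps * (1 - (/ 2) ^ J)).
      { clear. induction J; cbn [vsum]; [simpl; lra|]. rewrite IHJ. simpl. lra. }
      eapply Rle_trans; [apply Req_le, G|]. assert (0 < (/ 2) ^ J) by (apply pow_lt; lra). nra.
Qed.

Lemma null_or m (N N' : vec -> Prop) : null_set m N -> null_set m N' -> null_set m (fun x => N x \/ N' x).
Proof.
  intros H H'. apply (null_subset _ _ (fun x => exists k, match k with O => N x | _ => N' x end)).
  - intros x [h|h]; [now exists O|now exists 1%nat].
  - apply (null_union m (fun k x => match k with O => N x | _ => N' x end)). now intros [|k].
Qed.

Lemma null_empty m : (0 < m)%nat -> null_set m (fun _ => False).
Proof.
  intros Hm. apply null_cubes; [easy|]. intros eps He. exists O, (fun _ _ => 0), 0.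
  repeat split; [lra|easy|simpl; lra].
Qed.

(** * Derivatives and piecewise smooth functions *)

(** Scalar derivative in the sup norm; [has_derivative_intro] assembles the coordinates into a
    Euclidean derivative. *)
Definition hasd (m : nat) (f : vec -> R) (x g : vec) : Prop :=
  forall eps, 0 < eps -> exists d, 0 < d /\ forall h, supn m h < d ->
    Rabs (f (vadd x h) - f x - vsum m (fun j => g j * h j)) <= eps * supn m h.

Lemma hasd_local m f f' x g r : 0 < r -> (forall y, sdist m y x < r -> f y = f' y) ->
  hasd m f x g -> hasd m f' x g.
Proof.
  intros Hr He H eps Heps. destruct (H eps Heps) as [d [Hd Hf]].
  exists (Rmin d r). split; [now apply Rmin_pos|]. intros h Hh.
  assert (supn m h < d) by (eapply Rlt_le_trans; [exact Hh|apply Rmin_l]).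
  assert (supn m h < r) by (eapply Rlt_le_trans; [exact Hh|apply Rmin_r]).
  rewrite <- (He (vadd x h)), <- (He x).
  - now apply Hf.
  - rewrite sdist_same; auto.
  - eapply Rle_lt_trans; [|exact H1]. apply supn_mono. intros i _. unfold vsub, vadd.
    apply Req_le. f_equal. ring.
Qed.

Lemma hasd_ext m f f' x g : (forall y, f y = f' y) -> hasd m f x g -> hasd m f' x g.
Proof. intros H. apply (hasd_local m f f' x g 1); [lra|auto]. Qed.

Lemma hasd_const m c x : hasd m (fun _ => c) x (fun _ => 0).
Proof.
  intros eps He. exists 1. split; [lra|]. intros h _.
  rewrite vsum_scal. replace (c - c - 0 * vsum m h) with 0 by ring. rewrite Rabs_R0.
  pose proof (supn_nonneg m h). nra.
Qed.

Lemma hasd_coord m i x : (i < m)%nat -> hasd m (fun y => y i) x (fun j => if Nat.eqb j i then 1 else 0).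
Proof.
  intros Hi eps He. exists 1. split; [lra|]. intros h _.
  rewrite (vsum_single m i); [|easy|].
  - rewrite Nat.eqb_refl. unfold vadd. replace (x i + h i - x i - 1 * h i) with 0 by ring.
    rewrite Rabs_R0. pose proof (supn_nonneg m h). nra.
  - intros j _ Hj. apply Nat.eqb_neq in Hj. rewrite Hj. ring.
Qed.

Lemma hasd_add m f f' x g g' : hasd m f x g -> hasd m f' x g' ->
  hasd m (fun y => f y + f' y) x (fun i => g i + g' i).
Proof.
  intros H H' eps He. destruct (H (eps / 2)) as [d [Hd Hf]]; [lra|].
  destruct (H' (eps / 2)) as [d' [Hd' Hf']]; [lra|].
  exists (Rmin d d'). split; [now apply Rmin_pos|]. intros h Hh.
  specialize (Hf h ltac:(eapply Rlt_le_trans; [exact Hh|apply Rmin_l])).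
  specialize (Hf' h ltac:(eapply Rlt_le_trans; [exact Hh|apply Rmin_r])).
  rewrite (vsum_ext m (fun j => (g j + g' j) * h j) (fun j => g j * h j + g' j * h j)) by (intros; ring).
  rewrite vsum_plus.
  match type of Hf with Rabs ?a <= _ => match type of Hf' with Rabs ?b <= _ =>
    match goal with |- Rabs ?c <= _ => replace c with (a + b) by ring end;
    pose proof (Rabs_triang a b) end end. lra.
Qed.

Lemma hasd_bound m f x g : hasd m f x g -> exists K d, 0 < K /\ 0 < d /\
  forall h, supn m h < d -> Rabs (f (vadd x h) - f x) <= K * supn m h.
Proof.
  intros H. destruct (H 1) as [d [Hd Hf]]; [lra|].
  exists (1 + INR m * supn m g), d. split; [|split; [easy|]].
  - pose proof (pos_INR m); pose proof (supn_nonneg m g). nra.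
  - intros h Hh. specialize (Hf h Hh).
    assert (Rabs (vsum m (fun j => g j * h j)) <= INR m * (supn m g * supn m h)).
    { apply vsum_abs_le. intros i Hi. rewrite Rabs_mult.
      apply Rmult_le_compat; try apply Rabs_pos; now apply supn_ge. }
    match type of Hf with Rabs (?a - ?b - ?c) <= _ => replace (a - b) with ((a - b - c) + c) by ring;
      pose proof (Rabs_triang (a - b - c) c) end. lra.
Qed.

Lemma hasd_outer m f x g phi d : derivable_pt_lim phi (f x) d -> hasd m f x g ->
  hasd m (fun y => phi (f y)) x (fun i => d * g i).
Proof.
  intros Hp Hf eps He. destruct (hasd_bound m f x g Hf) as [K [d0 [HK [Hd0 HB]]]].
  destruct (Hp (eps / (2 * K))) as [d1 H1]; [apply Rdiv_lt_0_compat; lra|].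
  assert (Hpd : 0 < Rabs d + 1) by (pose proof (Rabs_pos d); lra).
  destruct (Hf (eps / (2 * (Rabs d + 1)))) as [d2 [Hd2 H2]]; [apply Rdiv_lt_0_compat; lra|].
  exists (Rmin d0 (Rmin d2 (d1 / K))). split.
  { repeat apply Rmin_pos; try easy. apply Rdiv_lt_0_compat; [apply cond_pos|easy]. }
  intros h Hh.
  assert (Hh0 : supn m h < d0) by (eapply Rlt_le_trans; [exact Hh|apply Rmin_l]).
  assert (Hh1 : supn m h < Rmin d2 (d1 / K)) by (eapply Rlt_le_trans; [exact Hh|apply Rmin_r]).
  assert (Hh2 : supn m h < d2) by (eapply Rlt_le_trans; [exact Hh1|apply Rmin_l]).
  assert (Hh3 : supn m h < d1 / K) by (eapply Rlt_le_trans; [exact Hh1|apply Rmin_r]).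
  specialize (HB h Hh0). specialize (H2 h Hh2). pose proof (supn_nonneg m h) as Hn.
  set (u := f (vadd x h) - f x) in *.
  (* The difference quotient of [derivable_pt_lim] says nothing about a zero increment, which is
     treated apart. *)
  assert (Hu : Rabs (phi (f x + u) - phi (f x) - d * u) <= eps / (2 * K) * Rabs u).
  { destruct (Req_dec u 0) as [->|Hu0].
    - rewrite Rplus_0_r, Rmult_0_r, Rminus_diag, Rminus_0_r, Rabs_R0. lra.
    - assert (Hlt : Rabs u < d1).
      { eapply Rle_lt_trans; [exact HB|]. apply (Rmult_lt_compat_l K) in Hh3; [|easy].
        replace (K * (d1 / K)) with (pos d1) in Hh3 by (field; lra). easy. }
      specialize (H1 u Hu0 Hlt).
      replace (phi (f x + u) - phi (f x) - d * u) with (((phi (f x + u) - phi (f x)) / u - d) * u) by (field; easy).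
      rewrite Rabs_mult. apply Rmult_le_compat_r; [apply Rabs_pos|lra]. }
  replace (f (vadd x h)) with (f x + u) by (unfold u; ring).
  rewrite (vsum_ext m (fun j => d * g j * h j) (fun j => d * (g j * h j))) by (intros; ring).
  rewrite vsum_scal.
  set (s := vsum m (fun j => g j * h j)) in *.
  replace (phi (f x + u) - phi (f x) - d * s) with ((phi (f x + u) - phi (f x) - d * u) + d * (u - s)) by ring.
  eapply Rle_trans; [apply Rabs_triang|]. rewrite Rabs_mult.
  assert (A1 : eps / (2 * K) * Rabs u <= eps / 2 * supn m h).
  { replace (eps / 2 * supn m h) with (eps / (2 * K) * (K * supn m h)) by (field; lra).
    apply Rmult_le_compat_l; [left; apply Rdiv_lt_0_compat; lra|easy]. }
  assert (A2 : Rabs d * Rabs (u - s) <= eps / 2 * supn m h).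
  { apply Rle_trans with ((Rabs d + 1) * (eps / (2 * (Rabs d + 1)) * supn m h)).
    - apply Rmult_le_compat; try apply Rabs_pos; [lra|easy].
    - apply Req_le. field. lra. }
  lra.
Qed.

Lemma hasd_scal m c f x g : hasd m f x g -> hasd m (fun y => c * f y) x (fun i => c * g i).
Proof.
  apply (hasd_outer m f x g (fun t => c * t)).
  intros e He. exists (mkposreal 1 Rlt_0_1). intros u Hu _.
  replace ((c * (f x + u) - c * f x) / u - c) with 0 by (field; easy). now rewrite Rabs_R0.
Qed.

(** Polarization: f f' = ((f + f')^2 - (f - f')^2)/4 reduces the product rule to sums and the chain
    rule for the square. *)
Lemma hasd_mul m f f' x g g' : hasd m f x g -> hasd m f' x g' ->
  exists g'', hasd m (fun y => f y * f' y) x g''.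
Proof.
  intros H H'. pose proof (hasd_add _ _ _ _ _ _ H H') as Hp.
  pose proof (hasd_add _ _ _ _ _ _ H (hasd_scal _ (-1) _ _ _ H')) as Hm.
  pose proof (fun F G (h : hasd m F x G) => hasd_outer m F x G Rsqr _ (derivable_pt_lim_Rsqr (F x)) h) as Hs.
  apply Hs in Hp, Hm.
  pose proof (hasd_add _ _ _ _ _ _ (hasd_scal _ (/ 4) _ _ _ Hp) (hasd_scal _ (- / 4) _ _ _ Hm)) as Hr.
  eexists. eapply hasd_ext; [|exact Hr]. intros y. unfold Rsqr. simpl. field.
Qed.

(** Where both f and its derivative vanish, |f| is again o(h). Only zeros with nonzero derivative
    are left out, and [null_zero_set] deals with them. *)
Lemma hasd_abs m f x g : hasd m f x g -> (f x <> 0 \/ forall i, (i < m)%nat -> g i = 0) ->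
  exists g', hasd m (fun y => Rabs (f y)) x g'.
Proof.
  intros H [h|h].
  - destruct (Rtotal_order (f x) 0) as [h'|[h'|h']]; [|easy|].
    + exists (fun i => -1 * g i). apply (hasd_outer m f x g Rabs); [now apply Rabs_derive_2|easy].
    + exists (fun i => 1 * g i). apply (hasd_outer m f x g Rabs); [now apply Rabs_derive_1|easy].
  - destruct (Req_dec (f x) 0) as [h0|h0].
    + exists (fun _ => 0). intros eps He. destruct (H eps He) as [d [Hd Hf]].
      exists d. split; [easy|]. intros v Hv. specialize (Hf v Hv).
      assert (E : forall k : vec, (forall i, (i < m)%nat -> k i = 0) -> vsum m (fun j => k j * v j) = 0).
      { intros k Hk. rewrite (vsum_ext m _ (fun _ => 0)), vsum_const; [ring|].
        intros i Hi. rewrite Hk; [ring|easy]. }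
      rewrite E in * by auto. rewrite h0, Rabs_R0, !Rminus_0_r, Rabs_Rabsolu in *. easy.
    + destruct (Rtotal_order (f x) 0) as [h'|[h'|h']]; [|easy|].
      * exists (fun i => -1 * g i). apply (hasd_outer m f x g Rabs); [now apply Rabs_derive_2|easy].
      * exists (fun i => 1 * g i). apply (hasd_outer m f x g Rabs); [now apply Rabs_derive_1|easy].
Qed.

Lemma archimed_nat x : exists n, x < INR (S n).
Proof.
  destruct (INR_unbounded x) as [n Hn]. exists n. rewrite S_INR. lra.
Qed.

(** In a thin double cone around the i-th axis the term [g i * h i] dominates the other partial
    terms and the error. One integer controls both the aperture and the height of the cone, so
    countably many cones suffice. *)
Lemma hasd_zero_cone m f x g i : hasd m f x g -> f x = 0 -> (i < m)%nat -> g i <> 0 ->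
  exists K, forall h, supn m h <= / INR (S K) ->
    (forall j, (j < m)%nat -> j <> i -> INR (S K) * Rabs (h j) <= Rabs (h i)) -> h i <> 0 ->
    f (vadd x h) <> 0.
Proof.
  intros H H0 Hi Hg. assert (Hg' : 0 < Rabs (g i)) by now apply Rabs_pos_lt.
  destruct (H (Rabs (g i) / 4)) as [d [Hd Hf]]; [lra|].
  set (S0 := INR m * supn m g).
  assert (HS0 : 0 <= S0) by (apply Rmult_le_pos; [apply pos_INR|apply supn_nonneg]).
  (* The first bound puts the cone inside the ball where the derivative estimate holds, the second
     keeps the other partial terms below a quarter of |g i h i|. *)
  destruct (archimed_nat (Rmax (/ d) (4 * S0 / Rabs (g i)))) as [K HK].
  assert (HK1 : / d < INR (S K)) by (eapply Rle_lt_trans; [apply Rmax_l|exact HK]).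
  assert (HK2 : 4 * S0 / Rabs (g i) < INR (S K)) by (eapply Rle_lt_trans; [apply Rmax_r|exact HK]).
  assert (HKp : 1 <= INR (S K)) by (rewrite S_INR; pose proof (pos_INR K); lra).
  exists K. intros h Hh Hc Hhi.
  assert (Hhd : supn m h < d).
  { eapply Rle_lt_trans; [exact Hh|]. rewrite <- (Rinv_inv d). apply Rinv_lt_contravar; [|easy].
    apply Rmult_lt_0_compat; [now apply Rinv_0_lt_compat|lra]. }
  specialize (Hf h Hhd). rewrite H0, Rminus_0_r in Hf.
  assert (Hhi' : 0 < Rabs (h i)) by now apply Rabs_pos_lt.
  assert (Hsup : supn m h <= Rabs (h i)).
  { apply supn_le; [lra|]. intros j Hj. destruct (Nat.eq_dec j i) as [->|Hne]; [lra|].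
    specialize (Hc j Hj Hne). pose proof (Rabs_pos (h j)). nra. }
  intros Hz. rewrite Hz in Hf.
  set (h' := fun j => if Nat.eqb j i then 0 else g j * h j).
  assert (Hs : vsum m (fun j => g j * h j) = g i * h i + vsum m h').
  { replace (g i * h i) with (vsum m (fun j => if Nat.eqb j i then g i * h i else 0)).
    2:{ rewrite (vsum_single m i); [now rewrite Nat.eqb_refl|easy|].
        intros j _ Hj. apply Nat.eqb_neq in Hj. now rewrite Hj. }
    rewrite <- vsum_plus. apply vsum_ext. intros j _. unfold h'.
    destruct (Nat.eqb_spec j i) as [->|]; ring. }
  assert (Hb : Rabs (vsum m h') <= INR m * (supn m g * (Rabs (h i) / INR (S K)))).
  { apply vsum_abs_le. intros j Hj. unfold h'. destruct (Nat.eqb_spec j i) as [->|Hne].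
    - rewrite Rabs_R0. apply Rmult_le_pos; [apply supn_nonneg|]. apply Rdiv_le_0_compat; lra.
    - rewrite Rabs_mult. apply Rmult_le_compat; try apply Rabs_pos; [now apply supn_ge|].
      specialize (Hc j Hj Hne). apply (Rmult_le_reg_l (INR (S K))); [lra|].
      replace (INR (S K) * (Rabs (h i) / INR (S K))) with (Rabs (h i)) by (field; lra). easy. }
  assert (Hb2 : INR m * (supn m g * (Rabs (h i) / INR (S K))) <= Rabs (g i) / 4 * Rabs (h i)).
  { replace (INR m * (supn m g * (Rabs (h i) / INR (S K)))) with (S0 / INR (S K) * Rabs (h i)) by (unfold S0; field; lra).
    apply Rmult_le_compat_r; [lra|]. apply (Rmult_le_reg_r (INR (S K))); [lra|].
    replace (S0 / INR (S K) * INR (S K)) with S0 by (field; lra).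
    apply (Rmult_lt_compat_l (Rabs (g i))) in HK2; [|easy].
    replace (Rabs (g i) * (4 * S0 / Rabs (g i))) with (4 * S0) in HK2 by (field; lra). lra. }
  rewrite Hs in Hf.
  replace (0 - (g i * h i + vsum m h')) with (- (g i * h i + vsum m h')) in Hf by ring.
  rewrite Rabs_Ropp in Hf.
  pose proof (Rabs_triang (g i * h i + vsum m h') (- vsum m h')) as Ht.
  replace (g i * h i + vsum m h' + - vsum m h') with (g i * h i) in Ht by ring.
  rewrite Rabs_Ropp, Rabs_mult in Ht.
  assert (Rabs (g i) / 4 * supn m h <= Rabs (g i) / 4 * Rabs (h i)) by (apply Rmult_le_compat_l; lra).
  nra.
Qed.

Lemma abs_tri3 a b c : Rabs (a - b) <= Rabs (a - c) + Rabs (b - c).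
Proof.
  replace (a - b) with ((a - c) + - (b - c)) by ring.
  eapply Rle_trans; [apply Rabs_triang|]. rewrite Rabs_Ropp. lra.
Qed.

(* Columns of the cube [-1,1]^m parallel to the i-th axis; on each of them the set is pinched into a cube of size O(1/n). *)
Lemma null_graph m (N : vec -> Prop) i K : (i < m)%nat -> 1 <= K ->
  (forall x, N x -> supn m x <= 1) ->
  (forall x y d, N x -> N y -> (forall j, (j < m)%nat -> j <> i -> Rabs (y j - x j) <= d) -> 0 <= d ->
     Rabs (y i - x i) <= K * d) ->
  null_set m N.
Proof.
  intros Hi HK HN HG. apply null_cubes; [lia|]. intros eps He.
  (* Q^(m-1) columns with one cube of half side 2K/Q each have total volume (4K)^m/Q. *)
  destruct (archimed_nat ((4 * K) ^ m / eps)) as [n Hn].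
  set (Q := S n) in *. assert (HQ : 0 < INR Q) by (apply lt_0_INR; unfold Q; lia).
  destruct m as [|p]; [lia|].
  set (sg := fun j => if (j <? i)%nat then j else S j).
  set (inC := fun c x => N x /\ forall j, (j < p)%nat -> Rabs (x (sg j) - gridpt Q c j) <= / INR Q).
  (* Each cube is centred at an arbitrary point of the set in its column; for an empty column the
     centre is irrelevant. *)
  exists (Q ^ p)%nat, (fun c => epsilon (inhabits (fun _ => 0)) (inC c)), (2 * K / INR Q).
  split; [apply Rdiv_le_0_compat; lra|]. split.
  - intros x Hx. destruct (grid_cover p Q (fun j => x (sg j))) as [c [Hc Hg]].
    + unfold Q; lia.
    + apply supn_le; [lra|]. intros j Hj. eapply Rle_trans; [|now apply (HN x)].
      apply (supn_ge (S p) x (sg j)). unfold sg. destruct (Nat.ltb_spec j i); lia.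
    + exists c. split; [easy|]. intros j Hj.
      assert (Hrep : inC c (epsilon (inhabits (fun _ => 0)) (inC c))).
      { apply epsilon_spec. exists x. split; easy. }
      set (y := epsilon _ _) in *. destruct Hrep as [Hy Hyg].
      assert (Hd : forall j, (j < S p)%nat -> j <> i -> Rabs (x j - y j) <= 2 / INR Q).
      { intros l Hl Hne. assert (exists q, (q < p)%nat /\ sg q = l) as [q [Hq Hsq]].
        { unfold sg. destruct (le_lt_dec i l) as [h|h].
          - exists (l - 1)%nat. destruct (Nat.ltb_spec (l - 1) i); lia.
          - exists l. destruct (Nat.ltb_spec l i); lia. }
        specialize (Hg q Hq). specialize (Hyg q Hq). cbv beta in Hg. rewrite Hsq in *.
        pose proof (abs_tri3 (x l) (y l) (gridpt Q c q)). lra. }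
      assert (H2Q : 0 <= 2 / INR Q) by (apply Rdiv_le_0_compat; lra).
      replace (2 * K / INR Q) with (K * (2 / INR Q)) by (field; lra).
      destruct (Nat.eq_dec j i) as [->|Hne].
      * apply HG; auto.
      * specialize (Hd j Hj Hne). nra.
  - replace (INR (Q ^ p) * (2 * (2 * K / INR Q)) ^ S p) with ((4 * K) ^ S p / INR Q).
    + apply (Rmult_le_reg_r (INR Q)); [easy|]. unfold Rdiv. rewrite Rmult_assoc, Rinv_l, Rmult_1_r by lra.
      apply (Rmult_lt_compat_l eps) in Hn; [|easy].
      replace (eps * ((4 * K) ^ S p / eps)) with ((4 * K) ^ S p) in Hn by (field; lra). lra.
    + replace (2 * (2 * K / INR Q)) with ((4 * K) * / INR Q) by (field; lra).
      rewrite pow_INR, (Rpow_mult_distr (4 * K)), pow_inv. cbn [pow].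
      assert (INR Q ^ p <> 0) by (apply pow_nonzero; lra). field. repeat split; lra.
Qed.

(* Where f = 0 and Df <> 0, the zero set of f is locally a Lipschitz graph; this is the bad set of |f|. *)
Lemma null_zero_set m f : (0 < m)%nat -> null_set m (fun x => supn m x <= 1 /\ f x = 0 /\
  exists g i, hasd m f x g /\ (i < m)%nat /\ g i <> 0).
Proof.
  intros Hm. set (Q := fun i K (x : vec) => forall h, supn m h <= / INR (S K) ->
    (forall j, (j < m)%nat -> j <> i -> INR (S K) * Rabs (h j) <= Rabs (h i)) -> h i <> 0 ->
    f (vadd x h) <> 0).
  (* Zeros are sorted by coordinate, cone size and grid cell. Two points in one cell differ by at
     most 1/(K+1) in each coordinate, so each is within the height of the cone of the other. *)
  apply (null_subset _ _ (fun x => exists i, exists K, exists b,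
    (i < m)%nat /\ supn m x <= 1 /\ f x = 0 /\ Q i K x /\
    forall j, (j < m)%nat -> Rabs (x j - gridpt (2 * S K) b j) <= / INR (2 * S K))).
  { intros x [Hx [Hf [g [i [Hg [Hi Hgi]]]]]].
    destruct (hasd_zero_cone m f x g i Hg Hf Hi Hgi) as [K HK].
    destruct (grid_cover m (2 * S K) x) as [b [_ Hb]]; [lia|easy|].
    exists i, K, b. auto. }
  apply null_union; intros i. apply null_union; intros K. apply null_union; intros b.
  destruct (le_lt_dec m i) as [Hi|Hi].
  { apply (null_subset _ _ (fun x => False)); [intros x [h _]; lia|]. now apply null_empty. }
  assert (HKp : 1 <= INR (S K)) by (rewrite S_INR; pose proof (pos_INR K); lra).
  apply (null_graph m _ i (INR (S K))); [easy|easy|now intros x [_ [h _]]|].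
  intros x y d [_ [_ [Hfx [Hqx Hbx]]]] [_ [_ [Hfy [_ Hby]]]] Hd Hd0.
  destruct (Rle_dec (Rabs (y i - x i)) (INR (S K) * d)) as [h|h]; [easy|exfalso].
  apply (Hqx (vsub y x)).
  - apply supn_le; [left; apply Rinv_0_lt_compat; lra|]. intros j Hj. unfold vsub.
    eapply Rle_trans; [apply (abs_tri3 _ _ (gridpt (2 * S K) b j))|].
    specialize (Hbx j Hj). specialize (Hby j Hj).
    replace (/ INR (S K)) with (/ INR (2 * S K) + / INR (2 * S K)); [lra|].
    rewrite mult_INR. simpl (INR 2). field. lra.
  - intros j Hj Hne. unfold vsub. specialize (Hd j Hj Hne). nra.
  - unfold vsub. intros h0. rewrite h0, Rabs_R0 in h. nra.
  - replace (vadd x (vsub y x)) with y; [easy|].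
    apply FunctionalExtensionality.functional_extensionality. intros j. unfold vadd, vsub. ring.
Qed.

(* Piecewise smooth functions, as a syntactic class. Unlike a.e. differentiability it is stable under substitution,
   and it makes Rademacher's theorem unnecessary. *)
Inductive PS (m : nat) : (vec -> R) -> Prop :=
| ps_coord i : (i < m)%nat -> PS m (fun x => x i)
| ps_const c : PS m (fun _ => c)
| ps_add f g : PS m f -> PS m g -> PS m (fun x => f x + g x)
| ps_mul f g : PS m f -> PS m g -> PS m (fun x => f x * g x)
| ps_abs f : PS m f -> PS m (fun x => Rabs (f x))
| ps_inv f c : 0 < c -> (forall x, c <= f x) -> PS m f -> PS m (fun x => / f x)
| ps_sqrt f c : 0 < c -> (forall x, c <= f x) -> PS m f -> PS m (fun x => sqrt (f x)).

Lemma ps_ext m f f' : (forall x, f x = f' x) -> PS m f -> PS m f'.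
Proof.
  intros H. now replace f' with f by (apply FunctionalExtensionality.functional_extensionality; exact H).
Qed.

Lemma ps_diff m f : (0 < m)%nat -> PS m f ->
  exists N, null_set m N /\ forall x, supn m x <= 1 -> ~ N x -> exists g, hasd m f x g.
Proof.
  intros Hm. induction 1 as [i Hi|c|f g Hf [N [HN H]] Hg [N' [HN' H']]|f g Hf [N [HN H]] Hg [N' [HN' H']]
    |f Hf [N [HN H]]|f c Hc Hb Hf [N [HN H]]|f c Hc Hb Hf [N [HN H]]].
  - exists (fun _ => False). split; [now apply null_empty|]. intros x _ _. eexists. now apply hasd_coord.
  - exists (fun _ => False). split; [now apply null_empty|]. intros x _ _. eexists. now apply hasd_const.
  - exists (fun x => N x \/ N' x). split; [now apply null_or|]. intros x Hx Hn.
    destruct (H x) as [u Hu]; [easy|tauto|]. destruct (H' x) as [u' Hu']; [easy|tauto|].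
    eexists. apply hasd_add; eauto.
  - exists (fun x => N x \/ N' x). split; [now apply null_or|]. intros x Hx Hn.
    destruct (H x) as [u Hu]; [easy|tauto|]. destruct (H' x) as [u' Hu']; [easy|tauto|].
    eapply hasd_mul; eauto.
  - eexists. split; [apply (null_or _ _ _ HN (null_zero_set m f Hm))|]. intros x Hx Hn.
    destruct (H x) as [u Hu]; [easy|tauto|]. apply (hasd_abs m f x u Hu).
    destruct (Req_dec (f x) 0) as [h0|h0]; [|now left]. right. intros i Hi.
    apply NNPP. intros hu. apply Hn. right. eauto 10.
  - exists N. split; [easy|]. intros x Hx Hn. destruct (H x Hx Hn) as [u Hu].
    specialize (Hb x). eexists. apply (hasd_outer m f x u Rinv); [|exact Hu].
    eapply (derivable_pt_lim_ext (fun t => (fct_cte 1 / id)%F t)).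
    + intros t. unfold div_fct, fct_cte, id, Rdiv. ring.
    + apply derivable_pt_lim_div; [apply derivable_pt_lim_const|apply derivable_pt_lim_id|unfold id; lra].
  - exists N. split; [easy|]. intros x Hx Hn. destruct (H x Hx Hn) as [u Hu].
    specialize (Hb x). eexists. apply (hasd_outer m f x u sqrt); [|exact Hu].
    apply derivable_pt_lim_sqrt. lra.
Qed.

(** For reciprocals and square roots the bound rests on the lower bound [c], which is why every
    denominator below is guarded by a maximum. *)
Lemma ps_lip m f : PS m f -> forall r, 0 <= r -> exists L B, 0 <= L /\ 0 <= B /\
  (forall x, supn m x <= r -> Rabs (f x) <= B) /\
  forall x y, supn m x <= r -> supn m y <= r -> Rabs (f x - f y) <= L * sdist m x y.
Proof.
  intros Hps r Hr. induction Hps as [i Hi|c|f g Hf [L [B [HL [HB [H1 H2]]]]] Hg [L' [B' [HL' [HB' [H1' H2']]]]]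
    |f g Hf [L [B [HL [HB [H1 H2]]]]] Hg [L' [B' [HL' [HB' [H1' H2']]]]]
    |f Hf [L [B [HL [HB [H1 H2]]]]]|f c Hc Hb Hf [L [B [HL [HB [H1 H2]]]]]|f c Hc Hb Hf [L [B [HL [HB [H1 H2]]]]]].
  - exists 1, r. repeat split; try lra.
    + intros x Hx. eapply Rle_trans; [apply (supn_ge m x i Hi)|exact Hx].
    + intros x y _ _. rewrite Rmult_1_l. now apply sdist_ge.
  - exists 0, (Rabs c). repeat split; try lra; try apply Rabs_pos; [intros; lra|].
    intros x y _ _. rewrite Rminus_diag, Rabs_R0. lra.
  - exists (L + L'), (B + B'). repeat split; try lra.
    + intros x Hx. eapply Rle_trans; [apply Rabs_triang|]. specialize (H1 x Hx); specialize (H1' x Hx). lra.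
    + intros x y Hx Hy. replace (f x + g x - (f y + g y)) with ((f x - f y) + (g x - g y)) by ring.
      eapply Rle_trans; [apply Rabs_triang|]. specialize (H2 x y Hx Hy). specialize (H2' x y Hx Hy). lra.
  - exists (L * B' + B * L'), (B * B'). repeat split; try nra.
    + intros x Hx. rewrite Rabs_mult. apply Rmult_le_compat; try apply Rabs_pos; auto.
    + intros x y Hx Hy. replace (f x * g x - f y * g y) with ((f x - f y) * g x + f y * (g x - g y)) by ring.
      eapply Rle_trans; [apply Rabs_triang|]. rewrite !Rabs_mult.
      assert (Rabs (f x - f y) * Rabs (g x) <= (L * sdist m x y) * B') by (apply Rmult_le_compat; try apply Rabs_pos; auto).
      assert (Rabs (f y) * Rabs (g x - g y) <= B * (L' * sdist m x y)) by (apply Rmult_le_compat; try apply Rabs_pos; auto).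
      lra.
  - exists L, B. repeat split; try lra.
    + intros x Hx. rewrite Rabs_Rabsolu. auto.
    + intros x y Hx Hy. eapply Rle_trans; [apply Rabs_triang_inv2|]. auto.
  - exists (L * (/ c * / c)), (/ c). assert (Hc' : 0 < / c) by now apply Rinv_0_lt_compat.
    assert (Hi : forall x, 0 < / f x <= / c).
    { intros x. specialize (Hb x). split; [apply Rinv_0_lt_compat; lra|]. apply Rinv_le_contravar; lra. }
    repeat split; try nra.
    + intros x Hx. rewrite Rabs_pos_eq by (left; apply Hi). apply Hi.
    + intros x y Hx Hy. replace (/ f x - / f y) with ((f y - f x) * (/ f x * / f y))
        by (field; pose proof (Hb x); pose proof (Hb y); lra).
      rewrite Rabs_mult, Rabs_minus_sym.
      replace (L * (/ c * / c) * sdist m x y) with (L * sdist m x y * (/ c * / c)) by ring.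
      apply Rmult_le_compat; try apply Rabs_pos; [auto|].
      rewrite Rabs_pos_eq by (apply Rmult_le_pos; left; apply Hi).
      apply Rmult_le_compat; try apply Hi; left; apply Hi.
  - exists (L * / sqrt c), (sqrt B).
    assert (Hs : 0 < sqrt c) by now apply sqrt_lt_R0.
    assert (Hsc : forall x, sqrt c <= sqrt (f x)) by (intros x; apply sqrt_le_1_alt, Hb).
    repeat split.
    + apply Rmult_le_pos; [easy|]. left; now apply Rinv_0_lt_compat.
    + apply sqrt_pos.
    + intros x Hx. rewrite Rabs_pos_eq by apply sqrt_pos. apply sqrt_le_1_alt.
      specialize (H1 x Hx). eapply Rle_trans; [apply Rle_abs|exact H1].
    + intros x y Hx Hy. specialize (H2 x y Hx Hy). pose proof (Hsc x) as Hx'; pose proof (Hsc y) as Hy'.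
      pose proof (Hb x); pose proof (Hb y).
      assert (E : f x - f y = (sqrt (f x) - sqrt (f y)) * (sqrt (f x) + sqrt (f y))).
      { pose proof (sqrt_sqrt (f x) ltac:(lra)). pose proof (sqrt_sqrt (f y) ltac:(lra)). lra. }
      rewrite E, Rabs_mult, (Rabs_pos_eq (_ + _)) in H2 by lra.
      pose proof (Rabs_pos (sqrt (f x) - sqrt (f y))) as Hp.
      apply (Rmult_le_reg_r (sqrt c)); [easy|].
      replace (L * / sqrt c * sdist m x y * sqrt c) with (L * sdist m x y) by (field; lra).
      eapply Rle_trans; [|exact H2]. apply Rmult_le_compat_l; lra.
Qed.

(** A special case of the Lipschitz bound: points that agree in the first [m] coordinates have sup
    distance 0. *)
Lemma ps_dep m f x y : PS m f -> (forall i, (i < m)%nat -> x i = y i) -> f x = f y.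
Proof.
  intros Hf H. destruct (ps_lip m f Hf (supn m x) (supn_nonneg _ _)) as [L [B [_ [_ [_ HL]]]]].
  specialize (HL x y (Rle_refl _)). rewrite (supn_ext m y x) in HL by (intros; symmetry; auto).
  specialize (HL (Rle_refl _)). rewrite sdist_same, Rmult_0_r in HL by easy.
  pose proof (Rabs_pos (f x - f y)). destruct (Req_dec (f x - f y) 0) as [h|h]; [lra|].
  apply Rabs_no_R0 in h. lra.
Qed.

(** The lower bounds in [ps_inv] and [ps_sqrt] hold at all points and therefore survive any
    substitution; this is what keeps the iterates piecewise smooth. *)
Lemma ps_subst m q f (G : vec -> vec) : PS q f -> (forall i, (i < q)%nat -> PS m (fun x => G x i)) ->
  PS m (fun x => f (G x)).
Proof.
  intros Hf HG. induction Hf as [i Hi|c|f g _ IH _ IH'|f g _ IH _ IH'|f _ IH|f c Hc Hb _ IH|f c Hc Hb _ IH].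
  - now apply HG.
  - apply ps_const.
  - exact (ps_add m _ _ IH IH').
  - exact (ps_mul m _ _ IH IH').
  - exact (ps_abs m _ IH).
  - exact (ps_inv m _ c Hc (fun x => Hb (G x)) IH).
  - exact (ps_sqrt m _ c Hc (fun x => Hb (G x)) IH).
Qed.

Lemma ps_scal m c f : PS m f -> PS m (fun x => c * f x).
Proof. intros H. apply ps_mul; [apply ps_const|easy]. Qed.

Lemma ps_opp m f : PS m f -> PS m (fun x => - f x).
Proof. intros H. apply (ps_ext m (fun x => -1 * f x)); [intros; ring|]. now apply ps_scal. Qed.

Lemma ps_sub m f g : PS m f -> PS m g -> PS m (fun x => f x - g x).
Proof. intros Hf Hg. apply (ps_add m f (fun x => - g x)); [easy|now apply ps_opp]. Qed.

Lemma ps_max m f g : PS m f -> PS m g -> PS m (fun x => Rmax (f x) (g x)).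
Proof.
  intros Hf Hg. apply (ps_ext m (fun x => / 2 * (f x + g x + Rabs (f x - g x)))).
  - intros x. unfold Rmax. destruct (Rle_dec (f x) (g x)).
    + rewrite Rabs_left1; lra.
    + rewrite Rabs_pos_eq; lra.
  - apply ps_scal, ps_add; [now apply ps_add|apply ps_abs; now apply ps_sub].
Qed.

Lemma ps_min m f g : PS m f -> PS m g -> PS m (fun x => Rmin (f x) (g x)).
Proof.
  intros Hf Hg. apply (ps_ext m (fun x => - Rmax (- f x) (- g x))).
  - intros x. unfold Rmin, Rmax. destruct (Rle_dec (f x) (g x)); destruct (Rle_dec (- f x) (- g x)); lra.
  - apply ps_opp, ps_max; now apply ps_opp.
Qed.

Lemma ps_vsum m p (F : nat -> vec -> R) : (forall i, (i < p)%nat -> PS m (F i)) -> PS m (fun x => vsum p (fun i => F i x)).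
Proof. induction p; intros H; simpl; [apply ps_const|]. apply ps_add; auto. Qed.

Lemma ps_supn m p (G : vec -> vec) : (forall i, (i < p)%nat -> PS m (fun x => G x i)) -> PS m (fun x => supn p (G x)).
Proof. induction p; intros H; simpl; [apply ps_const|]. apply ps_max; [auto|apply ps_abs; auto]. Qed.

Definition clamp (a b t : R) : R := Rmin b (Rmax a t).

Lemma ps_clamp m a b f : PS m f -> PS m (fun x => clamp a b (f x)).
Proof. intros H. apply ps_min; [apply ps_const|apply ps_max; [apply ps_const|easy]]. Qed.

Lemma clamp_range a b t : a <= b -> a <= clamp a b t <= b.
Proof. intros H. unfold clamp, Rmin, Rmax. destruct (Rle_dec a t), (Rle_dec b _); lra. Qed.

Lemma clamp_id a b t : a <= t <= b -> clamp a b t = t.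
Proof. intros H. unfold clamp, Rmin, Rmax. destruct (Rle_dec a t), (Rle_dec b _); lra. Qed.

Lemma clamp_hi a b t : a <= b <= t -> clamp a b t = b.
Proof. intros H. unfold clamp, Rmin, Rmax. destruct (Rle_dec a t), (Rle_dec b _); lra. Qed.

Lemma clamp_lo a b t : t <= a <= b -> clamp a b t = a.
Proof. intros H. unfold clamp, Rmin, Rmax. destruct (Rle_dec a t), (Rle_dec b _); lra. Qed.

Lemma clamp_lip a b t u : Rabs (clamp a b t - clamp a b u) <= Rabs (t - u).
Proof.
  unfold clamp, Rmin, Rmax. destruct (Rle_dec a t), (Rle_dec b _), (Rle_dec a u), (Rle_dec b _);
  apply Rabs_le; pose proof (Rle_abs (t - u)); pose proof (Rle_abs (u - t));
  rewrite (Rabs_minus_sym u t) in *; lra.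
Qed.

(** * Compactness and McShane extensions *)

(** Passage to the nested pairs on which the compactness theorem is stated; [ofT] goes back. *)
Fixpoint toT (m : nat) (x : vec) : Tn m R :=
  match m with O => tt | S m' => (x O, toT m' (fun i => x (S i))) end.

Fixpoint ofT (m : nat) : Tn m R -> vec :=
  match m with
  | O => fun _ _ => 0
  | S m' => fun t i => match i with O => fst t | S i' => ofT m' (snd t) i' end
  end.

Lemma bounded_toT m r x : supn m x <= r ->
  bounded_n m (toT m (fun _ => - r)) (toT m (fun _ => r)) (toT m x).
Proof.
  intros H. assert (H' : forall i, (i < m)%nat -> - r <= x i <= r).
  { intros i Hi. apply Rabs_le_between. eapply Rle_trans; [now apply (supn_ge m x i)|easy]. }
  clear H. revert x H'. induction m; intros x H; simpl; [easy|]. split; [apply H; lia|].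
  apply IHm. intros; apply H; lia.
Qed.

Lemma bounded_ofT m r (t : Tn m R) : 0 <= r ->
  bounded_n m (toT m (fun _ => - r)) (toT m (fun _ => r)) t -> supn m (ofT m t) <= r.
Proof.
  intros Hr H. apply supn_le; [easy|]. revert t H. induction m; intros t H i Hi; [lia|].
  simpl in *. destruct t as [t0 t]. destruct H as [H0 H]. destruct i; simpl.
  - apply Rabs_le_between. easy.
  - apply IHm; [easy|lia].
Qed.

Lemma close_toT m d x (t : Tn m R) : close_n m d (toT m x) t ->
  forall i, (i < m)%nat -> Rabs (x i - ofT m t i) < d.
Proof.
  revert x t; induction m; intros x t H i Hi; [lia|]. simpl in *. destruct t as [t0 t].
  destruct H as [H0 H]. destruct i; simpl; [easy|]. apply (IHm (fun i => x (S i))); [easy|lia].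
Qed.

(** Each point t gets a gauge. If 0 <= g t, then f stays above f t / 2 nearby; otherwise g stays
    negative nearby and nothing is required. Compactness bounds the gauges below by one constant.
    [L + 1] avoids a division by 0. *)
Lemma ps_pos_lower_bound m f g r : 0 <= r -> PS m f -> PS m g ->
  (forall x, supn m x <= r -> 0 <= g x -> 0 < f x) ->
  exists d, 0 < d /\ forall x, supn m x <= r -> 0 <= g x -> d <= f x.
Proof.
  intros Hr Hf Hg H.
  destruct (ps_lip m f Hf r Hr) as [L [_ [HL [_ [_ HfL]]]]].
  destruct (ps_lip m g Hg r Hr) as [L' [_ [HL' [_ [_ HgL]]]]].
  assert (HD : forall t : vec, supn m t <= r -> exists d, 0 < d /\
    forall x, supn m x <= r -> sdist m x t <= d -> 0 <= g x -> d <= f x).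
  { intros t Ht. destruct (Rle_dec 0 (g t)) as [h|h].
    - specialize (H t Ht h). exists (f t / (2 * (L + 1))).
      assert (Hd : 0 < f t / (2 * (L + 1))) by (apply Rdiv_lt_0_compat; lra). split; [easy|].
      intros x Hx Hxt _. specialize (HfL x t Hx Ht).
      assert (L * sdist m x t <= f t / 2).
      { apply Rle_trans with ((L + 1) * (f t / (2 * (L + 1)))).
        - apply Rmult_le_compat; try lra. apply sdist_nonneg.
        - apply Req_le. field. lra. }
      assert (f t / (2 * (L + 1)) <= f t / 2).
      { unfold Rdiv. apply Rmult_le_compat_l; [lra|]. apply Rinv_le_contravar; lra. }
      apply Rabs_le_between in HfL. lra.
    - exists (- g t / (2 * (L' + 1))).
      assert (Hd : 0 < - g t / (2 * (L' + 1))) by (apply Rdiv_lt_0_compat; lra). split; [easy|].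
      intros x Hx Hxt Hgx. exfalso. specialize (HgL x t Hx Ht).
      assert (L' * sdist m x t <= - g t / 2).
      { apply Rle_trans with ((L' + 1) * (- g t / (2 * (L' + 1)))).
        - apply Rmult_le_compat; try lra. apply sdist_nonneg.
        - apply Req_le. field. lra. }
      apply Rabs_le_between in HgL. lra. }
  assert (HD' : forall t : Tn m R, exists d : posreal, supn m (ofT m t) <= r ->
    forall x, supn m x <= r -> sdist m x (ofT m t) <= d -> 0 <= g x -> d <= f x).
  { intros t. destruct (Rle_dec (supn m (ofT m t)) r) as [h|h].
    - destruct (HD _ h) as [d [Hd Hx]]. now exists (mkposreal d Hd).
    - now exists (mkposreal 1 Rlt_0_1). }
  set (delta := fun t => proj1_sig (constructive_indefinite_description _ (HD' t))).
  assert (Hdel : forall t, supn m (ofT m t) <= r ->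
    forall x, supn m x <= r -> sdist m x (ofT m t) <= delta t -> 0 <= g x -> delta t <= f x).
  { intros t. apply (proj2_sig (constructive_indefinite_description _ (HD' t))). }
  clearbody delta.
  destruct (compactness_value m (toT m (fun _ => - r)) (toT m (fun _ => r)) delta) as [d Hd].
  exists d. split; [apply cond_pos|]. intros x Hx Hgx.
  (* The compactness theorem asserts the existence of the centre t under a double negation. *)
  destruct (NNPP _ (Hd (toT m x) (bounded_toT m r x Hx))) as [t [Hb [Hc Hdt]]].
  apply bounded_ofT in Hb; [|easy]. eapply Rle_trans; [exact Hdt|].
  apply Hdel; auto. apply sdist_le; [left; apply cond_pos|]. intros i Hi. left. now apply close_toT.
Qed.

(** One point of [A] is kept from each grid cell that meets [A]; the net thus lies in [A], whatever
    the nature of that set. *)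
Lemma finite_net m (A : vec -> Prop) eta : 0 < eta -> (forall x, A x -> supn m x <= 1) ->
  exists l, (forall a, In a l -> A a) /\ forall x, A x -> exists a, In a l /\ sdist m x a <= eta.
Proof.
  intros He HA. destruct (archimed_nat (2 / eta)) as [n Hn]. set (Q := S n) in *.
  assert (HQ : 0 < INR Q) by (apply lt_0_INR; unfold Q; lia).
  assert (H2 : 2 * / INR Q <= eta).
  { apply (Rmult_le_reg_r (INR Q)); [easy|]. rewrite Rmult_assoc, Rinv_l by lra.
    apply (Rmult_lt_compat_l eta) in Hn; [|easy].
    replace (eta * (2 / eta)) with 2 in Hn by (field; lra). lra. }
  set (near := fun c x => A x /\ forall i, (i < m)%nat -> Rabs (x i - gridpt Q c i) <= / INR Q).
  assert (HP : forall k, exists l, (forall a, In a l -> A a) /\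
     forall x c, (c < k)%nat -> near c x -> exists a, In a l /\ sdist m x a <= eta).
  { induction k as [|k [l [Hl IH]]].
    - exists nil. split; [easy|]. intros; lia.
    - destruct (classic (exists y, near k y)) as [[y Hy]|Hno].
      + exists (y :: l). split.
        * intros a [<-|Ha]; [apply Hy|auto].
        * intros x c Hc Hx. destruct (Nat.eq_dec c k) as [->|Hne].
          -- exists y. split; [now left|]. apply sdist_le; [lra|]. intros i Hi.
             pose proof (abs_tri3 (x i) (y i) (gridpt Q k i)).
             pose proof (proj2 Hx i Hi). pose proof (proj2 Hy i Hi). lra.
          -- destruct (IH x c) as [a [Ha Hd]]; [lia|easy|]. exists a. split; [now right|easy].
      + exists l. split; [easy|]. intros x c Hc Hx. destruct (Nat.eq_dec c k) as [->|Hne].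
        * destruct Hno. now exists x.
        * apply (IH x c); [lia|easy]. }
  destruct (HP (Q ^ m)%nat) as [l [Hl H]]. exists l. split; [easy|]. intros x Hx.
  destruct (grid_cover m Q x) as [c [Hc Hg]]; [unfold Q; lia|auto|].
  apply (H x c Hc). now split.
Qed.

(** McShane's extension formula cut off at [B]. Over a finite list it is a finite minimum, hence
    piecewise smooth. *)
Definition mcshane (m : nat) (L B : R) (v : vec -> R) (l : list vec) (x : vec) : R :=
  fold_right (fun a acc => Rmin (v a + L * sdist m x a) acc) B l.

Lemma mcshane_ps m L B v l : PS m (mcshane m L B v l).
Proof.
  induction l as [|a l IH]; [apply (ps_const m B)|].
  apply (ps_min m (fun x => v a + L * sdist m x a)); [|exact IH].
  apply ps_add; [apply ps_const|]. apply ps_scal.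
  apply (ps_supn m m (fun x => vsub x a)). intros i Hi. unfold vsub.
  apply ps_sub; [now apply ps_coord|apply ps_const].
Qed.

Lemma Rmin_lip a b c d e : Rabs (a - b) <= e -> Rabs (c - d) <= e -> Rabs (Rmin a c - Rmin b d) <= e.
Proof.
  intros H1 H2. apply Rabs_le_between in H1, H2. apply Rabs_le_between.
  unfold Rmin. destruct (Rle_dec a c), (Rle_dec b d); lra.
Qed.

Lemma mcshane_lip m L B v l x y : 0 <= L -> Rabs (mcshane m L B v l x - mcshane m L B v l y) <= L * sdist m x y.
Proof.
  intros HL. pose proof (sdist_nonneg m x y). induction l as [|a l IH]; simpl.
  - rewrite Rminus_diag, Rabs_R0. nra.
  - apply Rmin_lip; [|exact IH].
    pose proof (sdist_tri m x y a). pose proof (sdist_tri m y x a). rewrite (sdist_sym m y x) in *.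
    apply Rabs_le_between. split; nra.
Qed.

Lemma mcshane_le m L B v l x a : In a l -> mcshane m L B v l x <= v a + L * sdist m x a.
Proof.
  induction l as [|b l IH]; intros Ha; [easy|]. simpl. destruct Ha as [->|Ha]; [apply Rmin_l|].
  eapply Rle_trans; [apply Rmin_r|auto].
Qed.

Lemma mcshane_ge m L B v l x c : c <= B -> (forall a, In a l -> c <= v a + L * sdist m x a) ->
  c <= mcshane m L B v l x.
Proof.
  intros HB H. induction l as [|a l IH]; simpl; [easy|]. apply Rmin_glb; [apply H; now left|].
  apply IH. intros; apply H; now right.
Qed.

Lemma mcshane_app m L B v l l' x :
  (forall a, In a l' -> mcshane m L B v l x <= v a + L * sdist m x a) ->
  mcshane m L B v (l' ++ l) x = mcshane m L B v l x.
Proof.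
  intros H. induction l' as [|a l' IH]; simpl; [easy|]. rewrite IH by (intros; apply H; now right).
  apply Rmin_right, H. now left.
Qed.

(** The distance to an eps/4-net of [A1], cut off at eps, is at most eps/4 on [A1] and at least eps
    on [A2]. Slope 4/eps around the level eps/2 sends these values to at least 1 and at most -2. *)
Lemma ps_separation m (A1 A2 : vec -> Prop) eps : 0 < eps -> (forall x, A1 x -> supn m x <= 1) ->
  (forall x y, A1 x -> A2 y -> eps <= sdist m y x) ->
  exists f, PS m f /\ (forall x, -1 <= f x <= 1) /\ (forall x, A1 x -> f x = 1) /\ (forall x, A2 x -> f x = -1).
Proof.
  intros He HA Hsep. destruct (finite_net m A1 (eps / 4)) as [l [Hl Hnet]]; [lra|easy|].
  exists (fun x => clamp (-1) 1 (4 / eps * (eps / 2 - mcshane m 1 eps (fun _ => 0) l x))).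
  split; [|split; [|split]].
  - apply ps_clamp, ps_scal, ps_sub; [apply ps_const|apply mcshane_ps].
  - intros x. apply clamp_range. lra.
  - intros x Hx. apply clamp_hi. split; [lra|]. destruct (Hnet x Hx) as [a [Ha Hd]].
    pose proof (mcshane_le m 1 eps (fun _ => 0) l x a Ha).
    apply Rle_trans with (4 / eps * (eps / 4)); [apply Req_le; field; lra|].
    apply Rmult_le_compat_l; [left; apply Rdiv_lt_0_compat; lra|lra].
  - intros x Hx. apply clamp_lo. split; [|lra].
    assert (eps <= mcshane m 1 eps (fun _ => 0) l x).
    { apply mcshane_ge; [lra|]. intros a Ha. specialize (Hsep a x (Hl a Ha) Hx). lra. }
    apply Rle_trans with (4 / eps * (- eps / 2)); [|replace (4 / eps * (- eps / 2)) with (-2) by (field; lra); lra].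
    apply Rmult_le_compat_l; [left; apply Rdiv_lt_0_compat; lra|lra].
Qed.

(** * Rank of a derivative *)

Definition skip (p j : nat) : nat := if (j <? p)%nat then j else S j.

Lemma vsum_skip p m f : (p <= m)%nat -> vsum (S m) f = f p + vsum m (fun j => f (skip p j)).
Proof.
  unfold skip. induction m; intros Hp.
  - simpl. replace p with O by lia. lra.
  - destruct (Nat.eq_dec p (S m)) as [->|Hne].
    + cbn [vsum]. rewrite (vsum_ext m f (fun j => f (if (j <? S m)%nat then j else S j))).
      * replace (m <? S m)%nat with true by (symmetry; apply Nat.ltb_lt; lia). lra.
      * intros j Hj. replace (j <? S m)%nat with true by (symmetry; apply Nat.ltb_lt; lia). easy.
    + change (vsum (S (S m)) f) with (vsum (S m) f + f (S m)). rewrite IHm by lia. cbn [vsum].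
      replace (m <? p)%nat with false by (symmetry; apply Nat.ltb_ge; lia). lra.
Qed.

(** Gaussian elimination: a vector with nonzero last coordinate serves as pivot and is subtracted
    from the others. If there is none, the last coordinate vanishes throughout and all but one of
    the vectors already satisfy a relation. *)
Lemma linear_dependence r (w : nat -> vec) :
  exists c : nat -> R, (forall i, (i < r)%nat -> vsum (S r) (fun j => c j * w j i) = 0) /\
    exists j, (j < S r)%nat /\ c j <> 0.
Proof.
  revert w; induction r; intros w.
  - exists (fun _ => 1). split; [intros; lia|]. exists O. split; [lia|lra].
  - destruct (classic (exists p, (p < S (S r))%nat /\ w p r <> 0)) as [[p [Hp Hw]]|Hno].
      destruct (IHr (fun j i => w (skip p j) i - w (skip p j) r / w p r * w p i)) as [c [Hc [j0 [Hj0 Hcj]]]].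
      set (a := - vsum (S r) (fun j => c j * (w (skip p j) r / w p r))).
      set (c' := fun j => if Nat.eqb j p then a else c (if (j <? p)%nat then j else pred j)).
      assert (Hsg : forall j, c' (skip p j) = c j).
      { intros j. unfold c', skip. destruct (Nat.ltb_spec j p).
        - rewrite (eqb_ne j p) by lia.
          now replace (j <? p)%nat with true by (symmetry; apply Nat.ltb_lt; lia).
        - rewrite (eqb_ne (S j) p) by lia.
          now replace (S j <? p)%nat with false by (symmetry; apply Nat.ltb_ge; lia). }
      exists c'. split.
      * intros i Hi. rewrite (vsum_skip p) by lia. cbv beta.
        rewrite (vsum_ext (S r) _ (fun j => c j * w (skip p j) i)) by (intros; now rewrite Hsg).
        replace (c' p) with a by (unfold c'; now rewrite Nat.eqb_refl).
        assert (E : vsum (S r) (fun j => c j * (w (skip p j) i - w (skip p j) r / w p r * w p i)) = 0).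
        { destruct (Nat.eq_dec i r) as [->|Hne]; [|apply Hc; lia].
          rewrite (vsum_ext (S r) _ (fun _ => 0)), vsum_const; [ring|]. intros; field; easy. }
        rewrite (vsum_ext (S r) _ (fun j => c j * w (skip p j) i + (- w p i) * (c j * (w (skip p j) r / w p r)))) in E
          by (intros; ring).
        rewrite vsum_plus, vsum_scal in E. unfold a. lra.
      * exists (skip p j0). rewrite Hsg. split; [|easy]. unfold skip. destruct (Nat.ltb_spec j0 p); lia.
    + destruct (IHr w) as [c [Hc [j0 [Hj0 Hcj]]]].
      exists (fun j => if Nat.eqb j (S r) then 0 else c j). split.
      * intros i Hi. change (vsum (S (S r)) ?f) with (vsum (S r) f + f (S r)). cbv beta.
        rewrite Nat.eqb_refl. rewrite (vsum_ext (S r) _ (fun j => c j * w j i)).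
        -- destruct (Nat.eq_dec i r) as [->|Hne]; [|rewrite Hc by lia; lra].
           rewrite (vsum_ext (S r) _ (fun _ => 0)), vsum_const; [ring|]. intros j Hj.
           replace (w j r) with 0; [ring|]. symmetry. apply NNPP. intros h. apply Hno. exists j. split; [lia|easy].
        -- intros j Hj. now rewrite (eqb_ne j (S r)) by lia.
      * exists j0. split; [lia|]. now rewrite (eqb_ne j0 (S r)) by lia.
Qed.

Lemma lin_indep_span q w : lin_indep q q w ->
  forall y : vec, exists c : nat -> R, forall i, (i < q)%nat -> vsum q (fun j => c j * w j i) = y i.
Proof.
  intros H y. destruct (linear_dependence q (fun j => if Nat.eqb j q then y else w j)) as [c [Hc [j0 [Hj0 Hcj]]]].
  assert (E : forall i, (i < q)%nat -> vsum q (fun j => c j * w j i) + c q * y i = 0).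
  { intros i Hi. specialize (Hc i Hi). cbn [vsum] in Hc. rewrite Nat.eqb_refl in Hc.
    rewrite (vsum_ext q _ (fun j => c j * w j i)) in Hc; [easy|]. intros j Hj.
    now rewrite (eqb_ne j q) by lia. }
  destruct (Req_dec (c q) 0) as [h|h].
  - exfalso. apply Hcj. destruct (Nat.eq_dec j0 q) as [->|Hne]; [easy|].
    apply (H c); [|lia]. intros i Hi. specialize (E i Hi). rewrite h in E. lra.
  - exists (fun j => - / c q * c j). intros i Hi. specialize (E i Hi).
    rewrite (vsum_ext q _ (fun j => - / c q * (c j * w j i))) by (intros; ring). rewrite vsum_scal.
    replace (vsum q (fun j => c j * w j i)) with (- (c q * y i)) by lra. field. easy.
Qed.

(** Rank n+1 would make the linear map onto R^(n+1), so a single missed vector suffices. *)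
Lemma rank_le_intro p n M (y : vec) : (forall h, exists i, (i < S n)%nat /\ mapply p M h i <> y i) -> rank_le p (S n) M n.
Proof.
  intros H [v Hv]. destruct (lin_indep_span _ _ Hv y) as [c Hc].
  destruct (H (fun j => vsum (S n) (fun l => c l * v l j))) as [i [Hi Hne]]. apply Hne.
  rewrite <- Hc by easy. unfold mapply.
  rewrite (vsum_ext p _ (fun j => vsum (S n) (fun l => c l * (M i j * v l j)))).
  - rewrite vsum_swap. apply vsum_ext. intros l _. now rewrite vsum_scal.
  - intros j _. rewrite <- vsum_scal. apply vsum_ext. intros; ring.
Qed.

Lemma hasd_vsum m q (F : nat -> vec -> R) x (g : nat -> vec) : (forall i, (i < q)%nat -> hasd m (F i) x (g i)) ->
  hasd m (fun y => vsum q (fun i => F i y)) x (fun j => vsum q (fun i => g i j)).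
Proof.
  induction q; intros H; simpl; [apply hasd_const|]. apply hasd_add; auto.
Qed.

Lemma hasd_line m f x g : hasd m f x g -> forall h eps, 0 < eps -> exists d, 0 < d /\
  forall t, Rabs t < d -> Rabs (f (vadd x (fun i => t * h i)) - f x - t * vsum m (fun j => g j * h j)) <= eps * Rabs t.
Proof.
  intros H h eps He. pose proof (supn_nonneg m h) as Hn.
  destruct (H (eps / (supn m h + 1))) as [d [Hd Hf]]; [apply Rdiv_lt_0_compat; lra|].
  exists (d / (supn m h + 1)). split; [apply Rdiv_lt_0_compat; lra|]. intros t Ht.
  assert (Hs : supn m (fun i => t * h i) < d).
  { rewrite supn_scal. apply Rle_lt_trans with (Rabs t * (supn m h + 1)).
    - apply Rmult_le_compat_l; [apply Rabs_pos|lra].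
    - apply (Rmult_lt_compat_r (supn m h + 1)) in Ht; [|lra].
      replace (d / (supn m h + 1) * (supn m h + 1)) with d in Ht by (field; lra). easy. }
  specialize (Hf _ Hs). rewrite supn_scal in Hf.
  rewrite (vsum_ext m _ (fun j => t * (g j * h j))) in Hf by (intros; ring). rewrite vsum_scal in Hf.
  eapply Rle_trans; [exact Hf|].
  replace (eps * Rabs t) with (eps / (supn m h + 1) * (Rabs t * (supn m h + 1))) by (field; lra).
  apply Rmult_le_compat_l; [left; apply Rdiv_lt_0_compat; lra|].
  apply Rmult_le_compat_l; [apply Rabs_pos|lra].
Qed.

Lemma hasd_max m f x g r : 0 < r -> hasd m f x g -> (forall y, sdist m y x < r -> f y <= f x) ->
  forall h, vsum m (fun j => g j * h j) = 0.
Proof.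
  intros Hr Hf Hmax h. set (s := vsum m (fun j => g j * h j)).
  destruct (Req_dec s 0) as [|Hs]; [easy|exfalso].
  assert (Hs' : 0 < Rabs s) by now apply Rabs_pos_lt.
  destruct (hasd_line m f x g Hf h (Rabs s / 2)) as [d [Hd Hl]]; [lra|]. fold s in Hl.
  pose proof (supn_nonneg m h) as Hn.
  set (t0 := Rmin (d / 2) (r / 2 / (supn m h + 1))).
  assert (Ht0 : 0 < t0).
  { apply Rmin_pos; [lra|]. apply Rdiv_lt_0_compat; lra. }
  assert (Ht1 : t0 <= d / 2) by apply Rmin_l.
  assert (Ht2 : t0 <= r / 2 / (supn m h + 1)) by apply Rmin_r.
  set (t := if Rle_dec 0 s then t0 else - t0).
  assert (Hat : Rabs t = t0).
  { unfold t. destruct (Rle_dec 0 s); [apply Rabs_pos_eq; lra|]. rewrite Rabs_Ropp. apply Rabs_pos_eq; lra. }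
  assert (Hts : t * s = t0 * Rabs s).
  { unfold t. destruct (Rle_dec 0 s); [rewrite (Rabs_pos_eq s); lra|]. rewrite (Rabs_left s); lra. }
  specialize (Hl t ltac:(lra)). rewrite Hat, Hts in Hl.
  assert (Hd2 : sdist m (vadd x (fun i => t * h i)) x < r).
  { apply Rle_lt_trans with (t0 * (supn m h + 1)).
    - apply sdist_le; [nra|]. intros i Hi. unfold vadd.
      replace (x i + t * h i - x i) with (t * h i) by ring. rewrite Rabs_mult, Hat.
      pose proof (supn_ge m h i Hi). nra.
    - apply (Rmult_le_compat_r (supn m h + 1)) in Ht2; [|lra].
      replace (r / 2 / (supn m h + 1) * (supn m h + 1)) with (r / 2) in Ht2 by (field; lra). lra. }
  specialize (Hmax _ Hd2). apply Rabs_le_between in Hl. nra.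
Qed.

Lemma has_derivative_intro p q (f : vec -> vec) x M :
  (forall i, (i < q)%nat -> hasd p (fun y => f y i) x (M i)) -> has_derivative p q f x M.
Proof.
  intros H eps He. assert (Hq : 0 < INR q + 1) by (pose proof (pos_INR q); lra).
  assert (HP : forall k, (k <= q)%nat -> exists d, 0 < d /\ forall h, supn p h < d -> forall i, (i < k)%nat ->
    Rabs (f (vadd x h) i - f x i - vsum p (fun j => M i j * h j)) <= eps / (INR q + 1) * supn p h).
  { induction k as [|k IH]; intros Hk.
    - exists 1. split; [lra|]. intros; lia.
    - destruct IH as [d [Hd IH]]; [lia|].
      destruct (H k Hk (eps / (INR q + 1))) as [d' [Hd' H']]; [apply Rdiv_lt_0_compat; lra|].
      exists (Rmin d d'). split; [now apply Rmin_pos|]. intros h Hh i Hi.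
      destruct (Nat.eq_dec i k) as [->|Hne].
      + apply H'. eapply Rlt_le_trans; [exact Hh|apply Rmin_r].
      + apply IH; [|lia]. eapply Rlt_le_trans; [exact Hh|apply Rmin_l]. }
  destruct (HP q (Nat.le_refl _)) as [d [Hd HF]]. exists d. split; [easy|]. intros h Hh.
  pose proof (supn_le_norm p h) as Hs. pose proof (supn_nonneg p h) as Hs0.
  specialize (HF h ltac:(lra)).
  eapply Rle_trans; [apply norm_le_supn|].
  apply Rle_trans with (INR q * (eps / (INR q + 1) * supn p h)).
  - apply Rmult_le_compat_l; [apply pos_INR|]. apply supn_le; [|exact HF].
    apply Rmult_le_pos; [left; apply Rdiv_lt_0_compat; lra|easy].
  - replace (INR q * (eps / (INR q + 1) * supn p h)) with (eps * (INR q / (INR q + 1) * supn p h)) by (field; lra).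
    apply Rmult_le_compat_l; [lra|]. apply Rle_trans with (1 * supn p h); [|lra].
    apply Rmult_le_compat_r; [easy|]. apply (Rmult_le_reg_r (INR q + 1)); [easy|].
    replace (INR q / (INR q + 1) * (INR q + 1)) with (INR q) by (field; lra). lra.
Qed.

(** At x the function |f|^2 is maximal, so its derivative vanishes and [f x] is orthogonal to the
    image of Df. Being nonzero, [f x] is missed. *)
Lemma rank_le_sphere p n (f : vec -> vec) x M r : 0 < r ->
  (forall i, (i < S n)%nat -> hasd p (fun y => f y i) x (M i)) ->
  (forall y, sdist p y x < r -> sq (S n) (f y) <= 1) -> sq (S n) (f x) = 1 ->
  rank_le p (S n) M n.
Proof.
  intros Hr Hd Hle H1. apply (rank_le_intro p n M (f x)). intros h. apply NNPP. intros Hno.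
  assert (E : forall i, (i < S n)%nat -> mapply p M h i = f x i).
  { intros i Hi. apply NNPP. intros Hne. apply Hno. now exists i. }
  assert (Hs : hasd p (fun y => sq (S n) (f y)) x (fun j => vsum (S n) (fun i => 2 * f x i * M i j))).
  { apply (hasd_ext _ (fun y => vsum (S n) (fun i => Rsqr (f y i)))).
    - intros y. apply vsum_ext. intros; unfold Rsqr; ring.
    - apply (hasd_vsum p (S n) (fun i y => Rsqr (f y i)) x (fun i j => 2 * f x i * M i j)).
      intros i Hi. apply (hasd_outer p (fun y => f y i) x (M i) Rsqr); [apply derivable_pt_lim_Rsqr|auto]. }
  assert (Hm : forall y, sdist p y x < r -> sq (S n) (f y) <= sq (S n) (f x)) by (intros; rewrite H1; auto).
  pose proof (hasd_max p _ x _ r Hr Hs Hm h) as H0.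
  rewrite (vsum_ext p _ (fun j => vsum (S n) (fun i => 2 * (f x i * (M i j * h j))))) in H0.
  - rewrite vsum_swap in H0.
    rewrite (vsum_ext (S n) _ (fun i => 2 * (f x i * mapply p M h i))) in H0.
    + rewrite vsum_scal in H0. rewrite (vsum_ext (S n) _ (fun i => f x i ^ 2)) in H0.
      * fold (sq (S n) (f x)) in H0. lra.
      * intros i Hi. rewrite (E i Hi). ring.
    + intros i Hi. unfold mapply. rewrite !vsum_scal. easy.
  - intros j Hj. rewrite Rmult_comm, <- vsum_scal. apply vsum_ext. intros; ring.
Qed.

Lemma finite_gap (V : list R) a : exists g, 0 < g /\ forall v, In v V -> a < v -> a + g <= v.
Proof.
  induction V as [|v V [g [Hg IH]]]; [exists 1; split; [lra|easy]|].
  destruct (Rlt_dec a v) as [h|h].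
  - exists (Rmin g (v - a)). split; [apply Rmin_pos; lra|]. intros u [<-|Hu] Hau.
    + pose proof (Rmin_r g (v - a)). lra.
    + pose proof (Rmin_l g (v - a)). specialize (IH u Hu Hau). lra.
  - exists g. split; [easy|]. intros u [<-|Hu] Hau; [lra|auto].
Qed.

(* If the derivative were onto, moving in a direction which increases all coordinates at unit speed would leave the finitely many hyperplanes. *)
Lemma rank_le_hyperplanes p n (f : vec -> vec) x M r V : 0 < r ->
  (forall i, (i < S n)%nat -> hasd p (fun y => f y i) x (M i)) ->
  (forall y, sdist p y x < r -> exists i, (i < S n)%nat /\ In (f y i) V) ->
  rank_le p (S n) M n.
Proof.
  intros Hr Hd HV. apply (rank_le_intro p n M (fun _ => 1)). intros h. apply NNPP. intros Hno.
  assert (E : forall i, (i < S n)%nat -> mapply p M h i = 1).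
  { intros i Hi. apply NNPP. intros Hne. apply Hno. now exists i. }
  assert (HP : forall k, (k <= S n)%nat -> exists d, 0 < d /\ forall t, 0 < t < d -> forall i, (i < k)%nat ->
     ~ In (f (vadd x (fun j => t * h j)) i) V).
  { induction k as [|k IH]; intros Hk.
    - exists 1. split; [lra|]. intros; lia.
    - destruct IH as [d [Hd0 IH]]; [lia|].
      (* With error at most t/2, coordinate k grows by an amount between t/2 and 3t/2; for t < g/2
         this lands strictly inside the gap of [V] above [f x k]. *)
      destruct (hasd_line p _ x _ (Hd k Hk) h (/ 2)) as [d' [Hd' Hl]]; [lra|].
      destruct (finite_gap V (f x k)) as [g [Hg Hgap]].
      exists (Rmin d (Rmin d' (g / 2))). split; [repeat apply Rmin_pos; lra|]. intros t Ht i Hi Hin.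
      assert (t < d /\ t < d' /\ t < g / 2) as [Ht1 [Ht2 Ht3]].
      { destruct Ht as [_ Ht]. repeat split; eapply Rlt_le_trans; try exact Ht.
        - apply Rmin_l.
        - eapply Rle_trans; [apply Rmin_r|apply Rmin_l].
        - eapply Rle_trans; [apply Rmin_r|apply Rmin_r]. }
      destruct (Nat.eq_dec i k) as [->|Hne].
      + specialize (Hl t). rewrite Rabs_pos_eq in Hl by lra. specialize (Hl Ht2).
        specialize (E k Hk). unfold mapply in E. rewrite E in Hl. apply Rabs_le_between in Hl.
        specialize (Hgap _ Hin). lra.
      + apply (IH t ltac:(lra) i); [lia|easy]. }
  destruct (HP (S n) (Nat.le_refl _)) as [d [Hd0 HF]]. pose proof (supn_nonneg p h) as Hn.
  set (t := Rmin (d / 2) (r / 2 / (supn p h + 1))).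
  assert (Ht0 : 0 < t).
  { apply Rmin_pos; [lra|]. apply Rdiv_lt_0_compat; lra. }
  assert (Ht1 : t <= d / 2) by apply Rmin_l.
  assert (Ht2 : t <= r / 2 / (supn p h + 1)) by apply Rmin_r.
  destruct (HV (vadd x (fun j => t * h j))) as [i [Hi Hin]].
  - apply Rle_lt_trans with (t * (supn p h + 1)).
    + apply sdist_le; [nra|]. intros i Hi. unfold vadd.
      replace (x i + t * h i - x i) with (t * h i) by ring. rewrite Rabs_mult, (Rabs_pos_eq t) by lra.
      pose proof (supn_ge p h i Hi). nra.
    + apply (Rmult_le_compat_r (supn p h + 1)) in Ht2; [|lra].
      replace (r / 2 / (supn p h + 1) * (supn p h + 1)) with (r / 2) in Ht2 by (field; lra). lra.
  - apply (HF t ltac:(lra) i Hi Hin).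
Qed.

(** * The self-similar map *)

Definition sgn (m : nat) : R := (-1) ^ m.

Lemma sgn_sq m : sgn m * sgn m = 1.
Proof. unfold sgn. rewrite <- Rpow_mult_distr. replace (-1 * -1) with 1 by ring. apply pow1. Qed.

Lemma sgn_abs m : Rabs (sgn m) = 1.
Proof. unfold sgn. rewrite <- RPow_abs, Rabs_left by lra. replace (- -1) with 1 by ring. apply pow1. Qed.

(* The sign makes this signed cyclic permutation of m+1 coordinates have determinant 1, and hence no eigenvalue -1. *)
Definition cyc (m : nat) (y : vec) : vec := fun i => if Nat.eqb i m then sgn m * y O else y (S i).

Definition cyc_inv (m : nat) (y : vec) : vec := fun i => match i with O => sgn m * y m | S i' => y i' end.

Lemma cyc_lt m y i : (i < m)%nat -> cyc m y i = y (S i).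
Proof. intros H. unfold cyc. now rewrite (eqb_ne i m) by lia. Qed.

Lemma cyc_last m y : cyc m y m = sgn m * y O.
Proof. unfold cyc. now rewrite Nat.eqb_refl. Qed.

Lemma cyc_cyc_inv m y i : (i < S m)%nat -> cyc m (cyc_inv m y) i = y i.
Proof.
  intros H. destruct (Nat.eq_dec i m) as [->|Hne].
  - rewrite cyc_last. simpl. rewrite <- Rmult_assoc, sgn_sq. ring.
  - rewrite cyc_lt by lia. easy.
Qed.

Lemma cyc_inv_cyc m y i : (i < S m)%nat -> cyc_inv m (cyc m y) i = y i.
Proof.
  intros H. destruct i as [|i]; simpl.
  - rewrite cyc_last, <- Rmult_assoc, sgn_sq. ring.
  - apply cyc_lt. lia.
Qed.

Lemma cyc_supn_le m y : supn (S m) (cyc m y) <= supn (S m) y.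
Proof.
  apply supn_le; [apply supn_nonneg|]. intros i Hi. destruct (Nat.eq_dec i m) as [->|Hne].
  - rewrite cyc_last, Rabs_mult, sgn_abs, Rmult_1_l. apply supn_ge; lia.
  - rewrite cyc_lt by lia. apply supn_ge; lia.
Qed.

Lemma cyc_inv_supn_le m y : supn (S m) (cyc_inv m y) <= supn (S m) y.
Proof.
  apply supn_le; [apply supn_nonneg|]. intros [|i] Hi; simpl.
  - rewrite Rabs_mult, sgn_abs, Rmult_1_l. apply (supn_ge (S m) y m); lia.
  - apply (supn_ge (S m) y i); lia.
Qed.

Lemma cyc_supn m y : supn (S m) (cyc m y) = supn (S m) y.
Proof.
  apply Rle_antisym; [apply cyc_supn_le|].
  rewrite (supn_ext (S m) y (cyc_inv m (cyc m y))) by (intros; symmetry; now apply cyc_inv_cyc).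
  apply cyc_inv_supn_le.
Qed.

Lemma cyc_inv_supn m y : supn (S m) (cyc_inv m y) = supn (S m) y.
Proof.
  apply Rle_antisym; [apply cyc_inv_supn_le|].
  rewrite (supn_ext (S m) y (cyc m (cyc_inv m y))) by (intros; symmetry; now apply cyc_cyc_inv).
  apply cyc_supn_le.
Qed.

Lemma cyc_ext m x y : (forall i, (i < S m)%nat -> x i = y i) -> forall i, (i < S m)%nat -> cyc m x i = cyc m y i.
Proof.
  intros H i Hi. destruct (Nat.eq_dec i m) as [->|Hne].
  - rewrite !cyc_last, (H O); [easy|lia].
  - rewrite !cyc_lt by lia. apply H; lia.
Qed.

(** The power m+1 of [cyc] is multiplication by (-1)^m, so an eigenvalue -c with c >= 0 would give
    c^(m+1) = -1. *)
Lemma cyc_mix_inj m s y : 0 <= s <= 1 ->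
  (forall i, (i < S m)%nat -> (1 - s) * y i + s * cyc m y i = 0) -> forall i, (i < S m)%nat -> y i = 0.
Proof.
  intros Hs H. destruct (Req_dec s 0) as [->|Hs0].
  { intros i Hi. specialize (H i Hi). lra. }
  set (c := (1 - s) / s). assert (Hc : 0 <= c) by (apply Rdiv_le_0_compat; lra).
  assert (Hcs : 1 - s = c * s) by (unfold c; field; easy).
  assert (E : forall i, (i < S m)%nat -> y i = (- c) ^ i * y O).
  { induction i as [|i IH]; intros Hi; [simpl; ring|]. specialize (H i ltac:(lia)).
    rewrite cyc_lt, Hcs in H by lia. simpl. rewrite Rmult_assoc, <- IH by lia.
    apply (Rmult_eq_reg_l s); [|easy]. lra. }
  assert (Hl := H m ltac:(lia)). rewrite cyc_last, (E m), Hcs in Hl by lia.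
  assert (Hp : (- c) ^ m = sgn m * c ^ m).
  { unfold sgn. rewrite <- Rpow_mult_distr. f_equal. ring. }
  rewrite Hp in Hl.
  assert (Hz : (c * c ^ m + 1) * y O = 0).
  { apply (Rmult_eq_reg_l (s * sgn m)); [|apply Rmult_integral_contrapositive; split; [easy|]].
    - rewrite Rmult_0_r, <- Hl. ring.
    - pose proof (sgn_sq m). intros h. rewrite h in *. lra. }
  assert (0 <= c ^ m) by now apply pow_le.
  assert (y O = 0). { destruct (Rmult_integral _ _ Hz) as [h|h]; [nra|easy]. }
  intros i Hi. rewrite E, H1 by easy. ring.
Qed.

(** Substituting [cyc] of the unknown turns the segment to the inverse into the segment to [cyc]
    itself, run backwards. *)
Lemma cyc_inv_mix_inj m s y : 0 <= s <= 1 ->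
  (forall i, (i < S m)%nat -> (1 - s) * y i + s * cyc_inv m y i = 0) -> forall i, (i < S m)%nat -> y i = 0.
Proof.
  intros Hs H. assert (E : forall i, (i < S m)%nat -> cyc_inv m y i = 0).
  { apply (cyc_mix_inj m (1 - s)); [lra|]. intros i Hi. rewrite cyc_cyc_inv by easy.
    specialize (H i Hi). lra. }
  intros i Hi. rewrite <- (cyc_cyc_inv m y i Hi). destruct (Nat.eq_dec i m) as [->|Hne].
  - rewrite cyc_last, E by lia. ring.
  - rewrite cyc_lt by lia. apply E; lia.
Qed.

(* [wmap n b] maps the cube onto its half [b], and [hmap k th b] maps the cube into its half [b], both cut along the last
   axis and turning the axes cyclically. As for sheets of A4 paper, for the weights lam^-i (with lam^(n+1) = 1/2) and
   mu^i (with mu^(k+1) = 2, th = lam mu) in the sup norm both are contractions of ratio exactly lam. *)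
Definition half_last (m : nat) (b : R) (y : vec) : vec := fun i => if Nat.eqb i m then (y m + b) / 2 else y i.
Definition unhalf_last (m : nat) (b : R) (y : vec) : vec := fun i => if Nat.eqb i m then 2 * y m - b else y i.

Definition wmap (n : nat) (b : R) (y : vec) : vec := half_last n b (cyc n y).
Definition hmap (k : nat) (th b : R) (z : vec) : vec := half_last k b (fun i => th * cyc k z i).
Definition hinv (k : nat) (th b : R) (z : vec) : vec := cyc_inv k (fun i => / th * unhalf_last k b z i).

Definition clampv (x : vec) : vec := fun i => clamp (-1) 1 (x i).

Lemma clampv_le m x : supn m (clampv x) <= 1.
Proof. apply supn_le; [lra|]. intros i _. apply Rabs_le. apply clamp_range. lra. Qed.

Lemma clampv_id m x i : supn m x <= 1 -> (i < m)%nat -> clampv x i = x i.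
Proof.
  intros H Hi. apply clamp_id. apply Rabs_le_between. eapply Rle_trans; [now apply (supn_ge m x i)|easy].
Qed.

Lemma clampv_bd m x : 1 <= supn m x -> supn m (clampv x) = 1.
Proof.
  intros H. apply Rle_antisym; [apply clampv_le|].
  destruct m as [|m]; [simpl in H; lra|].
  destruct (supn_attained (S m) x) as [i [Hi Hx]]; [lia|]. rewrite <- Hx in H.
  eapply Rle_trans; [|apply (supn_ge _ _ i Hi)]. unfold clampv.
  destruct (Rle_dec 0 (x i)).
  - rewrite Rabs_pos_eq in H by easy. rewrite clamp_hi, Rabs_R1 by lra. lra.
  - rewrite Rabs_left in H by lra. rewrite clamp_lo by lra. rewrite Rabs_left; lra.
Qed.

Lemma wmap_lt n b y i : (i < n)%nat -> wmap n b y i = y (S i).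
Proof.
  intros H. unfold wmap, half_last. rewrite (eqb_ne i n) by lia.
  now apply cyc_lt.
Qed.

Lemma wmap_last n b y : wmap n b y n = (sgn n * y O + b) / 2.
Proof. unfold wmap, half_last. rewrite Nat.eqb_refl, cyc_last. easy. Qed.

Lemma hmap_lt k th b z i : (i < k)%nat -> hmap k th b z i = th * z (S i).
Proof.
  intros H. unfold hmap, half_last. rewrite (eqb_ne i k) by lia.
  now rewrite cyc_lt.
Qed.

Lemma hmap_last k th b z : hmap k th b z k = (th * (sgn k * z O) + b) / 2.
Proof. unfold hmap, half_last. rewrite Nat.eqb_refl, cyc_last. easy. Qed.

Lemma hinv_0 k th b z : hinv k th b z O = sgn k * (/ th * (2 * z k - b)).
Proof. unfold hinv, unhalf_last. simpl. now rewrite Nat.eqb_refl. Qed.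

Lemma hinv_S k th b z i : (i < k)%nat -> hinv k th b z (S i) = / th * z i.
Proof.
  intros H. unfold hinv, unhalf_last. simpl. now rewrite (eqb_ne i k) by lia.
Qed.

Lemma hmap_hinv k th b z i : 0 < th -> (i < S k)%nat -> hmap k th b (hinv k th b z) i = z i.
Proof.
  intros Ht Hi. destruct (Nat.eq_dec i k) as [->|Hne].
  - rewrite hmap_last, hinv_0.
    replace (th * (sgn k * (sgn k * (/ th * (2 * z k - b))))) with ((sgn k * sgn k) * (2 * z k - b)) by (field; lra).
    rewrite sgn_sq. lra.
  - rewrite hmap_lt, hinv_S by lia. field. lra.
Qed.

Lemma hinv_hmap k th b z i : 0 < th -> (i < S k)%nat -> hinv k th b (hmap k th b z) i = z i.
Proof.
  intros Ht Hi. destruct i as [|i].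
  - rewrite hinv_0, hmap_last.
    replace (sgn k * (/ th * (2 * ((th * (sgn k * z O) + b) / 2) - b))) with ((sgn k * sgn k) * z O) by (field; lra).
    rewrite sgn_sq. ring.
  - rewrite hinv_S, hmap_lt by lia. field. lra.
Qed.

Definition pm (b : R) : Prop := b = 1 \/ b = -1.

Lemma hmap_le k th b z : 0 < th < 1 -> pm b -> supn (S k) z <= 1 -> supn (S k) (hmap k th b z) <= (1 + th) / 2.
Proof.
  intros Ht Hb Hz. assert (Hz' : forall i, (i < S k)%nat -> Rabs (z i) <= 1).
  { intros i Hi. eapply Rle_trans; [now apply (supn_ge (S k) z i)|easy]. }
  apply supn_le; [lra|]. intros i Hi. destruct (Nat.eq_dec i k) as [->|Hne].
  - rewrite hmap_last. specialize (Hz' O ltac:(lia)).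
    assert (Rabs (sgn k * z O) <= 1) by (rewrite Rabs_mult, sgn_abs; lra).
    apply Rabs_le_between in H. destruct Hb as [-> | ->]; apply Rabs_le; nra.
  - rewrite hmap_lt by lia. specialize (Hz' (S i) ltac:(lia)).
    rewrite Rabs_mult, (Rabs_pos_eq th) by lra. nra.
Qed.

(** The last coordinate of a point of hole [b] lies within th/2 of b/2, and th < 1. *)
Lemma holes_disjoint k th b b' z : 0 < th < 1 -> pm b -> pm b' -> b <> b' -> supn (S k) (hinv k th b z) <= 1 ->
  1 < supn (S k) (hinv k th b' z).
Proof.
  intros Ht Hb Hb' Hne H.
  pose proof (supn_ge (S k) (hinv k th b z) O ltac:(lia)) as H1.
  eapply Rlt_le_trans; [|apply (supn_ge (S k) (hinv k th b' z) O ltac:(lia))].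
  rewrite hinv_0, Rabs_mult, sgn_abs, Rmult_1_l, Rabs_mult in *.
  assert (Hi : 0 < / th) by (apply Rinv_0_lt_compat; lra). rewrite (Rabs_pos_eq (/ th)) in * by lra.
  assert (A1 : Rabs (2 * z k - b) <= th).
  { apply (Rmult_le_reg_l (/ th)); [easy|]. rewrite Rinv_l by lra. lra. }
  apply (Rmult_lt_reg_l th); [lra|]. rewrite <- Rmult_assoc, Rinv_r, Rmult_1_l, Rmult_1_r by lra.
  apply Rabs_le_between in A1.
  destruct Hb as [-> | ->], Hb' as [-> | ->]; try easy.
  - rewrite Rabs_pos_eq; lra.
  - rewrite Rabs_left; lra.
Qed.

(** * Weighted sup distances *)

Definition wd (m : nat) (q : R) (x y : vec) : R := supn m (fun i => q ^ i * (x i - y i)).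

Lemma wd_le m q x y d : 0 < q -> 0 <= d -> (forall i, (i < m)%nat -> q ^ i * Rabs (x i - y i) <= d) -> wd m q x y <= d.
Proof.
  intros Hq Hd H. apply supn_le; [easy|]. intros i Hi. rewrite Rabs_mult, Rabs_pos_eq; [auto|].
  left. now apply pow_lt.
Qed.

Lemma wd_ge m q x y i : 0 < q -> (i < m)%nat -> q ^ i * Rabs (x i - y i) <= wd m q x y.
Proof.
  intros Hq Hi. rewrite <- (Rabs_pos_eq (q ^ i)) by (left; now apply pow_lt). rewrite <- Rabs_mult.
  apply (supn_ge m (fun i => q ^ i * (x i - y i)) i Hi).
Qed.

Lemma wd_nonneg m q x y : 0 <= wd m q x y.
Proof. apply supn_nonneg. Qed.

Lemma wd_sym m q x y : 0 < q -> wd m q x y = wd m q y x.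
Proof.
  intros Hq. apply Rle_antisym; apply wd_le; try easy; try apply wd_nonneg;
    intros i Hi; rewrite Rabs_minus_sym; now apply wd_ge.
Qed.

Lemma wd_tri m q x y z : 0 < q -> wd m q x z <= wd m q x y + wd m q y z.
Proof.
  intros Hq. apply wd_le; [easy| |].
  - pose proof (wd_nonneg m q x y); pose proof (wd_nonneg m q y z); lra.
  - intros i Hi. pose proof (wd_ge m q x y i Hq Hi). pose proof (wd_ge m q z y i Hq Hi).
    rewrite (wd_sym m q y z) by easy.
    pose proof (abs_tri3 (x i) (z i) (y i)). assert (0 < q ^ i) by now apply pow_lt. nra.
Qed.

Lemma wd_ext m q x y x' y' : (forall i, (i < m)%nat -> x i = x' i) -> (forall i, (i < m)%nat -> y i = y' i) ->
  wd m q x y = wd m q x' y'.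
Proof. intros H H'. apply supn_ext. intros i Hi. now rewrite H, H'. Qed.

Lemma sdist_wd m q x y : 1 <= q -> sdist m x y <= wd m q x y.
Proof.
  intros Hq. apply sdist_le; [apply wd_nonneg|]. intros i Hi.
  pose proof (wd_ge m q x y i ltac:(lra) Hi). pose proof (pow_R1_Rle q i Hq). pose proof (Rabs_pos (x i - y i)). nra.
Qed.

Lemma wd_sdist m q x y : 1 <= q -> wd m q x y <= q ^ m * sdist m x y.
Proof.
  intros Hq. pose proof (sdist_nonneg m x y). apply wd_le; [lra| |].
  - apply Rmult_le_pos; [apply pow_le; lra|easy].
  - intros i Hi. apply Rmult_le_compat.
    + apply pow_le; lra.
    + apply Rabs_pos.
    + apply Rle_pow; [easy|lia].
    + now apply sdist_ge.
Qed.

(** A coordinate that moves down one place gains the factor [lam] from the weights. The halved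
    coordinate jumps from place 0 to place n, where lam^-n times 1/2 = lam^(n+1) is again [lam]. *)
Lemma wmap_wd n lam b y y' : 0 < lam -> lam ^ S n = / 2 ->
  wd (S n) (/ lam) (wmap n b y) (wmap n b y') <= lam * wd (S n) (/ lam) y y'.
Proof.
  intros Hl Hp. assert (Hi : 0 < / lam) by now apply Rinv_0_lt_compat.
  apply wd_le; [easy| |].
  - apply Rmult_le_pos; [lra|apply wd_nonneg].
  - intros i Hi'. destruct (Nat.eq_dec i n) as [->|Hne].
    + rewrite !wmap_last. pose proof (wd_ge (S n) (/ lam) y y' O Hi ltac:(lia)) as H.
      replace ((sgn n * y O + b) / 2 - (sgn n * y' O + b) / 2) with (sgn n * ((y O - y' O) * / 2)) by field.
      rewrite !Rabs_mult, sgn_abs, (Rabs_pos_eq (/ 2)) by lra. simpl in H.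
      rewrite <- Hp. simpl. replace ((/ lam) ^ n * (1 * (Rabs (y O - y' O) * (lam * lam ^ n))))
        with (lam * Rabs (y O - y' O) * ((/ lam) ^ n * lam ^ n)) by ring.
      rewrite <- Rpow_mult_distr, Rinv_l, pow1 by lra. nra.
    + rewrite !wmap_lt by lia. pose proof (wd_ge (S n) (/ lam) y y' (S i) Hi ltac:(lia)) as H.
      simpl in H. apply (Rmult_le_compat_l lam) in H; [|lra].
      rewrite <- !Rmult_assoc, Rinv_r, Rmult_1_l in H by lra. exact H.
Qed.

(** The ratio is exactly inverse to that of [wmap_wd], so conjugating a map by the two contractions
    does not change its Lipschitz constant. *)
Lemma hinv_wd k lam mu b z z' : 0 < lam -> 1 <= mu -> mu ^ S k = 2 ->
  wd (S k) mu (hinv k (lam * mu) b z) (hinv k (lam * mu) b z') <= / lam * wd (S k) mu z z'.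
Proof.
  intros Hl Hm Hp. assert (Hi : 0 < / lam) by now apply Rinv_0_lt_compat.
  apply wd_le; [lra| |].
  - apply Rmult_le_pos; [lra|apply wd_nonneg].
  - intros [|i] Hi'.
    + rewrite !hinv_0. pose proof (wd_ge (S k) mu z z' k ltac:(lra) ltac:(lia)) as H.
      replace (sgn k * (/ (lam * mu) * (2 * z k - b)) - sgn k * (/ (lam * mu) * (2 * z' k - b)))
        with (sgn k * ((/ lam * mu ^ k) * (z k - z' k))).
      2:{ rewrite <- Hp. simpl. field. lra. }
      rewrite !Rabs_mult, sgn_abs, !(Rabs_pos_eq (/ lam)), (Rabs_pos_eq (mu ^ k)) by (try apply pow_le; lra).
      simpl. nra.
    + rewrite !hinv_S by lia. pose proof (wd_ge (S k) mu z z' i ltac:(lra) ltac:(lia)) as H.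
      replace (/ (lam * mu) * z i - / (lam * mu) * z' i) with (/ lam * (/ mu * (z i - z' i))) by (field; lra).
      assert (0 < / mu) by (apply Rinv_0_lt_compat; lra).
      rewrite !Rabs_mult, (Rabs_pos_eq (/ lam)), (Rabs_pos_eq (/ mu)) by lra.
      simpl. replace (mu * mu ^ i * (/ lam * (/ mu * Rabs (z i - z' i)))) with (/ lam * (mu ^ i * Rabs (z i - z' i))) by (field; lra).
      apply Rmult_le_compat_l; lra.
Qed.

Lemma hmap_wd k lam mu b z z' : 0 < lam -> 1 <= mu -> mu ^ S k = 2 ->
  wd (S k) mu (hmap k (lam * mu) b z) (hmap k (lam * mu) b z') <= lam * wd (S k) mu z z'.
Proof.
  intros Hl Hm Hp. apply wd_le; [lra| |].
  - apply Rmult_le_pos; [lra|apply wd_nonneg].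
  - intros i Hi. destruct (Nat.eq_dec i k) as [->|Hne].
    + rewrite !hmap_last. pose proof (wd_ge (S k) mu z z' O ltac:(lra) ltac:(lia)) as H. simpl in H.
      replace ((lam * mu * (sgn k * z O) + b) / 2 - (lam * mu * (sgn k * z' O) + b) / 2)
        with (sgn k * (lam * (mu * / 2) * (z O - z' O))) by field.
      rewrite !Rabs_mult, sgn_abs, (Rabs_pos_eq lam), (Rabs_pos_eq mu), (Rabs_pos_eq (/ 2)) by lra.
      replace (mu ^ k * (1 * (lam * (mu * / 2) * Rabs (z O - z' O)))) with (mu ^ S k * / 2 * (lam * Rabs (z O - z' O))) by (simpl; ring).
      rewrite Hp. nra.
    + rewrite !hmap_lt by lia. pose proof (wd_ge (S k) mu z z' (S i) ltac:(lra) ltac:(lia)) as H. simpl in H.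
      replace (lam * mu * z (S i) - lam * mu * z' (S i)) with (lam * (mu * (z (S i) - z' (S i)))) by ring.
      rewrite !Rabs_mult, (Rabs_pos_eq lam), (Rabs_pos_eq mu) by lra. nra.
Qed.

(** * Iterated insertion of rescaled copies *)

(* Outside the hole [b] the point [clampv (hinv k th b z)] is on the boundary of the cube and [t b] vanishes; inside,
   [t b] replaces the value of G by the rescaled copy of u. *)
Definition uT (k n : nat) (th : R) (G u : vec -> vec) (z : vec) : vec := fun i =>
  let t b := wmap n b (u (clampv (hinv k th b z))) i - G (hmap k th b (clampv (hinv k th b z))) i in
  G z i + (t 1 + t (-1)).

Fixpoint uN (k n : nat) (th : R) (F G : vec -> vec) (m : nat) : vec -> vec :=
  match m with O => F | S m' => uT k n th G (uN k n th F G m') end.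

(** [F] prescribes the boundary values and [G] fills the cube outside two holes. By [ifs_hole], [G]
    restricts on the boundary of a hole to the rescaled boundary values of [F], so a copy of the
    construction can be inserted there. The values -1, 0, 1 are the faces of the two halves of the
    target cube. *)
Record ifs_ok (k n : nat) (th : R) (F G : vec -> vec) : Prop := {
  ifs_th : 0 < th < 1;
  ifs_F : forall i, (i < S n)%nat -> PS (S k) (fun z => F z i);
  ifs_G : forall i, (i < S n)%nat -> PS (S k) (fun z => G z i);
  ifs_bd : forall z, supn (S k) z = 1 -> forall i, (i < S n)%nat -> G z i = F z i;
  ifs_hole : forall z b, pm b -> supn (S k) z = 1 -> forall i, (i < S n)%nat ->
    G (hmap k th b z) i = wmap n b (F z) i;
  ifs_Fle : forall z, supn (S k) z <= 1 -> supn (S n) (F z) <= 1;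
  ifs_off : forall z, supn (S k) z <= 1 -> (forall b, pm b -> 1 <= supn (S k) (hinv k th b z)) ->
    supn (S n) (G z) <= 1 /\ exists i, (i < S n)%nat /\ In (G z i) (-1 :: 0 :: 1 :: nil)
}.

Lemma wmap_ext n b y y' : (forall i, (i < S n)%nat -> y i = y' i) -> forall i, (i < S n)%nat -> wmap n b y i = wmap n b y' i.
Proof.
  intros H i Hi. destruct (Nat.eq_dec i n) as [->|Hne].
  - rewrite !wmap_last, (H O); [easy|lia].
  - rewrite !wmap_lt by lia. apply H; lia.
Qed.

Lemma wmap_ps m n b (u : vec -> vec) : (forall i, (i < S n)%nat -> PS m (fun z => u z i)) ->
  forall i, (i < S n)%nat -> PS m (fun z => wmap n b (u z) i).
Proof.
  intros H i Hi. destruct (Nat.eq_dec i n) as [->|Hne].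
  - apply (ps_ext m (fun z => / 2 * (sgn n * u z O + b))).
    + intros z. rewrite wmap_last. field.
    + apply ps_scal, ps_add; [apply ps_scal, H; lia|apply ps_const].
  - apply (ps_ext m (fun z => u z (S i))); [intros; now rewrite wmap_lt by lia|apply H; lia].
Qed.

Lemma hmap_ps m k th b (u : vec -> vec) : (forall i, (i < S k)%nat -> PS m (fun z => u z i)) ->
  forall i, (i < S k)%nat -> PS m (fun z => hmap k th b (u z) i).
Proof.
  intros H i Hi. destruct (Nat.eq_dec i k) as [->|Hne].
  - apply (ps_ext m (fun z => / 2 * (th * sgn k * u z O + b))).
    + intros z. rewrite hmap_last. field.
    + apply ps_scal, ps_add; [apply ps_scal, H; lia|apply ps_const].
  - apply (ps_ext m (fun z => th * u z (S i))); [intros; now rewrite hmap_lt by lia|apply ps_scal, H; lia].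
Qed.

Lemma hinv_ps m k th b (u : vec -> vec) : (forall i, (i < S k)%nat -> PS m (fun z => u z i)) ->
  forall i, (i < S k)%nat -> PS m (fun z => hinv k th b (u z) i).
Proof.
  intros H [|i] Hi.
  - apply (ps_ext m (fun z => (sgn k * / th) * (2 * u z k - b))).
    + intros z. rewrite hinv_0. ring.
    + apply ps_scal, ps_sub; [apply ps_scal, H; lia|apply ps_const].
  - apply (ps_ext m (fun z => / th * u z i)); [intros; now rewrite hinv_S by lia|apply ps_scal, H; lia].
Qed.

Lemma clampv_ps m q (u : vec -> vec) : (forall i, (i < q)%nat -> PS m (fun z => u z i)) ->
  forall i, (i < q)%nat -> PS m (fun z => clampv (u z) i).
Proof. intros H i Hi. apply ps_clamp. auto. Qed.

Lemma uN_ps k n th F G : ifs_ok k n th F G ->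
  forall m i, (i < S n)%nat -> PS (S k) (fun z => uN k n th F G m z i).
Proof.
  intros OK m. induction m as [|m IH]; intros i Hi; [now apply (ifs_F _ _ _ _ _ OK)|].
  simpl. unfold uT.
  assert (HC : forall b j, (j < S k)%nat -> PS (S k) (fun z => clampv (hinv k th b z) j)).
  { intros b. apply clampv_ps. apply (hinv_ps (S k) k th b (fun z => z)). intros; now apply ps_coord. }
  assert (HT : forall b, PS (S k) (fun z => wmap n b (uN k n th F G m (clampv (hinv k th b z))) i
     - G (hmap k th b (clampv (hinv k th b z))) i)).
  { intros b. apply ps_sub.
    - apply (wmap_ps (S k) n b (fun z => uN k n th F G m (clampv (hinv k th b z)))); [|easy].
      intros j Hj. apply (ps_subst (S k) (S k) (fun z => uN k n th F G m z j)); auto.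
    - apply (ps_subst (S k) (S k) (fun z => G z i)); [now apply (ifs_G _ _ _ _ _ OK)|].
      apply (hmap_ps (S k) k th b (fun z => clampv (hinv k th b z))). auto. }
  apply ps_add; [now apply (ifs_G _ _ _ _ _ OK)|]. apply ps_add; apply HT.
Qed.

Lemma uN_ext k n th F G m x y i : ifs_ok k n th F G -> (i < S n)%nat -> (forall j, (j < S k)%nat -> x j = y j) ->
  uN k n th F G m x i = uN k n th F G m y i.
Proof. intros OK Hi H. apply (ps_dep (S k) (fun z => uN k n th F G m z i)); [now apply uN_ps|easy]. Qed.

Lemma pm_1 : pm 1. Proof. now left. Qed.
Lemma pm_m1 : pm (-1). Proof. now right. Qed.

Lemma bd_not_hole k th z b : 0 < th < 1 -> pm b -> supn (S k) z = 1 -> 1 < supn (S k) (hinv k th b z).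
Proof.
  intros Ht Hb Hz. destruct (Rlt_dec 1 (supn (S k) (hinv k th b z))) as [h|h]; [easy|exfalso].
  pose proof (hmap_le k th b (hinv k th b z) Ht Hb ltac:(lra)) as H.
  rewrite (supn_ext _ _ z) in H; [lra|]. intros i Hi. apply hmap_hinv; [lra|easy].
Qed.

Lemma uN_bd k n th F G : ifs_ok k n th F G -> forall m z i, supn (S k) z = 1 -> (i < S n)%nat ->
  uN k n th F G m z i = F z i.
Proof.
  intros OK m. induction m as [|m IH]; intros z i Hz Hi; [easy|]. simpl. unfold uT.
  assert (HT : forall b, pm b -> wmap n b (uN k n th F G m (clampv (hinv k th b z))) i
     - G (hmap k th b (clampv (hinv k th b z))) i = 0).
  { intros b Hb. assert (Hc : supn (S k) (clampv (hinv k th b z)) = 1).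
    { apply clampv_bd. left. apply bd_not_hole; [apply OK|easy|easy]. }
    rewrite (ifs_hole _ _ _ _ _ OK) by easy.
    rewrite (wmap_ext n b _ (F (clampv (hinv k th b z)))) by (auto). ring. }
  rewrite !HT by (apply pm_1 || apply pm_m1). rewrite (ifs_bd _ _ _ _ _ OK) by easy. ring.
Qed.

Lemma uT_term_off k n th F G m z b i : ifs_ok k n th F G -> (i < S n)%nat -> pm b ->
  1 <= supn (S k) (hinv k th b z) ->
  wmap n b (uN k n th F G m (clampv (hinv k th b z))) i - G (hmap k th b (clampv (hinv k th b z))) i = 0.
Proof.
  intros OK Hi Hb H. apply clampv_bd in H.
  rewrite (ifs_hole _ _ _ _ _ OK) by easy.
  rewrite (wmap_ext n b _ (F (clampv (hinv k th b z)))); [ring| |easy].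
  intros j Hj. now apply uN_bd.
Qed.

Lemma uN_off k n th F G m z i : ifs_ok k n th F G -> (i < S n)%nat ->
  (forall b, pm b -> 1 <= supn (S k) (hinv k th b z)) -> uN k n th F G (S m) z i = G z i.
Proof.
  intros OK Hi H. simpl. unfold uT.
  rewrite (uT_term_off k n th F G m z 1), (uT_term_off k n th F G m z (-1)); auto using pm_1, pm_m1. ring.
Qed.

(** In hole [b] the clamp is inactive and the term of [b] cancels [G z]; the other hole is disjoint
    and its term vanishes. *)
Lemma uN_in k n th F G m z b i : ifs_ok k n th F G -> (i < S n)%nat -> pm b ->
  supn (S k) (hinv k th b z) <= 1 ->
  uN k n th F G (S m) z i = wmap n b (uN k n th F G m (hinv k th b z)) i.
Proof.
  intros OK Hi Hb H. pose proof (ifs_th _ _ _ _ _ OK) as Ht. simpl. unfold uT.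
  assert (Hoff : forall b', pm b' -> b' <> b -> wmap n b' (uN k n th F G m (clampv (hinv k th b' z))) i
     - G (hmap k th b' (clampv (hinv k th b' z))) i = 0).
  { intros b' Hb' Hne. apply uT_term_off; auto. left. apply (holes_disjoint k th b); auto. }
  assert (Hin : wmap n b (uN k n th F G m (clampv (hinv k th b z))) i
     - G (hmap k th b (clampv (hinv k th b z))) i = wmap n b (uN k n th F G m (hinv k th b z)) i - G z i).
  { f_equal.
    - apply wmap_ext; [|easy]. intros j Hj. apply uN_ext; auto. intros l Hl. now apply (clampv_id (S k)).
    - apply (ps_dep (S k) (fun z => G z i)); [now apply (ifs_G _ _ _ _ _ OK)|]. intros l Hl.
      transitivity (hmap k th b (hinv k th b z) l); [|apply hmap_hinv; [lra|easy]].
      destruct (Nat.eq_dec l k) as [->|Hne].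
      + rewrite !hmap_last. now rewrite (clampv_id (S k)) by (easy || lia).
      + rewrite !hmap_lt by lia. now rewrite (clampv_id (S k)) by (easy || lia). }
  destruct Hb as [-> | ->].
  - rewrite Hin, (Hoff (-1)); [ring|apply pm_m1|lra].
  - rewrite Hin, (Hoff 1); [ring|apply pm_1|lra].
Qed.

Lemma off_or_in k th z : (forall b, pm b -> 1 <= supn (S k) (hinv k th b z)) \/
  exists b, pm b /\ supn (S k) (hinv k th b z) <= 1.
Proof.
  destruct (Rle_dec (supn (S k) (hinv k th 1 z)) 1); [right; exists 1; auto using pm_1|].
  destruct (Rle_dec (supn (S k) (hinv k th (-1) z)) 1); [right; exists (-1); auto using pm_m1|].
  left. intros b [-> | ->]; lra.
Qed.

Lemma wmap_le n b y : pm b -> supn (S n) y <= 1 -> supn (S n) (wmap n b y) <= 1.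
Proof.
  intros Hb Hy. assert (Hy' : forall i, (i < S n)%nat -> Rabs (y i) <= 1).
  { intros i Hi. eapply Rle_trans; [now apply (supn_ge (S n) y i)|easy]. }
  apply supn_le; [lra|]. intros i Hi. destruct (Nat.eq_dec i n) as [->|Hne].
  - rewrite wmap_last. assert (H : Rabs (sgn n * y O) <= 1) by (rewrite Rabs_mult, sgn_abs, Rmult_1_l; apply Hy'; lia).
    apply Rabs_le_between in H. apply Rabs_le. destruct Hb as [-> | ->]; lra.
  - rewrite wmap_lt by lia. apply Hy'; lia.
Qed.

Lemma uN_le k n th F G : ifs_ok k n th F G -> forall m z, supn (S k) z <= 1 ->
  supn (S n) (uN k n th F G m z) <= 1.
Proof.
  intros OK m. induction m as [|m IH]; intros z Hz; [now apply (ifs_Fle _ _ _ _ _ OK)|].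
  destruct (off_or_in k th z) as [Hoff|[b [Hb Hin]]].
  - rewrite (supn_ext _ _ (G z)) by (intros; now apply uN_off). now apply (ifs_off _ _ _ _ _ OK).
  - rewrite (supn_ext _ _ (wmap n b (uN k n th F G m (hinv k th b z)))) by (intros; now apply uN_in).
    apply wmap_le; auto.
Qed.

(** The union of the 2^m cubes of generation m. The intersection over all m is the exceptional
    Cantor set. *)
Fixpoint deep (k : nat) (th : R) (m : nat) (z : vec) : Prop :=
  match m with
  | O => supn (S k) z <= 1
  | S m' => exists b, pm b /\ deep k th m' (hinv k th b z)
  end.

Lemma deep_le k th m z : 0 < th < 1 -> deep k th m z -> supn (S k) z <= 1.
Proof.
  intros Ht. revert z; induction m as [|m IH]; intros z H; [easy|].
  destruct H as [b [Hb H]]. apply IH in H. apply (hmap_le k th b _ Ht Hb) in H.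
  rewrite (supn_ext _ _ z) in H; [lra|]. intros i Hi. apply hmap_hinv; [lra|easy].
Qed.

(** Outside generation m+1 the recursion reaches [G] after at most m descents into holes, before the
    initial map [F] is consulted. *)
Lemma uN_stationary k n th F G : ifs_ok k n th F G -> forall m z, ~ deep k th (S m) z ->
  forall p, (m <= p)%nat -> forall i, (i < S n)%nat -> uN k n th F G (S p) z i = uN k n th F G (S m) z i.
Proof.
  intros OK m. induction m as [|m IH]; intros z Hz p Hp i Hi;
    (destruct (off_or_in k th z) as [Hoff|[b [Hb Hin]]]; [now rewrite !uN_off|]).
  - destruct Hz. now exists b.
  - rewrite !(uN_in k n th F G _ z b) by easy. destruct p as [|p]; [lia|].
    apply wmap_ext; [|easy]. intros j Hj. apply IH; [|lia|easy]. intros Hd. apply Hz. now exists b.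
Qed.

Lemma uN_hyperplanes k n th F G : ifs_ok k n th F G -> forall m, exists V, forall z, supn (S k) z <= 1 ->
  ~ deep k th (S m) z -> exists i, (i < S n)%nat /\ In (uN k n th F G (S m) z i) V.
Proof.
  intros OK m. induction m as [|m [V IH]].
  - exists (-1 :: 0 :: 1 :: nil). intros z Hz Hd. destruct (off_or_in k th z) as [Hoff|[b [Hb Hin]]].
    + destruct (ifs_off _ _ _ _ _ OK z Hz Hoff) as [_ [i [Hi H]]]. exists i. split; [easy|]. now rewrite uN_off.
    + destruct Hd. now exists b.
  - exists ((-1 :: 0 :: 1 :: nil) ++ V ++ map (fun v => (sgn n * v + 1) / 2) V ++ map (fun v => (sgn n * v + -1) / 2) V).
    intros z Hz Hd. destruct (off_or_in k th z) as [Hoff|[b [Hb Hin]]].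
    + destruct (ifs_off _ _ _ _ _ OK z Hz Hoff) as [_ [i [Hi H]]]. exists i. split; [easy|].
      rewrite uN_off by easy. apply in_or_app. now left.
    + destruct (IH (hinv k th b z) Hin) as [i [Hi H]]; [intros h; apply Hd; now exists b|].
      destruct i as [|i].
      * exists n. split; [lia|]. rewrite (uN_in k n th F G _ z b) by (easy || lia). rewrite wmap_last.
        apply in_or_app; right. apply in_or_app; right. apply in_or_app.
        destruct Hb as [-> | ->]; [left; now apply (in_map (fun v => (sgn n * v + 1) / 2))
          |right; now apply (in_map (fun v => (sgn n * v + -1) / 2))].
      * exists i. split; [lia|]. rewrite (uN_in k n th F G _ z b) by (easy || lia). rewrite wmap_lt by lia.
        apply in_or_app; right. apply in_or_app; now left.
Qed.

Lemma hinv_sdist k th b z z' : 0 < th -> sdist (S k) (hinv k th b z) (hinv k th b z') <= / th * 2 * sdist (S k) z z'.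
Proof.
  intros Ht. assert (Hi : 0 < / th) by now apply Rinv_0_lt_compat. pose proof (sdist_nonneg (S k) z z').
  apply sdist_le; [apply Rmult_le_pos; lra|]. intros [|i] Hi'.
  - rewrite !hinv_0. pose proof (sdist_ge (S k) z z' k ltac:(lia)).
    replace (sgn k * (/ th * (2 * z k - b)) - sgn k * (/ th * (2 * z' k - b))) with (sgn k * (/ th * 2 * (z k - z' k))) by ring.
    rewrite Rabs_mult, sgn_abs, Rmult_1_l, Rabs_mult, (Rabs_pos_eq (/ th * 2)) by lra.
    apply Rmult_le_compat_l; lra.
  - rewrite !hinv_S by lia. pose proof (sdist_ge (S k) z z' i ltac:(lia)).
    replace (/ th * z i - / th * z' i) with (/ th * (z i - z' i)) by ring.
    rewrite Rabs_mult, (Rabs_pos_eq (/ th)) by lra. rewrite Rmult_assoc. apply Rmult_le_compat_l; lra.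
Qed.

Lemma deep_closed k th m z : 0 < th -> ~ deep k th m z -> exists r, 0 < r /\ forall y, sdist (S k) y z < r -> ~ deep k th m y.
Proof.
  intros Ht. revert z; induction m as [|m IH]; intros z H; cbn [deep] in H.
  - exists (supn (S k) z - 1). split; [lra|]. intros y Hy Hd. cbn [deep] in Hd.
    pose proof (supn_sdist (S k) z y). rewrite sdist_sym in Hy. lra.
  - assert (HB : forall b, pm b -> exists r, 0 < r /\ forall y, sdist (S k) y z < r -> ~ deep k th m (hinv k th b y)).
    { intros b Hb. destruct (IH (hinv k th b z)) as [r [Hr Hy]]; [intros h; apply H; now exists b|].
      exists (r * th / 2). split; [nra|]. intros y Hyz. apply Hy.
      eapply Rle_lt_trans; [now apply hinv_sdist|].
      apply (Rmult_lt_compat_l (/ th * 2)) in Hyz; [|pose proof (Rinv_0_lt_compat th Ht); lra].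
      replace (/ th * 2 * (r * th / 2)) with r in Hyz by (field; lra). easy. }
    destruct (HB 1 pm_1) as [r1 [Hr1 H1]]. destruct (HB (-1) pm_m1) as [r2 [Hr2 H2]].
    exists (Rmin r1 r2). split; [now apply Rmin_pos|]. intros y Hy [b [[-> | ->] Hd]].
    + apply (H1 y); [|easy]. eapply Rlt_le_trans; [exact Hy|apply Rmin_l].
    + apply (H2 y); [|easy]. eapply Rlt_le_trans; [exact Hy|apply Rmin_r].
Qed.

(** The initial radius 2 is mu^(k+1), a bound for the weighted radius of the unit cube; each
    generation doubles the number of centres and multiplies the radius by [lam]. *)
Lemma deep_cover k lam mu m : 0 < lam -> 1 <= mu -> mu ^ S k = 2 -> lam * mu < 1 ->
  exists c : nat -> vec, forall z, deep k (lam * mu) m z ->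
    exists j, (j < 2 ^ m)%nat /\ wd (S k) mu z (c j) <= 2 * lam ^ m.
Proof.
  intros Hl Hm Hp Ht. induction m as [|m [c IH]].
  - exists (fun _ _ => 0). intros z Hz. exists O. split; [simpl; lia|]. cbn [deep] in Hz.
    eapply Rle_trans; [now apply wd_sdist|]. rewrite Hp. simpl.
    apply Rmult_le_compat_l; [lra|].
    eapply Rle_trans; [|exact Hz]. apply supn_mono. intros i _. unfold vsub. rewrite Rminus_0_r. lra.
  - exists (fun j => if (j <? 2 ^ m)%nat then hmap k (lam * mu) 1 (c j) else hmap k (lam * mu) (-1) (c (j - 2 ^ m)%nat)).
    assert (G : forall z b j, deep k (lam * mu) m (hinv k (lam * mu) b z) ->
      wd (S k) mu (hinv k (lam * mu) b z) (c j) <= 2 * lam ^ m ->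
      wd (S k) mu z (hmap k (lam * mu) b (c j)) <= 2 * lam ^ S m).
    { intros z b j _ H.
      rewrite (wd_ext _ _ z _ (hmap k (lam * mu) b (hinv k (lam * mu) b z)) (hmap k (lam * mu) b (c j))); [|intros; symmetry; apply hmap_hinv; [nra|easy]|easy].
      eapply Rle_trans; [now apply hmap_wd|]. simpl. nra. }
    intros z [b [[-> | ->] Hd]]; destruct (IH _ Hd) as [j [Hj H]].
    + exists j. split; [simpl; lia|]. replace (j <? 2 ^ m)%nat with true by (symmetry; apply Nat.ltb_lt; lia). auto.
    + exists (j + 2 ^ m)%nat. split; [simpl; lia|].
      replace (j + 2 ^ m <? 2 ^ m)%nat with false by (symmetry; apply Nat.ltb_ge; lia).
      rewrite Nat.add_sub. auto.
Qed.

Lemma pow_small x e C : 0 <= x < 1 -> 0 < e -> 0 <= C -> exists m, C * x ^ m <= e.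
Proof.
  intros Hx He HC. destruct (pow_lt_1_zero x) with (y := e / (C + 1)) as [m Hm].
  - rewrite Rabs_pos_eq; lra.
  - apply Rdiv_lt_0_compat; lra.
  - exists m. specialize (Hm m (Nat.le_refl _)). assert (0 <= x ^ m) by (apply pow_le; lra).
    rewrite Rabs_pos_eq in Hm by easy.
    apply Rle_trans with ((C + 1) * x ^ m); [nra|].
    apply (Rmult_lt_compat_l (C + 1)) in Hm; [|lra].
    replace ((C + 1) * (e / (C + 1))) with e in Hm by (field; lra). lra.
Qed.

(** At generation m the cubes have total volume (4 rho)^(k+1) (2 lam^(k+1))^m. *)
Lemma deep_null k lam mu rho : 0 < lam -> 1 <= mu -> mu ^ S k = 2 -> lam * mu < 1 -> 2 * lam ^ S k < 1 -> 0 < rho ->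
  null_set (S k) (fun z => forall m, deep k (lam * mu) m (fun i => / rho * z i)).
Proof.
  intros Hl Hm Hp Ht H2 Hr. apply null_cubes; [lia|]. intros eps He.
  destruct (pow_small (2 * lam ^ S k) eps ((4 * rho) ^ S k)) as [m Hpow]; [|easy| |].
  { split; [|easy]. apply Rmult_le_pos; [lra|apply pow_le; lra]. }
  { apply pow_le; lra. }
  destruct (deep_cover k lam mu m) as [c Hc]; auto.
  assert (Hlm : 0 < lam ^ m) by now apply pow_lt.
  exists (2 ^ m)%nat, (fun j i => rho * c j i), (rho * (2 * lam ^ m)). split; [nra|]. split.
  - intros x Hx. destruct (Hc _ (Hx m)) as [j [Hj H]]. exists j. split; [easy|]. intros i Hi.
    pose proof (sdist_wd (S k) mu (fun i => / rho * x i) (c j) Hm).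
    pose proof (sdist_ge (S k) (fun i => / rho * x i) (c j) i Hi).
    replace (x i - rho * c j i) with (rho * (/ rho * x i - c j i)) by (field; lra).
    rewrite Rabs_mult, Rabs_pos_eq by lra. apply Rmult_le_compat_l; lra.
  - eapply Rle_trans; [|exact Hpow]. apply Req_le.
    replace (2 * (rho * (2 * lam ^ m))) with ((4 * rho) * lam ^ m) by ring.
    rewrite pow_INR, Rpow_mult_distr, (Rpow_mult_distr 2 (lam ^ S k) m), <- !pow_mult, (Nat.mul_comm m (S k)).
    simpl (INR 2). replace (1 + 1) with 2 by ring. ring.
Qed.

Lemma psv_lip m q (f : vec -> vec) r : 0 <= r -> (forall i, (i < q)%nat -> PS m (fun x => f x i)) ->
  exists L, 0 <= L /\ forall x y, supn m x <= r -> supn m y <= r -> sdist q (f x) (f y) <= L * sdist m x y.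
Proof.
  intros Hr H. induction q as [|q IH].
  - exists 0. split; [lra|]. intros x y _ _. unfold sdist at 1. simpl. lra.
  - destruct IH as [L [HL IH]]; [auto|].
    destruct (ps_lip m (fun x => f x q) (H q ltac:(lia)) r Hr) as [L' [_ [HL' [_ [_ H']]]]].
    exists (Rmax L L'). split; [eapply Rle_trans; [exact HL|apply Rmax_l]|]. intros x y Hx Hy.
    pose proof (sdist_nonneg m x y). unfold sdist at 1. simpl. apply Rmax_lub.
    + eapply Rle_trans; [now apply IH|]. apply Rmult_le_compat_r; [easy|apply Rmax_l].
    + eapply Rle_trans; [now apply H'|]. apply Rmult_le_compat_r; [easy|apply Rmax_r].
Qed.

(** * A Lipschitz bound uniform in the generation *)

Section uniform_lipschitz.

Context (k n : nat) (lam mu : R) (F G : vec -> vec).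
Context (Hlam : 0 < lam < 1) (Hmu : 1 <= mu) (Hlamn : lam ^ S n = / 2) (Hmuk : mu ^ S k = 2).
Context (OK : ifs_ok k n (lam * mu) F G).

Let th := lam * mu.
Let u := uN k n th F G.
Let dB := wd (S n) (/ lam).
Let dD := wd (S k) mu.

Lemma inv_lam_ge1 : 1 <= / lam.
Proof. rewrite <- Rinv_1. apply Rinv_le_contravar; lra. Qed.

Lemma psv_wd_lip (f : vec -> vec) : (forall i, (i < S n)%nat -> PS (S k) (fun x => f x i)) ->
  exists L, 0 <= L /\ forall x y, supn (S k) x <= 1 -> supn (S k) y <= 1 -> dB (f x) (f y) <= L * dD x y.
Proof.
  intros H. destruct (psv_lip (S k) (S n) f 1) as [L [HL Hf]]; [lra|easy|].
  assert (Hp : 0 < (/ lam) ^ S n) by (apply pow_lt, Rinv_0_lt_compat; lra).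
  exists ((/ lam) ^ S n * L). split; [apply Rmult_le_pos; lra|]. intros x y Hx Hy.
  eapply Rle_trans; [apply wd_sdist, inv_lam_ge1|]. rewrite Rmult_assoc. apply Rmult_le_compat_l; [lra|].
  eapply Rle_trans; [now apply Hf|]. apply Rmult_le_compat_l; [easy|]. now apply sdist_wd.
Qed.

Definition retr (b : R) (z : vec) : vec := hmap k (lam * mu) b (clampv (hinv k (lam * mu) b z)).

(** A hole is a box, so clamping its coordinates is a nearest point retraction for every weighted
    sup distance. *)
Lemma retr_near b z y : supn (S k) (hinv k th b y) <= 1 -> dD (retr b z) z <= dD y z.
Proof.
  intros Hy. pose proof (ifs_th _ _ _ _ _ OK) as Ht.
  unfold retr, dD. rewrite (wd_ext _ _ _ z (hmap k th b (clampv (hinv k th b z))) (hmap k th b (hinv k th b z)));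
    [|easy|intros; symmetry; apply hmap_hinv; unfold th; [lra|easy]].
  eapply Rle_trans; [apply hmap_wd; lra|].
  apply Rle_trans with (lam * (/ lam * wd (S k) mu y z)).
  - apply Rmult_le_compat_l; [lra|]. eapply Rle_trans; [|apply (hinv_wd k lam mu b y z); lra].
    apply supn_mono. intros i Hi. rewrite !Rabs_mult. apply Rmult_le_compat_l; [apply Rabs_pos|].
    assert (Hyi : Rabs (hinv k (lam * mu) b y i) <= 1) by (eapply Rle_trans; [now apply (supn_ge (S k) (hinv k (lam * mu) b y) i)|easy]).
    apply Rabs_le_between in Hyi. unfold clampv, th.
    set (t := hinv k (lam * mu) b z i). set (s := hinv k (lam * mu) b y i) in *.
    destruct (Rle_dec t (-1)); [rewrite clamp_lo by lra; rewrite !Rabs_pos_eq; lra|].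
    destruct (Rle_dec 1 t); [rewrite clamp_hi by lra; rewrite !Rabs_left1; lra|].
    rewrite clamp_id, Rminus_diag, Rabs_R0 by lra. apply Rabs_pos.
  - rewrite <- Rmult_assoc, Rinv_r by lra. lra.
Qed.

Lemma dB_ext x y x' y' : (forall i, (i < S n)%nat -> x i = x' i) -> (forall i, (i < S n)%nat -> y i = y' i) -> dB x y = dB x' y'.
Proof. apply wd_ext. Qed.

Lemma dB_tri x y z : dB x z <= dB x y + dB y z.
Proof. apply wd_tri, Rinv_0_lt_compat; lra. Qed.

Lemma dD_tri x y z : dD x z <= dD x y + dD y z.
Proof. apply wd_tri; lra. Qed.

Lemma dB_sym x y : dB x y = dB y x.
Proof. apply wd_sym, Rinv_0_lt_compat; lra. Qed.

Lemma dD_sym x y : dD x y = dD y x.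
Proof. apply wd_sym; lra. Qed.

Lemma retr_bd b z : pm b -> 1 <= supn (S k) (hinv k th b z) ->
  supn (S k) (retr b z) <= 1 /\ supn (S k) (hinv k th b (retr b z)) = 1 /\
  (forall b', pm b' -> 1 <= supn (S k) (hinv k th b' (retr b z))).
Proof.
  intros Hb H. pose proof (ifs_th _ _ _ _ _ OK) as Ht. apply clampv_bd in H.
  assert (H1 : supn (S k) (hinv k th b (retr b z)) = 1).
  { rewrite <- H. apply supn_ext. intros i Hi. apply hinv_hmap; [unfold th; lra|easy]. }
  split; [|split]; [|easy|].
  - unfold retr. eapply Rle_trans; [apply hmap_le; [easy|easy|apply clampv_le]|]. lra.
  - intros b' Hb'. destruct (Req_dec b' b) as [->|Hne]; [lra|].
    left. apply (holes_disjoint k th b); auto. lra.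
Qed.

(* A boundary point keeps a positive distance from the holes, which gives a bound that does not deteriorate with the generation m. *)
Lemma uN_bd_lip : exists L, 0 <= L /\
  (forall x y, supn (S k) x <= 1 -> supn (S k) y <= 1 -> dB (G x) (G y) <= L * dD x y) /\
  (forall x y, supn (S k) x <= 1 -> supn (S k) y <= 1 -> dB (F x) (F y) <= L * dD x y) /\
  (forall m x y, supn (S k) x <= 1 -> supn (S k) y = 1 -> dB (u m x) (u m y) <= L * dD x y).
Proof.
  pose proof (ifs_th _ _ _ _ _ OK) as Ht. fold th in Ht.
  destruct (psv_wd_lip G (ifs_G _ _ _ _ _ OK)) as [LG [HLG HG]].
  destruct (psv_wd_lip F (ifs_F _ _ _ _ _ OK)) as [LF [HLF HF]].
  assert (Hp : 0 < (/ lam) ^ S n) by (apply pow_lt, Rinv_0_lt_compat; lra).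
  (* [Dm] bounds the weighted diameter of the target cube, and [gam] is the gap between the boundary
     and the holes, which lie in |z| <= (1+th)/2. *)
  set (Dm := (/ lam) ^ S n * 2). set (gam := (1 - th) / 2). assert (Hgam : 0 < gam) by (unfold gam; lra).
  assert (HDg : 0 <= Dm / gam) by (apply Rdiv_le_0_compat; unfold Dm; nra).
  exists (LG + LF + Dm / gam). split; [lra|].
  assert (Hmon : forall c x y, c <= LG + LF + Dm / gam -> forall w, w <= c * dD x y -> w <= (LG + LF + Dm / gam) * dD x y).
  { intros c x y Hc w Hw. eapply Rle_trans; [exact Hw|]. apply Rmult_le_compat_r; [apply wd_nonneg|easy]. }
  split; [|split].
  - intros x y Hx Hy. apply (Hmon LG); [lra|auto].
  - intros x y Hx Hy. apply (Hmon LF); [lra|auto].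
  - intros m x y Hx Hy. destruct m as [|m]; [apply (Hmon LF); [lra|apply HF; lra]|].
    assert (Ey : forall i, (i < S n)%nat -> u (S m) y i = G y i).
    { intros i Hi. apply uN_off; [easy|easy|]. intros b Hb. left. now apply bd_not_hole. }
    destruct (off_or_in k th x) as [Hoff|[b [Hb Hin]]].
    + rewrite (dB_ext _ _ (G x) (G y)); [|intros; now apply uN_off|easy].
      apply (Hmon LG); [lra|apply HG; lra].
    + assert (Hd : gam <= dD x y).
      { eapply Rle_trans; [|now apply sdist_wd].
        pose proof (hmap_le k th b (hinv k th b x) Ht Hb Hin) as Hh.
        rewrite (supn_ext _ _ x) in Hh by (intros; apply hmap_hinv; [lra|easy]).
        pose proof (supn_sdist (S k) y x). rewrite sdist_sym. unfold gam. lra. }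
      assert (HB : dB (u (S m) x) (u (S m) y) <= Dm).
      { eapply Rle_trans; [apply wd_sdist, inv_lam_ge1|]. unfold Dm. apply Rmult_le_compat_l; [lra|].
        apply sdist_le; [lra|]. intros i Hi.
        assert (Hux : Rabs (u (S m) x i) <= 1).
        { eapply Rle_trans; [now apply (supn_ge (S n) (u (S m) x) i)|]. now apply uN_le. }
        assert (Huy : Rabs (u (S m) y i) <= 1).
        { eapply Rle_trans; [now apply (supn_ge (S n) (u (S m) y) i)|]. apply uN_le; [easy|lra]. }
        apply Rabs_le_between in Hux, Huy. apply Rabs_le. lra. }
      apply (Hmon (Dm / gam)); [lra|]. eapply Rle_trans; [exact HB|].
      replace Dm with (Dm / gam * gam) at 1 by (field; lra). now apply Rmult_le_compat_l.
Qed.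

Lemma uN_wd_lip : exists L, 0 <= L /\ forall m x y, supn (S k) x <= 1 -> supn (S k) y <= 1 ->
  dB (u m x) (u m y) <= L * dD x y.
Proof.
  pose proof (ifs_th _ _ _ _ _ OK) as Ht. fold th in Ht.
  destruct uN_bd_lip as [L [HL [HG [HF Hbd]]]].
  assert (Hoffoff : forall m x y, supn (S k) x <= 1 -> supn (S k) y <= 1 ->
    (forall b, pm b -> 1 <= supn (S k) (hinv k th b x)) -> (forall b, pm b -> 1 <= supn (S k) (hinv k th b y)) ->
    dB (u (S m) x) (u (S m) y) <= L * dD x y).
  { intros m x y Hx Hy Hox Hoy. rewrite (dB_ext _ _ (G x) (G y)); [auto| |]; intros; now apply uN_off. }
  assert (Hretr : forall m b x y, pm b -> supn (S k) (hinv k th b x) <= 1 -> 1 <= supn (S k) (hinv k th b y) ->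
    dB (u (S m) x) (u (S m) (retr b y)) <= L * dD x (retr b y)).
  { intros m b x y Hb Hx Hy. destruct (retr_bd b y Hb Hy) as [_ [Hr _]].
    rewrite (dB_ext _ _ (wmap n b (u m (hinv k th b x))) (wmap n b (u m (hinv k th b (retr b y)))));
      [|intros; now apply uN_in|intros; apply uN_in; auto; lra].
    eapply Rle_trans; [apply wmap_wd; [lra|easy]|].
    apply Rle_trans with (lam * (L * (/ lam * dD x (retr b y)))).
    - apply Rmult_le_compat_l; [lra|]. eapply Rle_trans; [now apply Hbd|]. apply Rmult_le_compat_l; [easy|].
      apply hinv_wd; lra.
    - apply Req_le. field. lra. }
  assert (Hinoff : forall m b x y, pm b -> supn (S k) y <= 1 -> supn (S k) (hinv k th b x) <= 1 ->
    (forall b, pm b -> 1 <= supn (S k) (hinv k th b y)) -> dB (u (S m) x) (u (S m) y) <= 3 * L * dD x y).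
  { intros m b x y Hb Hy Hx Hoy.
    pose proof (Hretr m b x y Hb Hx (Hoy b Hb)) as H1.
    destruct (retr_bd b y Hb (Hoy b Hb)) as [Hr1 [_ Hr2]].
    pose proof (Hoffoff m (retr b y) y Hr1 Hy Hr2 Hoy) as H2.
    pose proof (retr_near b y x Hx) as H3. pose proof (dB_tri (u (S m) x) (u (S m) (retr b y)) (u (S m) y)) as H4.
    pose proof (dD_tri x y (retr b y)) as H5. rewrite (dD_sym y (retr b y)) in H5.
    assert (L * dD x (retr b y) <= L * (2 * dD x y)) by (apply Rmult_le_compat_l; lra).
    assert (L * dD (retr b y) y <= L * dD x y) by (apply Rmult_le_compat_l; lra). lra. }
  exists (5 * L). split; [lra|].
  assert (Hmon : forall c x y, 0 <= c <= 5 -> forall w, w <= c * L * dD x y -> w <= 5 * L * dD x y).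
  { intros c x y Hc w Hw. eapply Rle_trans; [exact Hw|]. apply Rmult_le_compat_r; [apply wd_nonneg|nra]. }
  induction m as [|m IH]; intros x y Hx Hy; [apply (Hmon 1); [lra|]; rewrite Rmult_1_l; now apply HF|].
  destruct (off_or_in k th x) as [Hox|[b [Hb Hbx]]].
  - destruct (off_or_in k th y) as [Hoy|[b [Hb Hby]]].
    + apply (Hmon 1); [lra|]. rewrite Rmult_1_l. now apply Hoffoff.
    + apply (Hmon 3); [lra|]. rewrite dB_sym, dD_sym. now apply (Hinoff m b).
  - destruct (Rle_dec (supn (S k) (hinv k th b y)) 1) as [Hby|Hby].
    + rewrite (dB_ext _ _ (wmap n b (u m (hinv k th b x))) (wmap n b (u m (hinv k th b y))));
        [|intros; now apply uN_in|intros; now apply uN_in].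
      eapply Rle_trans; [apply wmap_wd; [lra|easy]|].
      apply Rle_trans with (lam * (5 * L * (/ lam * dD x y))).
      * apply Rmult_le_compat_l; [lra|]. eapply Rle_trans; [now apply IH|]. apply Rmult_le_compat_l; [lra|].
        apply hinv_wd; lra.
      * apply Req_le. field. lra.
    + destruct (off_or_in k th y) as [Hoy|[b' [Hb' Hb'y]]]; [apply (Hmon 3); [lra|]; now apply (Hinoff m b)|].
      assert (Hby' : 1 <= supn (S k) (hinv k th b y)) by lra.
      pose proof (Hretr m b x y Hb Hbx Hby') as H1.
      destruct (retr_bd b y Hb Hby') as [Hr1 [_ Hr2]].
      pose proof (Hinoff m b' y (retr b y) Hb' Hr1 Hb'y Hr2) as H2. rewrite dB_sym, dD_sym in H2.
      pose proof (retr_near b y x Hbx) as H3. pose proof (dB_tri (u (S m) x) (u (S m) (retr b y)) (u (S m) y)) as H4.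
      pose proof (dD_tri x y (retr b y)) as H5. rewrite (dD_sym y (retr b y)) in H5.
      assert (L * dD x (retr b y) <= L * (2 * dD x y)) by (apply Rmult_le_compat_l; lra).
      assert (3 * L * dD (retr b y) y <= 3 * L * dD x y) by (apply Rmult_le_compat_l; lra). lra.
Qed.

Lemma uN_lip : exists L, 0 <= L /\ forall m x y, supn (S k) x <= 1 -> supn (S k) y <= 1 ->
  sdist (S n) (uN k n (lam * mu) F G m x) (uN k n (lam * mu) F G m y) <= L * sdist (S k) x y.
Proof.
  destruct uN_wd_lip as [L [HL H]]. exists (L * mu ^ S k). split; [apply Rmult_le_pos; [easy|apply pow_le; lra]|].
  intros m x y Hx Hy. eapply Rle_trans; [apply (sdist_wd _ (/ lam)), inv_lam_ge1|].
  eapply Rle_trans; [now apply H|]. rewrite Rmult_assoc. apply Rmult_le_compat_l; [easy|]. now apply wd_sdist.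
Qed.

End uniform_lipschitz.

(** * The pattern of one generation *)

Lemma ps_weaken m q f : (m <= q)%nat -> PS m f -> PS q f.
Proof. intros H Hf. apply (ps_subst q m f (fun x => x)); [easy|]. intros i Hi. apply ps_coord. lia. Qed.

Lemma cyc_ps m n (u : vec -> vec) : (forall i, (i < S n)%nat -> PS m (fun z => u z i)) ->
  forall i, (i < S n)%nat -> PS m (fun z => cyc n (u z) i).
Proof.
  intros H i Hi. destruct (Nat.eq_dec i n) as [->|Hne].
  - apply (ps_ext m (fun z => sgn n * u z O)); [intros; now rewrite cyc_last|]. apply ps_scal, H; lia.
  - apply (ps_ext m (fun z => u z (S i))); [intros; now rewrite cyc_lt by lia|apply H; lia].
Qed.

Lemma cyc_inv_ps m n (u : vec -> vec) : (forall i, (i < S n)%nat -> PS m (fun z => u z i)) ->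
  forall i, (i < S n)%nat -> PS m (fun z => cyc_inv n (u z) i).
Proof.
  intros H [|i] Hi; simpl; [apply ps_scal, H; lia|apply H; lia].
Qed.

(** Parameter of the homotopy in the shell: 0 on the boundary of the cube, 1 for |z| <= th. *)
Definition mixp (th : R) (k : nat) (z : vec) : R := clamp 0 1 (/ (1 - th) * (1 - supn (S k) z)).

Definition cyc_inv_mix (k : nat) (s : R) (z : vec) : vec := fun i => (1 - s) * z i + s * cyc_inv k z i.
Definition cyc_mix (n : nat) (s : R) (y : vec) : vec := fun i => (1 - s) * y i + s * cyc n y i.

Lemma mixp_ps th k : PS (S k) (mixp th k).
Proof.
  apply ps_clamp, ps_scal, ps_sub; [apply ps_const|]. apply (ps_supn (S k) (S k) (fun z => z)). intros; now apply ps_coord.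
Qed.

Lemma mixp_range th k z : 0 <= mixp th k z <= 1.
Proof. apply clamp_range. lra. Qed.

Lemma cyc_inv_mix_ps th k i : (i < S k)%nat -> PS (S k) (fun z => cyc_inv_mix k (mixp th k z) z i).
Proof.
  intros Hi. apply ps_add; apply ps_mul.
  - apply ps_sub; [apply ps_const|apply mixp_ps].
  - now apply ps_coord.
  - apply mixp_ps.
  - apply (cyc_inv_ps (S k) k (fun z => z)); [intros; now apply ps_coord|easy].
Qed.

Lemma supn_pos m x i : (i < m)%nat -> x i <> 0 -> 0 < supn m x.
Proof.
  intros Hi Hx. eapply Rlt_le_trans; [|apply (supn_ge m x i Hi)]. now apply Rabs_pos_lt.
Qed.

Lemma supn_pos_ex m x : 0 < supn m x -> exists i, (i < m)%nat /\ x i <> 0.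
Proof.
  intros H. destruct m as [|m]; [simpl in H; lra|].
  destruct (supn_attained (S m) x) as [i [Hi Hx]]; [lia|]. exists i. split; [easy|].
  intros h. rewrite h, Rabs_R0 in Hx. lra.
Qed.

(** [c0] depends on [k] and [th] only. It is available before [g] and tells how near 0 the map [g]
    may have zeros. *)
Lemma cyc_inv_mix_lower k th : 0 < th < 1 -> exists c0, 0 < c0 /\ forall z, th <= supn (S k) z <= 1 ->
  c0 <= supn (S k) (cyc_inv_mix k (mixp th k z) z).
Proof.
  intros Ht. destruct (ps_pos_lower_bound (S k) (fun z => supn (S k) (cyc_inv_mix k (mixp th k z) z))
    (fun z => supn (S k) z - th) 1) as [c [Hc H]]; [lra| | | |].
  - apply (ps_supn (S k) (S k) (fun z => cyc_inv_mix k (mixp th k z) z)). apply cyc_inv_mix_ps.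
  - apply ps_sub; [|apply ps_const]. apply (ps_supn (S k) (S k) (fun z => z)). intros; now apply ps_coord.
  - intros z Hz Hz'. destruct (supn_pos_ex (S k) z) as [i [Hi Hzi]]; [lra|].
    apply NNPP. intros Hno. apply Hzi. apply (cyc_inv_mix_inj k (mixp th k z)); [apply mixp_range| |easy].
    intros j Hj. apply NNPP. intros Hne. apply Hno. now apply (supn_pos _ _ j).
  - exists c. split; [easy|]. intros z Hz. apply H; lra.
Qed.

Section pattern.

Context (k n : nat) (th c0 : R) (g : vec -> vec).
Context (Ht : 0 < th < 1).
Context (Hc0 : forall z, th <= supn (S k) z <= 1 -> c0 <= supn (S k) (cyc_inv_mix k (mixp th k z) z)).
Context (Hc0p : 0 < c0).
Context (Hgps : forall i, (i < n)%nat -> PS k (fun x => g x i)).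
Context (Hgle : forall x, supn n (g x) <= 1).
Context (Hgbd : forall x, 1 <= supn k x -> supn n (g x) = 1).
Context (Hgnz : forall x, c0 <= supn k x -> exists i, (i < n)%nat /\ g x i <> 0).

Definition patF (z : vec) : vec := fun i => if Nat.eqb i n then z k else g z i.

(* On the shell th <= |z| <= 1 this homotopy joins F on the outer boundary to cyc o F o cyc^-1 on the inner one; it avoids 0
   because the cyclic permutations do not have the eigenvalue -1. *)
Definition patP (z : vec) : vec :=
  let s := mixp th k z in
  cyc_mix n s (patF (fun i => ((1 - s) + s * / th) * cyc_inv_mix k s z i)).

(** Radial projection to the boundary of the target cube wherever |P| >= d1. The maximum gives
    [ps_inv] its lower bound everywhere, including where P vanishes. *)
Definition patH (d1 : R) (z : vec) : vec := fun i => / Rmax (supn (S n) (patP z)) d1 * patP z i.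

(** Stretches the half [b] to the whole cube and flattens the other half onto the face where the
    last coordinate is -b. *)
Definition patz (b : R) (z : vec) : vec := fun i => if Nat.eqb i k then clamp (-1) 1 (2 * z k - b) else z i.

(* If b z_k >= 0, then [patz (- b) z] lies on a horizontal face, where H = F, so that only the half [b] contributes. *)
Definition patG (d1 : R) (z : vec) : vec := fun i =>
  if Nat.eqb i n then / 2 * (patH d1 (patz 1 z) n + patH d1 (patz (-1) z) n)
  else patH d1 (patz 1 z) i + patH d1 (patz (-1) z) i - g z i.

Lemma patF_last z : patF z n = z k.
Proof. unfold patF. now rewrite Nat.eqb_refl. Qed.

Lemma patF_lt z i : (i < n)%nat -> patF z i = g z i.
Proof. intros H. unfold patF. now rewrite (eqb_ne i n) by lia. Qed.

Lemma patF_ps i : (i < S n)%nat -> PS (S k) (fun z => patF z i).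
Proof.
  intros Hi. destruct (Nat.eq_dec i n) as [->|Hne].
  - apply (ps_ext _ (fun z => z k)); [intros; now rewrite patF_last|]. apply ps_coord; lia.
  - apply (ps_ext _ (fun z => g z i)); [intros; now rewrite patF_lt by lia|]. apply (ps_weaken k); [lia|apply Hgps; lia].
Qed.

Lemma patF_ext x y : (forall i, (i < S k)%nat -> x i = y i) -> forall i, (i < S n)%nat -> patF x i = patF y i.
Proof. intros H i Hi. apply (ps_dep (S k) (fun z => patF z i)); [now apply patF_ps|easy]. Qed.

Lemma patF_le z : supn (S k) z <= 1 -> supn (S n) (patF z) <= 1.
Proof.
  intros Hz. apply supn_le; [lra|]. intros i Hi. destruct (Nat.eq_dec i n) as [->|Hne].
  - rewrite patF_last. eapply Rle_trans; [apply (supn_ge (S k) z k); lia|easy].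
  - rewrite patF_lt by lia. eapply Rle_trans; [apply (supn_ge n (g z) i); lia|apply Hgle].
Qed.

Lemma patF_bd z : supn (S k) z = 1 -> supn (S n) (patF z) = 1.
Proof.
  intros Hz. apply Rle_antisym; [apply patF_le; lra|].
  destruct (supn_attained (S k) z) as [j [Hj Hzj]]; [lia|]. rewrite Hz in Hzj.
  destruct (Nat.eq_dec j k) as [->|Hne].
  - rewrite <- Hzj, <- patF_last. apply supn_ge; lia.
  - assert (H1 : 1 <= supn k z) by (rewrite <- Hzj; apply supn_ge; lia).
    rewrite <- (Hgbd z H1). apply supn_le; [apply supn_nonneg|]. intros i Hi.
    rewrite <- patF_lt by easy. apply supn_ge; lia.
Qed.

Lemma patF_nz z : c0 <= supn (S k) z -> 0 < supn (S n) (patF z).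
Proof.
  intros Hz. destruct (Req_dec (z k) 0) as [h|h].
  - assert (H : c0 <= supn k z).
    { simpl in Hz. rewrite h, Rabs_R0, Rmax_left in Hz; [easy|apply supn_nonneg]. }
    destruct (Hgnz z H) as [i [Hi Hg]]. apply (supn_pos _ _ i); [lia|]. now rewrite patF_lt.
  - apply (supn_pos _ _ n); [lia|]. now rewrite patF_last.
Qed.

Lemma patP_ps i : (i < S n)%nat -> PS (S k) (fun z => patP z i).
Proof.
  intros Hi. unfold patP, cyc_mix.
  assert (HF : forall j, (j < S n)%nat -> PS (S k) (fun z => patF (fun i => ((1 - mixp th k z) + mixp th k z * / th) * cyc_inv_mix k (mixp th k z) z i) j)).
  { intros j Hj. apply (ps_subst (S k) (S k) (fun z => patF z j)); [now apply patF_ps|]. intros l Hl.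
    apply ps_mul; [|now apply cyc_inv_mix_ps].
    apply ps_add; [apply ps_sub; [apply ps_const|apply mixp_ps]|apply ps_mul; [apply mixp_ps|apply ps_const]]. }
  apply ps_add; apply ps_mul.
  - apply ps_sub; [apply ps_const|apply mixp_ps].
  - now apply HF.
  - apply mixp_ps.
  - now apply (cyc_ps (S k) n (fun z => patF (fun i => ((1 - mixp th k z) + mixp th k z * / th) * cyc_inv_mix k (mixp th k z) z i))).
Qed.

Lemma supn_patP_ps : PS (S k) (fun z => supn (S n) (patP z)).
Proof. apply ps_supn. apply patP_ps. Qed.

Lemma patP_pos z : th <= supn (S k) z <= 1 -> 0 < supn (S n) (patP z).
Proof.
  intros Hz. specialize (Hc0 z Hz). unfold patP. set (s := mixp th k z) in *.
  assert (Hs : 0 <= s <= 1) by apply mixp_range.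
  set (a := fun i => ((1 - s) + s * / th) * cyc_inv_mix k s z i).
  assert (Ha : c0 <= supn (S k) a).
  { unfold a. rewrite supn_scal. assert (1 < / th) by (rewrite <- Rinv_1; apply Rinv_lt_contravar; lra).
    assert (Hk : 1 <= (1 - s) + s * / th) by nra.
    rewrite Rabs_pos_eq by lra. apply Rle_trans with (1 * supn (S k) (cyc_inv_mix k s z)); [lra|].
    apply Rmult_le_compat_r; [apply supn_nonneg|easy]. }
  destruct (supn_pos_ex _ _ (patF_nz a Ha)) as [i [Hi Hne]].
  apply NNPP. intros Hno. apply Hne. apply (cyc_mix_inj n s); [easy| |easy].
  intros j Hj. apply NNPP. intros Hj0. apply Hno. now apply (supn_pos _ _ j).
Qed.

Lemma patP_bd z i : supn (S k) z = 1 -> (i < S n)%nat -> patP z i = patF z i.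
Proof.
  intros Hz Hi. unfold patP. assert (Hs : mixp th k z = 0).
  { unfold mixp. rewrite Hz, Rminus_diag, Rmult_0_r. apply clamp_id. lra. }
  rewrite Hs. unfold cyc_mix.
  match goal with |- (1 - 0) * ?A + 0 * ?B = _ => transitivity A; [ring|] end.
  apply patF_ext; [|easy]. intros j Hj. unfold cyc_inv_mix. ring.
Qed.

Lemma patP_hole x i : supn (S k) x = 1 -> (i < S n)%nat -> patP (fun j => th * cyc k x j) i = cyc n (patF x) i.
Proof.
  intros Hx Hi. unfold patP. set (z := fun j => th * cyc k x j).
  assert (Hs : mixp th k z = 1).
  { unfold mixp, z. rewrite supn_scal, cyc_supn, Hx, Rabs_pos_eq by lra. apply clamp_hi. split; [lra|].
    rewrite Rmult_1_r, Rinv_l by lra. lra. }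
  rewrite Hs. unfold cyc_mix.
  match goal with |- (1 - 1) * ?A + 1 * ?B = _ => transitivity B; [ring|] end.
  apply cyc_ext; [|easy]. intros j Hj. apply patF_ext; [|easy]. intros l Hl. unfold cyc_inv_mix.
  rewrite <- (cyc_inv_cyc k x l Hl) at 1. unfold z. destruct l as [|l]; simpl; field; lra.
Qed.

Lemma patH_ps d1 i : 0 < d1 -> (i < S n)%nat -> PS (S k) (fun z => patH d1 z i).
Proof.
  intros Hd Hi. apply ps_mul; [|now apply patP_ps].
  apply (ps_inv _ _ d1); [easy|intros; apply Rmax_r|]. apply ps_max; [apply supn_patP_ps|apply ps_const].
Qed.

Lemma patH_of_unit d1 z i : 0 < d1 <= 1 -> supn (S n) (patP z) = 1 -> patH d1 z i = patP z i.
Proof. intros Hd H. unfold patH. rewrite H, Rmax_left by lra. field. Qed.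

Lemma patH_bd d1 z i : 0 < d1 <= 1 -> supn (S k) z = 1 -> (i < S n)%nat -> patH d1 z i = patF z i.
Proof.
  intros Hd Hz Hi. rewrite patH_of_unit; [now apply patP_bd|easy|].
  rewrite (supn_ext _ _ (patF z)) by (intros; now apply patP_bd). now apply patF_bd.
Qed.

Lemma patH_hole d1 x i : 0 < d1 <= 1 -> supn (S k) x = 1 -> (i < S n)%nat ->
  patH d1 (fun j => th * cyc k x j) i = cyc n (patF x) i.
Proof.
  intros Hd Hz Hi. rewrite patH_of_unit; [now apply patP_hole|easy|].
  rewrite (supn_ext _ _ (cyc n (patF x))) by (intros; now apply patP_hole). rewrite cyc_supn. now apply patF_bd.
Qed.

Lemma patG_ps d1 i : 0 < d1 -> (i < S n)%nat -> PS (S k) (fun z => patG d1 z i).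
Proof.
  intros Hd Hi.
  assert (HH : forall b j, (j < S n)%nat -> PS (S k) (fun z => patH d1 (patz b z) j)).
  { intros b j Hj. apply (ps_subst (S k) (S k) (fun z => patH d1 z j)); [now apply patH_ps|].
    intros l Hl. unfold patz. destruct (Nat.eqb l k); [|now apply ps_coord].
    apply ps_clamp, ps_sub; [apply ps_scal, ps_coord; lia|apply ps_const]. }
  unfold patG. destruct (Nat.eqb_spec i n) as [->|Hne].
  - apply ps_scal, ps_add; apply HH; lia.
  - apply ps_sub; [apply ps_add; now apply HH|]. apply (ps_weaken k); [lia|apply Hgps; lia].
Qed.

Lemma patH_ext d1 x y i : 0 < d1 -> (i < S n)%nat -> (forall j, (j < S k)%nat -> x j = y j) -> patH d1 x i = patH d1 y i.
Proof. intros Hd Hi H. apply (ps_dep (S k) (fun z => patH d1 z i)); [now apply patH_ps|easy]. Qed.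

Lemma g_ext x y i : (i < n)%nat -> (forall j, (j < k)%nat -> x j = y j) -> g x i = g y i.
Proof. intros Hi H. apply (ps_dep k (fun z => g z i)); [now apply Hgps|easy]. Qed.

Lemma patz_last b z : patz b z k = clamp (-1) 1 (2 * z k - b).
Proof. unfold patz. now rewrite Nat.eqb_refl. Qed.

Lemma patz_lt b z i : (i < k)%nat -> patz b z i = z i.
Proof. intros H. unfold patz. now rewrite (eqb_ne i k) by lia. Qed.

Lemma patz_far d1 b z i : 0 < d1 <= 1 -> pm b -> supn (S k) z <= 1 -> 0 <= b * z k -> (i < S n)%nat ->
  patH d1 (patz (- b) z) i = if Nat.eqb i n then b else g z i.
Proof.
  intros Hd Hb Hz Hbz Hi.
  assert (Hl : patz (- b) z k = b).
  { rewrite patz_last. destruct Hb as [-> | ->]; [apply clamp_hi|apply clamp_lo]; lra. }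
  assert (H1 : supn (S k) (patz (- b) z) = 1).
  { apply Rle_antisym.
    - apply supn_le; [lra|]. intros j Hj. destruct (Nat.eq_dec j k) as [->|Hne].
      + rewrite Hl. destruct Hb as [-> | ->]; [rewrite Rabs_R1|rewrite Rabs_left]; lra.
      + rewrite patz_lt by lia. eapply Rle_trans; [apply (supn_ge (S k) z j Hj)|easy].
    - eapply Rle_trans; [|apply (supn_ge (S k) _ k); lia]. rewrite Hl.
      destruct Hb as [-> | ->]; [rewrite Rabs_R1|rewrite Rabs_left]; lra. }
  rewrite patH_bd by easy. unfold patF. destruct (Nat.eqb_spec i n); [easy|].
  apply g_ext; [lia|]. intros; now apply patz_lt.
Qed.

Lemma unhalf_patz b z : pm b -> supn (S k) z <= 1 -> 0 <= b * z k ->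
  forall i, patz b z i = unhalf_last k b z i.
Proof.
  intros Hb Hz Hbz i. unfold patz, unhalf_last. destruct (Nat.eqb_spec i k); [|easy].
  assert (H : Rabs (z k) <= 1) by (eapply Rle_trans; [apply (supn_ge (S k) z k); lia|easy]).
  apply Rabs_le_between in H. apply clamp_id. destruct Hb as [-> | ->]; lra.
Qed.

(** The term of the other half contributes [b] to the last coordinate, where the factor 1/2 turns
    the sum into [half_last], and [g z] to the others, where it is subtracted. *)
Lemma patG_loc d1 b z i : 0 < d1 <= 1 -> pm b -> supn (S k) z <= 1 -> 0 <= b * z k -> (i < S n)%nat ->
  patG d1 z i = half_last n b (patH d1 (unhalf_last k b z)) i.
Proof.
  intros Hd Hb Hz Hbz Hi.
  assert (HE : forall j, (j < S n)%nat -> patH d1 (patz b z) j = patH d1 (unhalf_last k b z) j).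
  { intros j Hj. apply patH_ext; [lra|easy|]. intros; now apply unhalf_patz. }
  assert (HF := fun j => patz_far d1 b z j Hd Hb Hz Hbz).
  unfold patG, half_last. destruct Hb as [-> | ->].
  - replace (- (1)) with (-1) in HF by ring.
    destruct (Nat.eqb_spec i n) as [->|Hne].
    + rewrite HE, HF, Nat.eqb_refl by lia. field.
    + rewrite HE, HF by lia. rewrite (eqb_ne i n) by lia. ring.
  - replace (- -1) with 1 in HF by ring.
    destruct (Nat.eqb_spec i n) as [->|Hne].
    + rewrite HE, HF, Nat.eqb_refl by lia. field.
    + rewrite HE, HF by lia. rewrite (eqb_ne i n) by lia. ring.
Qed.

Lemma choose_side z : exists b, pm b /\ 0 <= b * z k.
Proof.
  destruct (Rle_dec 0 (z k)); [exists 1; split; [apply pm_1|lra]|exists (-1); split; [apply pm_m1|lra]].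
Qed.

Lemma unhalf_le b z : pm b -> supn (S k) z <= 1 -> 0 <= b * z k -> supn (S k) (unhalf_last k b z) <= 1.
Proof.
  intros Hb Hz Hbz. apply supn_le; [lra|]. intros i Hi. rewrite <- unhalf_patz by easy.
  unfold patz. destruct (Nat.eqb i k).
  - apply Rabs_le, clamp_range. lra.
  - eapply Rle_trans; [apply (supn_ge (S k) z i Hi)|easy].
Qed.

Lemma pattern_ifs : exists G, ifs_ok k n th patF G.
Proof.
  destruct (ps_pos_lower_bound (S k) (fun z => supn (S n) (patP z)) (fun z => supn (S k) z - th) 1)
    as [d [Hd Hlow]]; [lra|apply supn_patP_ps| | |].
  { apply ps_sub; [|apply ps_const]. apply (ps_supn (S k) (S k) (fun z => z)). intros; now apply ps_coord. }
  { intros z Hz Hz'. apply patP_pos. lra. }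
  set (d1 := Rmin d 1).
  assert (Hd1 : 0 < d1 <= 1) by (split; [apply Rmin_pos; lra|apply Rmin_r]).
  (* On the shell [d1] is below |P|, so the guard is inactive and H has sup norm exactly 1. *)
  assert (HH : forall z, th <= supn (S k) z <= 1 -> supn (S n) (patH d1 z) = 1).
  { intros z Hz. assert (Hz' : d1 <= supn (S n) (patP z)).
    { eapply Rle_trans; [apply Rmin_l|]. apply Hlow; lra. }
    unfold patH. rewrite supn_scal, Rmax_left, Rabs_pos_eq by (try (left; apply Rinv_0_lt_compat); lra).
    apply Rinv_l. lra. }
  exists (patG d1). constructor.
  - easy.
  - apply patF_ps.
  - intros i Hi. apply patG_ps; [lra|easy].
  - intros z Hz i Hi. destruct (choose_side z) as [b [Hb Hbz]].
    rewrite (patG_loc d1 b) by (easy || lra).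
    assert (Hu : supn (S k) (unhalf_last k b z) = 1).
    { apply Rle_antisym; [apply unhalf_le; auto; lra|].
      destruct (supn_attained (S k) z) as [j [Hj Hzj]]; [lia|]. rewrite Hz in Hzj.
      rewrite <- Hzj. destruct (Nat.eq_dec j k) as [->|Hne].
      - eapply Rle_trans; [|apply (supn_ge _ _ k); lia]. unfold unhalf_last. rewrite Nat.eqb_refl.
        destruct Hb as [-> | ->].
        + rewrite (Rabs_pos_eq (z k)) in * by lra. rewrite Rabs_pos_eq; lra.
        + rewrite (Rabs_left1 (z k)) in * by lra. rewrite Rabs_left1; lra.
      - eapply Rle_trans; [|apply (supn_ge _ _ j); lia]. unfold unhalf_last.
        rewrite (eqb_ne j k) by lia. lra. }
    unfold half_last. destruct (Nat.eqb_spec i n) as [->|Hne].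
    + rewrite patH_bd, !patF_last by (easy || lia). unfold unhalf_last. rewrite Nat.eqb_refl. field.
    + rewrite patH_bd, !patF_lt by (easy || lia). apply g_ext; [lia|]. intros j Hj. unfold unhalf_last.
      now rewrite (eqb_ne j k) by lia.
  - intros z b Hb Hz i Hi.
    assert (Hle := hmap_le k th b z Ht Hb ltac:(lra)).
    assert (Hz0 : Rabs (sgn k * z O) <= 1).
    { rewrite Rabs_mult, sgn_abs, Rmult_1_l, <- Hz. apply supn_ge; lia. }
    apply Rabs_le_between in Hz0.
    rewrite (patG_loc d1 b); [|easy|easy|lra| |easy].
    2:{ rewrite hmap_last. destruct Hb as [-> | ->]; nra. }
    assert (HE : forall j, (j < S n)%nat -> patH d1 (unhalf_last k b (hmap k th b z)) j = cyc n (patF z) j).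
    { intros j Hj. rewrite <- (patH_hole d1) by easy. apply patH_ext; [lra|easy|]. intros l Hl.
      unfold unhalf_last. destruct (Nat.eqb_spec l k) as [->|Hne].
      - rewrite hmap_last, cyc_last. field.
      - rewrite hmap_lt, cyc_lt by lia. easy. }
    unfold wmap, half_last. destruct (Nat.eqb_spec i n); rewrite HE by lia; easy.
  - apply patF_le.
  - intros z Hz Hoff. destruct (choose_side z) as [b [Hb Hbz]].
    (* Being outside the hole means being in the shell once the half is stretched back to the
       cube. *)
    assert (Hu : th <= supn (S k) (unhalf_last k b z) <= 1).
    { split; [|now apply unhalf_le]. specialize (Hoff b Hb). unfold hinv in Hoff.
      rewrite cyc_inv_supn, supn_scal, Rabs_pos_eq in Hoff by (left; apply Rinv_0_lt_compat; lra).
      apply (Rmult_le_compat_l th) in Hoff; [|lra]. rewrite <- Rmult_assoc, Rinv_r in Hoff by lra. lra. }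
    specialize (HH _ Hu). set (h := patH d1 (unhalf_last k b z)) in *.
    assert (Hg : forall i, (i < S n)%nat -> patG d1 z i = half_last n b h i) by (intros; now apply patG_loc).
    assert (Hh : forall i, (i < S n)%nat -> Rabs (h i) <= 1) by (intros; rewrite <- HH; now apply supn_ge).
    split.
    + apply supn_le; [lra|]. intros i Hi. rewrite Hg by easy. unfold half_last.
      destruct (Nat.eqb i n); [|now apply Hh]. specialize (Hh n ltac:(lia)). apply Rabs_le_between in Hh.
      apply Rabs_le. destruct Hb as [-> | ->]; lra.
    + destruct (supn_attained (S n) h) as [i [Hi Hhi]]; [lia|]. exists i. split; [easy|].
      rewrite Hg by easy. rewrite HH in Hhi. unfold half_last.
      assert (Hpm : h i = 1 \/ h i = -1).
      { destruct (Rle_dec 0 (h i)); [rewrite Rabs_pos_eq in Hhi by easy|rewrite Rabs_left in Hhi by lra]; lra. }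
      (* A last coordinate 1 or -1 becomes [b] or 0 under halving: 0 is the common face of the two
         halves of the target. *)
      destruct (Nat.eqb_spec i n) as [->|Hne].
      * destruct Hb as [-> | ->], Hpm as [-> | ->].
        -- right; right; left; lra.
        -- right; left; lra.
        -- right; left; lra.
        -- left; lra.
      * destruct Hpm as [-> | ->]; [right; right; left; lra|left; lra].
Qed.

End pattern.

(** * General position of two fibers *)

(** Oblique projection along (s,1) to the hyperplane where the last coordinate is 0. It vanishes
    exactly on the line of (s,1), which meets the sphere in two opposite points. *)
Definition obl (m : nat) (s x : vec) : vec := fun i => x i - x m * s i.

Lemma obl_sdist m s x y : (forall i, (i < m)%nat -> Rabs (s i) <= 1) ->
  sdist m (obl m s x) (obl m s y) <= 2 * sdist (S m) x y.
Proof.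
  intros Hs. pose proof (sdist_nonneg (S m) x y). apply sdist_le; [lra|]. intros i Hi. unfold obl.
  replace (x i - x m * s i - (y i - y m * s i)) with ((x i - y i) + - ((x m - y m) * s i)) by ring.
  eapply Rle_trans; [apply Rabs_triang|]. rewrite Rabs_Ropp, Rabs_mult.
  pose proof (sdist_ge (S m) x y i ltac:(lia)). pose proof (sdist_ge (S m) x y m ltac:(lia)).
  specialize (Hs i Hi). pose proof (Rabs_pos (x m - y m)). pose proof (Rabs_pos (s i)). nra.
Qed.

Lemma obl_last m s x d eta : (forall i, (i < m)%nat -> Rabs (s i) <= 1) -> d <= supn (S m) x -> eta < d / 2 ->
  0 < d -> supn m (obl m s x) <= eta -> d / 2 <= Rabs (x m).
Proof.
  intros Hs Hx He Hd Ho. destruct (Rle_dec (d / 2) (Rabs (x m))) as [h|h]; [easy|exfalso].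
  apply (Rle_not_lt _ _ Hx). apply supn_lt; [lra|]. intros i Hi.
  destruct (Nat.eq_dec i m) as [->|Hne]; [lra|].
  pose proof (supn_ge m (obl m s x) i ltac:(lia)) as H.
  change (Rabs (x i - x m * s i) <= supn m (obl m s x)) in H.
  specialize (Hs i ltac:(lia)).
  replace (x i) with ((x i - x m * s i) + x m * s i) by ring.
  eapply Rle_lt_trans; [apply Rabs_triang|]. rewrite Rabs_mult.
  pose proof (Rmult_le_compat_l (Rabs (x m)) _ _ (Rabs_pos _) Hs). lra.
Qed.

Lemma obl_unique m s s' x d eta : (forall i, (i < m)%nat -> Rabs (s i) <= 1) -> d <= supn (S m) x -> eta < d / 2 ->
  0 < d -> supn m (obl m s x) <= eta -> supn m (obl m s' x) <= eta ->
  forall i, (i < m)%nat -> Rabs (s i - s' i) <= 4 * eta / d.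
Proof.
  intros Hs Hx He Hd Ho Ho' i Hi. pose proof (obl_last m s x d eta Hs Hx He Hd Ho) as Hm.
  pose proof (supn_ge m (obl m s x) i Hi) as H1. pose proof (supn_ge m (obl m s' x) i Hi) as H2.
  assert (H3 : Rabs (x m) * Rabs (s i - s' i) <= 2 * eta).
  { rewrite <- Rabs_mult. replace (x m * (s i - s' i)) with (obl m s' x i - obl m s x i) by (unfold obl; ring).
    replace (obl m s' x i - obl m s x i) with (obl m s' x i + - obl m s x i) by ring.
    eapply Rle_trans; [apply Rabs_triang|]. rewrite Rabs_Ropp. lra. }
  pose proof (Rabs_pos (s i - s' i)). apply (Rmult_le_reg_r (d / 2)); [lra|].
  replace (4 * eta / d * (d / 2)) with (2 * eta) by (field; lra).
  apply Rle_trans with (Rabs (x m) * Rabs (s i - s' i)); [|easy].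
  rewrite (Rmult_comm (Rabs (x m))). now apply Rmult_le_compat_l.
Qed.

(** * Counting cells and directions *)

Definition decb (P : Prop) : bool := if excluded_middle_informative P then true else false.

Lemma decb_true P : decb P = true <-> P.
Proof. unfold decb. destruct (excluded_middle_informative P); split; easy. Qed.

Lemma filter_length_split {A} (f : A -> bool) l :
  (length (filter f l) + length (filter (fun a => negb (f a)) l))%nat = length l.
Proof. induction l as [|a l IH]; simpl; [easy|]. destruct (f a); simpl; lia. Qed.

Lemma filter_filter_negb {A} (f g : A -> bool) l : (forall a, In a l -> g a = true -> f a = false) ->
  filter g (filter (fun a => negb (f a)) l) = filter g l.
Proof.
  induction l as [|a l IH]; intros H; simpl; [easy|].
  assert (IH' := IH (fun b Hb => H b (or_intror Hb))).
  destruct (f a) eqn:E; simpl.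
  - rewrite IH'. destruct (g a) eqn:E'; [|easy]. rewrite H in E; easy || now left.
  - destruct (g a); now rewrite IH'.
Qed.

Lemma sum_filter_le {A B} (R : B -> A -> Prop) lb : NoDup lb -> forall la,
  (forall a b b', In a la -> In b lb -> In b' lb -> R b a -> R b' a -> b = b') ->
  (list_sum (map (fun b => length (filter (fun a => decb (R b a)) la)) lb) <= length la)%nat.
Proof.
  induction lb as [|b lb IH]; intros Hnd la H; simpl; [lia|].
  inversion_clear Hnd as [|? ? Hb Hnd'].
  pose proof (filter_length_split (fun a => decb (R b a)) la) as E0.
  enough (list_sum (map (fun b => length (filter (fun a => decb (R b a)) la)) lb) <=
    length (filter (fun a => negb (decb (R b a))) la))%nat by lia.
  eapply Nat.le_trans; [|apply (IH Hnd' (filter (fun a => negb (decb (R b a))) la))].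
  - apply Nat.eq_le_incl. f_equal. apply map_ext_in. intros b' Hb'. f_equal. symmetry. apply filter_filter_negb.
    intros a Ha E. apply (proj1 (decb_true _)) in E. destruct (decb (R b a)) eqn:E'; [|easy]. apply (proj1 (decb_true _)) in E'.
    destruct Hb. assert (b = b') as -> by (apply (H a); [easy|now left|now right|easy|easy]). easy.
  - intros a0 b1 b2 Ha H1 H2. apply H; [|now right|now right]. now apply filter_In in Ha.
Qed.

Lemma list_sum_lower {B} (f : B -> nat) lb c : (forall b, In b lb -> (c <= f b)%nat) ->
  (c * length lb <= list_sum (map f lb))%nat.
Proof.
  induction lb as [|b lb IH]; intros H; simpl; [lia|].
  specialize (IH (fun b' h => H b' (or_intror h))). specialize (H b (or_introl eq_refl)). nia.
Qed.

(** Each element of [la] is related to at most one element of [lb], so the related subsets are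
    disjoint and one of them is no larger than the average. *)
Lemma pigeonhole {A B} (R : B -> A -> Prop) la lb : NoDup lb -> lb <> nil ->
  (forall a b b', In a la -> In b lb -> In b' lb -> R b a -> R b' a -> b = b') ->
  exists b l, In b lb /\ (forall a, In a l <-> In a la /\ R b a) /\ (length l * length lb <= length la)%nat.
Proof.
  intros Hnd Hne H. pose proof (sum_filter_le R lb Hnd la H) as Hs.
  set (f := fun b => length (filter (fun a => decb (R b a)) la)) in *.
  assert (HL : (0 < length lb)%nat) by (destruct lb; [easy|simpl; lia]).
  assert (Hex : exists b, In b lb /\ (f b * length lb <= length la)%nat).
  { apply NNPP. intros Hno.
    assert (Hb : forall b, In b lb -> (S (length la) <= f b * length lb)%nat).
    { intros b Hb. destruct (le_lt_dec (f b * length lb) (length la)); [|lia]. destruct Hno. now exists b. }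
    pose proof (list_sum_lower (fun b => f b * length lb)%nat lb (S (length la)) Hb) as H1.
    assert (E : list_sum (map (fun b => f b * length lb)%nat lb) = (list_sum (map f lb) * length lb)%nat).
    { generalize (length lb). clear. intros c. induction lb; simpl; [easy|]. rewrite IHlb. lia. }
    rewrite E in H1. nia. }
  destruct Hex as [b [Hb Hfb]]. exists b, (filter (fun a => decb (R b a)) la). split; [easy|]. split; [|easy].
  intros a. rewrite filter_In, decb_true. easy.
Qed.

(** A cell of S^k: a coordinate of absolute value at least 1/(k+1), its sign, and a grid cell for
    the remaining k coordinates. This makes the count O(N^k), where a grid of the ambient space
    would give N^(k+1). *)
Definition scode (k N : nat) (t : nat * (bool * nat)) (v : vec) : Prop :=
  let '(i, (b, c)) := t in
  sphere k v /\ (i < S k)%nat /\ / INR (S k) <= (if b then v i else - v i) /\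
  forall j, (j < k)%nat -> Rabs (v (skip i j) - gridpt N c j) <= / INR N.

Definition scodes (k N : nat) : list (nat * (bool * nat)) :=
  list_prod (seq 0 (S k)) (list_prod (true :: false :: nil) (seq 0 (N ^ k))).

Lemma scodes_length k N : length (scodes k N) = (S k * (2 * N ^ k))%nat.
Proof. unfold scodes. rewrite !length_prod, !length_seq. simpl length. lia. Qed.

Lemma sphere_le k v i : sphere k v -> (i < S k)%nat -> Rabs (v i) <= 1.
Proof. intros H Hi. rewrite <- H. now apply norm_ge. Qed.

Lemma sphere_supn k v : sphere k v -> / INR (S k) <= supn (S k) v <= 1.
Proof.
  intros H. assert (Hk : 0 < INR (S k)) by (apply lt_0_INR; lia). split.
  - pose proof (norm_le_supn (S k) v) as Hn. unfold sphere in H. rewrite H in Hn.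
    apply (Rmult_le_reg_l (INR (S k))); [easy|]. rewrite Rinv_r by lra. easy.
  - apply supn_le; [lra|]. intros; now apply sphere_le with k.
Qed.

Lemma scode_ex k N v : (0 < N)%nat -> sphere k v -> exists t, In t (scodes k N) /\ scode k N t v.
Proof.
  intros HN Hv. destruct (supn_attained (S k) v) as [i [Hi Hvi]]; [lia|].
  pose proof (proj1 (sphere_supn k v Hv)) as Hs. rewrite <- Hvi in Hs.
  destruct (grid_cover k N (fun j => v (skip i j)) HN) as [c [Hc Hg]].
  { apply supn_le; [lra|]. intros j Hj. apply sphere_le with k; [easy|]. unfold skip. destruct (Nat.ltb_spec j i); lia. }
  exists (i, (if Rle_dec 0 (v i) then true else false, c)). split.
  - apply in_prod; [apply in_seq; lia|]. apply in_prod; [destruct (Rle_dec 0 (v i)); simpl; auto|apply in_seq; lia].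
  - repeat split; auto. destruct (Rle_dec 0 (v i)).
    + now rewrite Rabs_pos_eq in Hs.
    + now rewrite Rabs_left in Hs by lra.
Qed.

Lemma skip_surj i l k : (l < S k)%nat -> (i < S k)%nat -> l <> i -> exists j, (j < k)%nat /\ skip i j = l.
Proof.
  intros Hl Hi Hne. unfold skip. destruct (le_lt_dec i l) as [h|h].
  - exists (l - 1)%nat. destruct (Nat.ltb_spec (l - 1) i); lia.
  - exists l. destruct (Nat.ltb_spec l i); lia.
Qed.

Definition scC (k : nat) : R := 2 * INR (S k) * INR (S k).

(** The large coordinate is determined by the others through the equation of the sphere; with its
    sign fixed and its size bounded below, a bound on the difference of squares bounds the
    difference. *)
Lemma scode_close k N t u v : (0 < N)%nat -> scode k N t u -> scode k N t v -> sdist (S k) u v <= scC k * / INR N.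
Proof.
  destruct t as [i [b c]]. intros HN [Hu [Hi [Hbu Hgu]]] [Hv [_ [Hbv Hgv]]].
  assert (Hk : 1 <= INR (S k)) by (rewrite S_INR; pose proof (pos_INR k); lra).
  assert (HNi : 0 < / INR N) by (apply Rinv_0_lt_compat, lt_0_INR; lia).
  assert (Hj : forall j, (j < k)%nat -> Rabs (u (skip i j) - v (skip i j)) <= 2 * / INR N).
  { intros j Hj. specialize (Hgu j Hj). specialize (Hgv j Hj).
    pose proof (abs_tri3 (u (skip i j)) (v (skip i j)) (gridpt N c j)). lra. }
  unfold scC. apply sdist_le; [repeat apply Rmult_le_pos; lra|]. intros l Hl.
  destruct (Nat.eq_dec l i) as [->|Hne].
  - apply norm_1_sq in Hu, Hv. unfold sq in Hu, Hv. rewrite (vsum_skip i) in Hu, Hv by lia.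
    assert (E : Rabs (u i ^ 2 - v i ^ 2) <= INR k * (4 * / INR N)).
    { replace (u i ^ 2 - v i ^ 2) with (vsum k (fun j => v (skip i j) ^ 2 + (-1) * u (skip i j) ^ 2)).
      - apply vsum_abs_le. intros j Hjk. specialize (Hj j Hjk).
        assert (Hsk : (skip i j < S k)%nat) by (unfold skip; destruct (Nat.ltb_spec j i); lia).
        assert (Hu1 : sphere k u) by (apply norm_1_sq; unfold sq; rewrite (vsum_skip i) by lia; easy).
        assert (Hv1 : sphere k v) by (apply norm_1_sq; unfold sq; rewrite (vsum_skip i) by lia; easy).
        replace (v (skip i j) ^ 2 + -1 * u (skip i j) ^ 2)
          with (- ((u (skip i j) - v (skip i j)) * (u (skip i j) + v (skip i j)))) by ring.
        rewrite Rabs_Ropp, Rabs_mult.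
        assert (Rabs (u (skip i j) + v (skip i j)) <= 2).
        { eapply Rle_trans; [apply Rabs_triang|].
          pose proof (sphere_le k u _ Hu1 Hsk). pose proof (sphere_le k v _ Hv1 Hsk). lra. }
        pose proof (Rabs_pos (u (skip i j) - v (skip i j))). pose proof (Rabs_pos (u (skip i j) + v (skip i j))). nra.
      - rewrite vsum_plus, vsum_scal. lra. }
    replace (u i ^ 2 - v i ^ 2) with ((u i + v i) * (u i - v i)) in E by ring. rewrite Rabs_mult in E.
    assert (Hs : 2 * / INR (S k) <= Rabs (u i + v i)).
    { destruct b; cbv iota in Hbu, Hbv; [rewrite Rabs_pos_eq|rewrite Rabs_left1]; pose proof (Rinv_0_lt_compat (INR (S k)) ltac:(lra)); lra. }
    assert (H : 2 * / INR (S k) * Rabs (u i - v i) <= INR k * (4 * / INR N)).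
    { eapply Rle_trans; [|exact E]. apply Rmult_le_compat_r; [apply Rabs_pos|easy]. }
    apply (Rmult_le_compat_l (INR (S k) * / 2)) in H; [|lra].
    replace (INR (S k) * / 2 * (2 * / INR (S k) * Rabs (u i - v i))) with (Rabs (u i - v i)) in H by (field; lra).
    eapply Rle_trans; [exact H|].
    assert (INR k <= INR (S k)) by (apply le_INR; lia).
    assert (0 < INR N) by (apply lt_0_INR; lia).
    replace (INR (S k) * / 2 * (INR k * (4 * / INR N))) with (2 * INR (S k) * / INR N * INR k) by (field; lra).
    replace (2 * INR (S k) * INR (S k) * / INR N) with (2 * INR (S k) * / INR N * INR (S k)) by ring.
    apply Rmult_le_compat_l; [|easy]. apply Rmult_le_pos; lra.
  - destruct (skip_surj i l k Hl Hi Hne) as [j [Hjk <-]]. eapply Rle_trans; [now apply Hj|].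
    apply Rmult_le_compat_r; [lra|]. nra.
Qed.

(** Candidate slopes: q^m points spaced by 1/q. *)
Definition svec (q b : nat) : vec := fun i => INR (dig q b i) / INR q.

Lemma svec_le q b i : (0 < q)%nat -> Rabs (svec q b i) <= 1.
Proof.
  intros Hq. assert (0 < INR q) by (apply lt_0_INR; lia). unfold svec.
  rewrite Rabs_pos_eq by (apply Rdiv_le_0_compat; [apply pos_INR|easy]).
  apply (Rmult_le_reg_r (INR q)); [easy|]. unfold Rdiv. rewrite Rmult_assoc, Rinv_l by lra.
  rewrite Rmult_1_r, Rmult_1_l. apply le_INR. pose proof (dig_lt q b i Hq). lia.
Qed.

Lemma svec_inj q m b b' : (0 < q)%nat -> (b < q ^ m)%nat -> (b' < q ^ m)%nat ->
  (forall i, (i < m)%nat -> Rabs (svec q b i - svec q b' i) < / INR q) -> b = b'.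
Proof.
  intros Hq Hb Hb' H. apply (dig_inj q m); auto. intros i Hi. specialize (H i Hi).
  assert (Hq' : 0 < INR q) by (apply lt_0_INR; lia). unfold svec in H.
  replace (INR (dig q b i) / INR q - INR (dig q b' i) / INR q) with ((INR (dig q b i) - INR (dig q b' i)) * / INR q) in H by (field; lra).
  rewrite Rabs_mult, (Rabs_pos_eq (/ INR q)) in H by (left; now apply Rinv_0_lt_compat).
  assert (H1 : Rabs (INR (dig q b i) - INR (dig q b' i)) < 1).
  { apply (Rmult_lt_reg_r (/ INR q)); [now apply Rinv_0_lt_compat|lra]. }
  destruct (Nat.lt_trichotomy (dig q b i) (dig q b' i)) as [h|[h|h]]; [|easy|].
  - exfalso. apply le_INR in h. rewrite S_INR in h. rewrite Rabs_left in H1; lra.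
  - exfalso. apply le_INR in h. rewrite S_INR in h. rewrite Rabs_pos_eq in H1; lra.
Qed.

Lemma sq_combination m u v c : sq m (fun i => u i - c * v i) =
  (1 - c) * sq m u + (c ^ 2 - c) * sq m v + c * sq m (vsub u v).
Proof.
  unfold sq. rewrite <- !vsum_scal, <- !vsum_plus. apply vsum_ext. intros i _. unfold vsub. ring.
Qed.

(** For unit vectors |u - c v|^2 = (1-c)^2 + c |u-v|^2; the first term suffices for c <= 1/4, the
    second for larger c. *)
Lemma unit_combination_lower k u v c d : sphere k u -> sphere k v -> 0 <= c <= 1 -> 0 < d <= 1 ->
  d <= sdist (S k) u v -> d / (2 * INR (S k)) <= supn (S k) (fun i => u i - c * v i).
Proof.
  intros Hu Hv Hc Hd Huv. apply norm_1_sq in Hu, Hv.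
  assert (Hk : 1 <= INR (S k)) by (rewrite S_INR; pose proof (pos_INR k); lra).
  assert (HD : d ^ 2 <= sq (S k) (vsub u v)).
  { eapply Rle_trans; [|apply sq_supn]. apply pow_incr. split; [lra|easy]. }
  pose proof (sq_combination (S k) u v c) as E. rewrite Hu, Hv in E.
  assert (H1 : d ^ 2 / 4 <= sq (S k) (fun i => u i - c * v i)).
  { rewrite E. destruct (Rle_dec c (/ 4)); nra. }
  set (x := fun i => u i - c * v i) in *.
  pose proof (sq_le (S k) x (supn (S k) x) (fun i Hi => supn_ge (S k) x i Hi)) as H2.
  pose proof (supn_nonneg (S k) x) as H3.
  destruct (Rle_dec (d / (2 * INR (S k))) (supn (S k) x)) as [h|h]; [easy|exfalso].
  apply Rnot_le_lt in h.
  assert (H4 : supn (S k) x ^ 2 < (d / (2 * INR (S k))) ^ 2) by nra.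
  apply (Rmult_lt_compat_l (INR (S k))) in H4; [|lra].
  replace (INR (S k) * (d / (2 * INR (S k))) ^ 2) with (d ^ 2 / 4 * / INR (S k)) in H4 by (field; lra).
  assert (/ INR (S k) <= 1) by (rewrite <- Rinv_1; apply Rinv_le_contravar; lra).
  assert (0 <= d ^ 2 / 4) by nra. nra.
Qed.

Lemma nat_grid_ex N c : (0 < N)%nat -> 0 <= c <= 1 -> exists j, (j < S N)%nat /\ Rabs (c - INR j / INR N) <= / INR N.
Proof.
  intros HN Hc. assert (HNR : 0 < INR N) by (apply lt_0_INR; lia).
  destruct (unit_cell_ex N (c * INR N) HN) as [j [Hj H]]; [nra|]. exists j. split; [lia|].
  replace (c - INR j / INR N) with ((c * INR N - INR j) * / INR N) by (field; lra).
  assert (0 < / INR N) by now apply Rinv_0_lt_compat.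
  rewrite Rabs_mult, Rabs_pos_eq, Rabs_pos_eq by lra. nra.
Qed.

(** Thickened preimage of the two opposite points of S^n on the line of (s,1); the sign of the last
    coordinate of [beta v] tells them apart. *)
Definition fiber (n k : nat) (beta : vec -> vec) (s : vec) (e : R) (v : vec) : Prop :=
  sphere k v /\ supn n (obl n s (beta v)) <= e.

(** The image of a cell of mesh 1/(A q) is small compared with the spacing 1/q of the slopes, so
    each cell is near at most one of the q^n candidate lines, and some line receives at most the
    fraction q^-n of the cells. *)
Lemma thin_fiber n k beta L A : (0 < A)%nat -> 0 <= L ->
  (forall x, sphere k x -> sphere n (beta x)) ->
  (forall x y, sphere k x -> sphere k y -> sdist (S n) (beta x) (beta y) <= L * sdist (S k) x y) ->
  4 * INR (S n) * (1 + 2 * L * scC k) < INR A ->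
  forall q, (0 < q)%nat -> exists (s : vec) (W : list vec), (forall i, Rabs (s i) <= 1) /\
    (forall u, In u W -> sphere k u) /\
    (forall v, fiber n k beta s (/ INR (A * q)) v -> exists u, In u W /\ sdist (S k) u v <= scC k * / INR (A * q)) /\
    (length W * q ^ n <= S k * (2 * (A * q) ^ k))%nat.
Proof.
  intros HA HL Hmap Hlip HAbig q Hq. set (N := (A * q)%nat).
  assert (HN : (0 < N)%nat) by (unfold N; lia).
  assert (HNR : 0 < / INR N) by (apply Rinv_0_lt_compat, lt_0_INR; lia).
  assert (HqR : 0 < INR q) by (apply lt_0_INR; lia).
  assert (Hn1 : 1 <= INR (S n)) by (rewrite S_INR; pose proof (pos_INR n); lra).
  assert (HC : 0 <= scC k) by (unfold scC; repeat apply Rmult_le_pos; try apply pos_INR; lra).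
  set (rep := fun t => epsilon (inhabits (fun _ => 0)) (scode k N t)).
  assert (Hrep : forall t v, scode k N t v -> scode k N t (rep t)) by (intros t v Hv; apply epsilon_spec; now exists v).
  (* 1/N is the thickness of the fibre; the other part is the variation of [obl] of [beta] across
     one cell. *)
  set (eta := (1 + 2 * L * scC k) * / INR N).
  assert (Heta : 4 * INR (S n) * eta < / INR q).
  { unfold eta. rewrite <- Rmult_assoc. apply (Rmult_lt_reg_r (INR N)); [now apply lt_0_INR|].
    rewrite Rmult_assoc, Rinv_l by (apply not_0_INR; lia). rewrite Rmult_1_r.
    unfold N. rewrite mult_INR. replace (/ INR q * (INR A * INR q)) with (INR A) by (field; lra). easy. }
  set (R0 := fun b t => (exists v, scode k N t v) /\ supn n (obl n (svec q b) (beta (rep t))) <= eta).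
  assert (Hq1 : / INR q <= 1).
  { rewrite <- Rinv_1. apply Rinv_le_contravar; [lra|]. apply (le_INR 1); lia. }
  assert (HlinkS : forall t, (exists v, scode k N t v) -> sphere k (rep t)).
  { intros t [v Hv]. apply Hrep in Hv. destruct t as [i [b c]]. apply Hv. }
  assert (Hdn : 0 < / INR (S n)) by (apply Rinv_0_lt_compat; lra).
  assert (Heta2 : eta < / INR (S n) / 2 /\ 4 * eta / (/ INR (S n)) < / INR q).
  { replace (4 * eta / (/ INR (S n))) with (4 * INR (S n) * eta) by (field; lra). split; [|easy].
    apply (Rmult_lt_reg_l (4 * INR (S n))); [lra|].
    replace (4 * INR (S n) * (/ INR (S n) / 2)) with 2 by (field; lra). lra. }
  destruct (pigeonhole R0 (scodes k N) (seq 0 (q ^ n))) as [b [l [Hb [Hl Hlen]]]].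
  - apply seq_NoDup.
  - assert (q ^ n <> 0)%nat by (apply Nat.pow_nonzero; lia). destruct (q ^ n)%nat; easy.
  - intros t b b' _ Hb Hb' [Hv H1] [_ H2]. apply in_seq in Hb, Hb'.
    apply (svec_inj q n); try lia. intros i Hi.
    pose proof (sphere_supn n _ (Hmap _ (HlinkS t Hv))) as [Hs _].
    eapply Rle_lt_trans; [apply (obl_unique n (svec q b) (svec q b') (beta (rep t)) (/ INR (S n)) eta); auto|].
    + intros; now apply svec_le.
    + apply Heta2.
    + apply Heta2.
  - exists (svec q b), (map rep l). split; [intros; now apply svec_le|]. split; [|split].
    + intros u Hu. apply in_map_iff in Hu. destruct Hu as [t [<- Ht]]. apply HlinkS.
      apply (proj1 (Hl t)) in Ht. apply Ht.
    + intros v [Hv Hfv]. destruct (scode_ex k N v HN Hv) as [t [Ht Htv]].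
      pose proof (Hrep t v Htv) as Hr. pose proof (scode_close k N t (rep t) v HN Hr Htv) as Hclose.
      exists (rep t). split; [|easy]. apply in_map. apply Hl. split; [easy|]. split; [now exists v|].
      pose proof (supn_sdist n (obl n (svec q b) (beta (rep t))) (obl n (svec q b) (beta v))) as H1.
      pose proof (obl_sdist n (svec q b) (beta (rep t)) (beta v) (fun i _ => svec_le q b i Hq)) as H2.
      assert (Hrs : sphere k (rep t)) by (apply HlinkS; now exists v).
      pose proof (Hlip _ _ Hrs Hv) as H3. unfold eta. fold N in Hfv.
      assert (L * sdist (S k) (rep t) v <= L * (scC k * / INR N)) by (apply Rmult_le_compat_l; lra). lra.
    + rewrite length_map. rewrite length_seq, scodes_length in Hlen. exact Hlen.
Qed.

(** The left side is at most a constant times q^(2(k-n)+1), and k+1 < 2n makes this exponent at most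
    k-1. The bound on q absorbs the constant. *)
Lemma count_bound n k A q w : (n <= k)%nat -> (k + 1 < 2 * n)%nat -> (0 < A)%nat ->
  (2 * A * (2 * S k * A ^ k) * (2 * S k * A ^ k) < q)%nat ->
  (w * q ^ n <= S k * (2 * (A * q) ^ k))%nat -> (w * (w * S (A * q)) < q ^ k)%nat.
Proof.
  intros Hnk Hk HA Hq Hw. set (C1 := (2 * S k * A ^ k)%nat) in *.
  assert (Hq0 : (0 < q)%nat) by lia.
  assert (Hqn : (0 < q ^ n)%nat) by (apply Nat.neq_0_lt_0, Nat.pow_nonzero; lia).
  assert (H1 : (w <= C1 * q ^ (k - n))%nat).
  { apply (Nat.mul_le_mono_pos_r _ _ (q ^ n)); [easy|]. eapply Nat.le_trans; [exact Hw|].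
    rewrite <- Nat.mul_assoc, <- Nat.pow_add_r, Nat.sub_add by easy. unfold C1. rewrite Nat.pow_mul_l. nia. }
  assert (Hqe : (0 < q ^ (k - n))%nat) by (apply Nat.neq_0_lt_0, Nat.pow_nonzero; lia).
  assert (H2 : (w * (w * S (A * q)) <= C1 * q ^ (k - n) * (C1 * q ^ (k - n) * (2 * A * q)))%nat).
  { apply Nat.mul_le_mono; [easy|]. apply Nat.mul_le_mono; [easy|]. nia. }
  eapply Nat.le_lt_trans; [exact H2|].
  replace (C1 * q ^ (k - n) * (C1 * q ^ (k - n) * (2 * A * q)))%nat
    with (2 * A * C1 * C1 * (q ^ (k - n) * q ^ (k - n) * q))%nat by ring.
  rewrite <- Nat.pow_add_r.
  replace (q ^ (k - n + (k - n)) * q)%nat with (q ^ S (k - n + (k - n)))%nat by (rewrite Nat.pow_succ_r'; ring).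
  assert (H3 : (q ^ S (k - n + (k - n)) <= q ^ (k - 1))%nat) by (apply Nat.pow_le_mono_r; lia).
  replace (q ^ k)%nat with (q * q ^ (k - 1))%nat by (rewrite <- Nat.pow_succ_r'; f_equal; lia).
  assert (H4 : (0 < q ^ (k - 1))%nat) by (apply Nat.neq_0_lt_0, Nat.pow_nonzero; lia).
  apply Nat.le_lt_trans with (2 * A * C1 * C1 * q ^ (k - 1))%nat.
  - now apply Nat.mul_le_mono_l.
  - now apply Nat.mul_lt_mono_pos_r.
Qed.

(* General position: the two fibers have dimension k-n, the lines joining them sweep out directions of dimension
   2(k-n)+1 < k, so some direction r is missed. *)
Lemma separation n k beta L : (n <= k)%nat -> (k + 1 < 2 * n)%nat -> 1 <= L ->
  (forall x, sphere k x -> sphere n (beta x)) ->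
  (forall x y, sphere k x -> sphere k y -> sdist (S n) (beta x) (beta y) <= L * sdist (S k) x y) ->
  exists (s r : vec) (e : R), 0 < e /\ e < / INR (S n) / 2 /\ (forall i, Rabs (s i) <= 1) /\ (forall i, Rabs (r i) <= 1) /\
    (forall v, fiber n k beta s e v -> e <= supn k (obl k r v)) /\
    (forall v1 v2 c, fiber n k beta s e v1 -> fiber n k beta s e v2 -> beta v1 n * beta v2 n < 0 -> 0 <= c <= 1 ->
       e <= supn k (obl k r (fun i => v1 i - c * v2 i))).
Proof.
  intros Hnk Hk HL Hmap Hlip.
  assert (Hn1 : 1 <= INR (S n)) by (rewrite S_INR; pose proof (pos_INR n); lra).
  assert (Hk1 : 1 <= INR (S k)) by (rewrite S_INR; pose proof (pos_INR k); lra).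
  assert (Hdn : 0 < / INR (S n) <= 1).
  { split; [apply Rinv_0_lt_compat; lra|]. rewrite <- Rinv_1. apply Rinv_le_contravar; lra. }
  (* Fibre points over opposite sides have images whose heights differ by at least 1/(n+1), so their
     own distance is at least d. Then [d0] bounds |v1 - c v2| from below. *)
  set (d := / INR (S n) / L).
  assert (Hd : 0 < d <= 1).
  { unfold d. split; [apply Rdiv_lt_0_compat; lra|]. apply (Rmult_le_reg_r L); [lra|].
    unfold Rdiv. rewrite Rmult_assoc, Rinv_l by lra. lra. }
  set (d0 := d / (2 * INR (S k))). assert (Hd0 : 0 < d0) by (apply Rdiv_lt_0_compat; lra).
  assert (Hd0k : d0 <= / INR (S k)).
  { unfold d0. apply (Rmult_le_reg_r (2 * INR (S k))); [lra|].
    replace (d / (2 * INR (S k)) * (2 * INR (S k))) with d by (field; lra).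
    replace (/ INR (S k) * (2 * INR (S k))) with 2 by (field; lra). lra. }
  set (C := scC k). assert (HC : 0 <= C) by (unfold C, scC; repeat apply Rmult_le_pos; lra).
  (* The first bound is required by [thin_fiber]; the second makes [e2] small against d0/q, so that
     a segment point is near at most one axis. *)
  destruct (archimed_nat (Rmax (4 * INR (S n) * (1 + 2 * L * C)) (8 * (4 * C + 3) / d0))) as [A' HA'].
  set (A := S A') in *. assert (HA : (0 < A)%nat) by (unfold A; lia).
  assert (HA1 : 4 * INR (S n) * (1 + 2 * L * C) < INR A) by (eapply Rle_lt_trans; [apply Rmax_l|exact HA']).
  assert (HA2 : 8 * (4 * C + 3) / d0 < INR A) by (eapply Rle_lt_trans; [apply Rmax_r|exact HA']).
  set (q := S (2 * A * (2 * S k * A ^ k) * (2 * S k * A ^ k))). assert (Hq : (0 < q)%nat) by (unfold q; lia).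
  assert (HAR : 0 < INR A) by (apply lt_0_INR; lia). assert (HqR : 0 < INR q) by (apply lt_0_INR; lia).
  destruct (thin_fiber n k beta L A HA ltac:(lra) Hmap Hlip HA1 q Hq) as [s [W [Hs [HW [Hnet Hlen]]]]].
  set (N := (A * q)%nat) in *. assert (HN : (0 < N)%nat) by (unfold N; lia).
  assert (HNR : 0 < / INR N) by (apply Rinv_0_lt_compat, lt_0_INR; lia).
  fold C in Hnet.
  (* The thickness 1/N plus twice the discretization error (2C+1)/N of a segment point. *)
  set (e2 := (4 * C + 3) * / INR N).
  assert (He2 : 8 * e2 / d0 < / INR q).
  { unfold e2, N. rewrite mult_INR. apply (Rmult_lt_reg_r (INR A * INR q)); [nra|].
    replace (8 * ((4 * C + 3) * / (INR A * INR q)) / d0 * (INR A * INR q)) with (8 * (4 * C + 3) / d0) by (field; lra).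
    replace (/ INR q * (INR A * INR q)) with (INR A) by (field; lra). easy. }
  assert (Hq1 : / INR q <= 1) by (rewrite <- Rinv_1; apply Rinv_le_contravar; [lra|apply (le_INR 1); lia]).
  assert (He2d : e2 < d0 / 8).
  { apply (Rmult_lt_reg_r (8 / d0)); [apply Rdiv_lt_0_compat; lra|].
    replace (d0 / 8 * (8 / d0)) with 1 by (field; lra). replace (e2 * (8 / d0)) with (8 * e2 / d0) by (field; lra). lra. }
  set (X := fun (p : vec * (vec * nat)) i => fst p i - INR (snd (snd p)) / INR N * fst (snd p) i).
  set (R0 := fun b p => d0 / 2 <= supn (S k) (X p) /\ supn k (obl k (svec q b) (X p)) <= e2).
  destruct (pigeonhole R0 (list_prod W (list_prod W (seq 0 (S N)))) (seq 0 (q ^ k))) as [b [l [Hb [Hl Hcard]]]].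
  { apply seq_NoDup. }
  { assert (q ^ k <> 0)%nat by (apply Nat.pow_nonzero; lia). destruct (q ^ k)%nat; easy. }
  { intros p b b' _ Hb Hb' [H1 H2] [_ H2']. apply in_seq in Hb, Hb'.
    apply (svec_inj q k); try lia. intros i Hi.
    eapply Rle_lt_trans; [apply (obl_unique k (svec q b) (svec q b') (X p) (d0 / 2) e2); auto; try lra|].
    - intros; now apply svec_le.
    - replace (4 * e2 / (d0 / 2)) with (8 * e2 / d0) by (field; lra). easy. }
  rewrite !length_prod, !length_seq in Hcard.
  assert (Hcount := count_bound n k A q (length W) Hnk Hk HA ltac:(unfold q; lia) Hlen). fold N in Hcount.
  (* There are fewer triples than axes, so an axis with at most the average number of triples has
     none. *)
  assert (Hnil : l = nil).
  { destruct l as [|p l]; [easy|exfalso]. simpl length in Hcard. nia. }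
  assert (Hno : forall u1 u2 j, In u1 W -> In u2 W -> (j < S N)%nat -> ~ R0 b (u1, (u2, j))).
  { intros u1 u2 j H1 H2 Hj HR. cut (In (u1, (u2, j)) l); [rewrite Hnil; easy|].
    apply Hl. split; [|easy]. apply in_prod; [easy|]. apply in_prod; [easy|]. apply in_seq; lia. }
  set (r := svec q b) in *.
  assert (Hr : forall i, Rabs (r i) <= 1) by (intros; now apply svec_le).
  assert (Hkey : forall v1 v2 c, fiber n k beta s (/ INR N) v1 -> fiber n k beta s (/ INR N) v2 -> 0 <= c <= 1 ->
     d0 <= supn (S k) (fun i => v1 i - c * v2 i) -> / INR N <= supn k (obl k r (fun i => v1 i - c * v2 i))).
  { intros v1 v2 c H1 H2 Hc HY. set (Y := fun i => v1 i - c * v2 i) in *.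
    destruct (Hnet v1 H1) as [u1 [Hu1 Hd1]]. destruct (Hnet v2 H2) as [u2 [Hu2 Hd2]].
    destruct (nat_grid_ex N c HN Hc) as [j [Hj Hcj]].
    destruct (Rle_dec (/ INR N) (supn k (obl k r Y))) as [h|h]; [easy|exfalso].
    apply Rnot_le_lt in h. apply (Hno u1 u2 j Hu1 Hu2 Hj).
    assert (HXY : sdist (S k) (X (u1, (u2, j))) Y <= (2 * C + 1) * / INR N).
    { apply sdist_le; [apply Rmult_le_pos; lra|]. intros i Hi. unfold X, Y. cbn [fst snd].
      replace (u1 i - INR j / INR N * u2 i - (v1 i - c * v2 i))
        with ((u1 i - v1 i) + ((c - INR j / INR N) * u2 i + (- c) * (u2 i - v2 i))) by ring.
      pose proof (sdist_ge (S k) u1 v1 i Hi). pose proof (sdist_ge (S k) u2 v2 i Hi).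
      pose proof (sphere_le k u2 i (HW u2 Hu2) Hi) as Hu2i.
      eapply Rle_trans; [apply Rabs_triang|].
      assert (Rabs ((c - INR j / INR N) * u2 i + - c * (u2 i - v2 i)) <= / INR N * 1 + 1 * (C * / INR N)).
      { eapply Rle_trans; [apply Rabs_triang|]. rewrite !Rabs_mult, Rabs_Ropp, (Rabs_pos_eq c) by lra.
        apply Rplus_le_compat; apply Rmult_le_compat; try apply Rabs_pos; lra. }
      lra. }
    assert (Hsm : (2 * C + 1) * / INR N <= d0 / 2).
    { unfold e2 in He2d. nra. }
    split.
    - pose proof (supn_sdist (S k) Y (X (u1, (u2, j)))) as H3. rewrite sdist_sym in H3. lra.
    - pose proof (supn_sdist k (obl k r (X (u1, (u2, j)))) (obl k r Y)) as H3.
      pose proof (obl_sdist k r (X (u1, (u2, j))) Y (fun i _ => Hr i)) as H4.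
      change (supn k (obl k r (X (u1, (u2, j)))) <= e2). unfold e2. lra. }
  assert (HeN : / INR N < / INR (S n) / 2).
  { apply (Rmult_lt_reg_r (INR N * (2 * INR (S n)))).
    - apply Rmult_lt_0_compat; [now apply lt_0_INR|lra].
    - assert (0 < INR N) by now apply lt_0_INR.
      replace (/ INR N * (INR N * (2 * INR (S n)))) with (2 * INR (S n)) by (field; lra).
      replace (/ INR (S n) / 2 * (INR N * (2 * INR (S n)))) with (INR N) by (field; lra).
      unfold N. rewrite mult_INR. assert (1 <= INR q) by (apply (le_INR 1); lia).
      assert (0 <= L * C) by nra. nra. }
  exists s, r, (/ INR N). split; [easy|]. split.
  { exact HeN. }
  split; [easy|]. split; [easy|]. split.
  (* The factor c = 0 shows that the fibre stays away from the axis itself. *)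
  - intros v Hv. specialize (Hkey v v 0 Hv Hv ltac:(lra)).
    replace (obl k r v) with (obl k r (fun i => v i - 0 * v i)).
    + apply Hkey. rewrite (supn_ext _ _ v) by (intros; ring). pose proof (sphere_supn k v (proj1 Hv)). lra.
    + f_equal. apply FunctionalExtensionality.functional_extensionality. intros; ring.
  - intros v1 v2 c H1 H2 Hop Hc. apply Hkey; auto.
    apply unit_combination_lower; try apply H1; try apply H2; auto.
    destruct H1 as [H1 H1'], H2 as [H2 H2'].
    assert (Hlast : forall v, sphere k v -> supn n (obl n s (beta v)) <= / INR N -> / INR (S n) / 2 <= Rabs (beta v n)).
    { intros v Hv Hv'. apply (obl_last n s (beta v) (/ INR (S n)) (/ INR N)); auto; try lra.
      apply (sphere_supn n (beta v)). auto. }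
    pose proof (Hlast v1 H1 H1') as G1. pose proof (Hlast v2 H2 H2') as G2.
    pose proof (sdist_ge (S n) (beta v1) (beta v2) n ltac:(lia)) as G3.
    pose proof (Hlip v1 v2 H1 H2) as G4.
    assert (G5 : / INR (S n) <= Rabs (beta v1 n - beta v2 n)).
    { destruct (Rle_dec 0 (beta v1 n)) as [h|h].
      - assert (beta v2 n < 0) by nra. rewrite (Rabs_pos_eq (beta v1 n)) in G1 by lra.
        rewrite (Rabs_left (beta v2 n)) in G2 by lra. rewrite Rabs_pos_eq; lra.
      - assert (0 < beta v2 n) by nra. rewrite (Rabs_left (beta v1 n)) in G1 by lra.
        rewrite (Rabs_pos_eq (beta v2 n)) in G2 by lra. rewrite Rabs_left; lra. }
    unfold d. apply (Rmult_le_reg_l L); [lra|].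
    replace (L * (/ INR (S n) / L)) with (/ INR (S n)) by (field; lra). lra.
Qed.

(** * Smoothing near the boundary sphere *)

Definition radial (m : nat) (z : vec) : vec := fun i => / norm m z * z i.

Lemma norm_half m z : / 4 <= sq m z -> / 2 <= norm m z.
Proof.
  intros H. unfold norm. fold (sq m z). replace (/ 2) with (sqrt (/ 4)); [now apply sqrt_le_1_alt|].
  replace (/ 4) with (/ 2 * / 2) by field. apply sqrt_square. lra.
Qed.

Lemma radial_sphere k z : / 4 <= sq (S k) z -> sphere k (radial (S k) z).
Proof.
  intros H. apply norm_half in H. apply norm_1_sq. unfold radial. rewrite sq_scal, <- norm_sq. field. lra.
Qed.

Lemma radial_of_sphere k z i : sphere k z -> radial (S k) z i = z i.
Proof. intros H. unfold radial. unfold sphere in H. rewrite H. field. Qed.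

Lemma norm_le_1 m z : sq m z <= 1 -> norm m z <= 1.
Proof. intros H. unfold norm. fold (sq m z). rewrite <- sqrt_1. now apply sqrt_le_1_alt. Qed.

Lemma coord_le_1 m z i : sq m z <= 1 -> (i < m)%nat -> Rabs (z i) <= 1.
Proof. intros H Hi. eapply Rle_trans; [apply (norm_ge m z i Hi)|now apply norm_le_1]. Qed.

Lemma sq_sdist m x y : sq m x <= 1 -> sq m y <= 1 -> Rabs (sq m x - sq m y) <= 2 * INR m * sdist m x y.
Proof.
  intros Hx Hy. eapply Rle_trans; [apply (sq_lip m x y 1); intros i Hi; [now apply (coord_le_1 m x)|now apply (coord_le_1 m y)]|]. apply Req_le. ring.
Qed.

Lemma radial_lip m x y : / 4 <= sq m x <= 1 -> / 4 <= sq m y <= 1 ->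
  sdist m (radial m x) (radial m y) <= (2 + 4 * INR m) * sdist m x y.
Proof.
  intros Hx Hy. pose proof (norm_half m x ltac:(lra)) as Hnx. pose proof (norm_half m y ltac:(lra)) as Hny.
  pose proof (pos_INR m) as Hm. pose proof (sdist_nonneg m x y) as Hd.
  pose proof (sq_sdist m x y ltac:(lra) ltac:(lra)) as Hs. rewrite <- !norm_sq in Hs.
  set (a := norm m x) in *. set (b := norm m y) in *.
  assert (Hab : Rabs (a - b) <= 2 * INR m * sdist m x y).
  { replace (a * a - b * b) with ((a + b) * (a - b)) in Hs by ring.
    rewrite Rabs_mult, (Rabs_pos_eq (a + b)) in Hs by lra. pose proof (Rabs_pos (a - b)). nra. }
  apply sdist_le; [nra|]. intros i Hi. unfold radial. fold a b.
  replace (/ a * x i - / b * y i) with (/ a * (x i - y i) + (/ a * (b - a)) * (/ b * y i)) by (field; lra).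
  assert (Hia : 0 < / a <= 2).
  { split; [apply Rinv_0_lt_compat; lra|]. rewrite <- (Rinv_inv 2). apply Rinv_le_contravar; lra. }
  assert (Hyb : Rabs (/ b * y i) <= 1).
  { rewrite Rabs_mult, Rabs_pos_eq by (left; apply Rinv_0_lt_compat; lra).
    apply (Rmult_le_reg_l b); [lra|]. rewrite <- Rmult_assoc, Rinv_r, Rmult_1_l, Rmult_1_r by lra. now apply norm_ge. }
  eapply Rle_trans; [apply Rabs_triang|]. rewrite !Rabs_mult in *.
  rewrite (Rabs_pos_eq (/ a)) by lra. rewrite (Rabs_minus_sym b a).
  pose proof (sdist_ge m x y i Hi).
  assert (/ a * Rabs (x i - y i) <= 2 * sdist m x y) by (apply Rmult_le_compat; try apply Rabs_pos; lra).
  assert (/ a * Rabs (a - b) * (Rabs (/ b) * Rabs (y i)) <= 2 * (2 * INR m * sdist m x y) * 1).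
  { apply Rmult_le_compat; [|rewrite <- Rabs_mult; apply Rabs_pos| |easy].
    - apply Rmult_le_pos; [lra|apply Rabs_pos].
    - apply Rmult_le_compat; try apply Rabs_pos; lra. }
  lra.
Qed.

(** Squared radii that start at 1/4 and halve their gap to 1 at each step. *)
Definition shell_t (j : nat) : R := 1 - 3 / 4 * (/ 2) ^ j.

Lemma half_pow j : 0 < (/ 2) ^ j <= 1.
Proof.
  split; [apply pow_lt; lra|]. rewrite <- (pow1 j). apply pow_incr. lra.
Qed.

Lemma half_pow_mono i j : (i <= j)%nat -> (/ 2) ^ j <= (/ 2) ^ i.
Proof.
  intros H. replace j with (i + (j - i))%nat by lia. rewrite pow_add.
  pose proof (half_pow i). pose proof (half_pow (j - i)). nra.
Qed.

Lemma shell_dichotomy M s : / 4 <= s -> (exists j, (j <= M)%nat /\ shell_t j <= s <= shell_t (S j)) \/ shell_t (S M) <= s.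
Proof.
  intros Hs. induction M as [|M [[j [Hj IH]]|IH]].
  - destruct (Rle_dec s (shell_t 1)); [left; exists O; split; [lia|]; unfold shell_t in *; simpl in *; lra|right; lra].
  - left. exists j. split; [lia|easy].
  - destruct (Rle_dec s (shell_t (S (S M)))); [left; exists (S M); split; [lia|easy]|right; lra].
Qed.

Section collar.

Context (n k : nat) (beta : vec -> vec) (L : R) (HL : 1 <= L).
Context (Hmap : forall x, sphere k x -> sphere n (beta x)).
Context (Hlip : forall x y, sphere k x -> sphere k y -> sdist (S n) (beta x) (beta y) <= L * sdist (S k) x y).

Let m := S k.
Let Lr := L * (2 + 4 * INR m).
Let b0 (z : vec) : vec := beta (radial m z).

Context (ep : R) (Hep : 0 < ep) (Hep' : 3 * ep <= 3 / (32 * INR m)).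

Lemma m_ge1 : 1 <= INR m.
Proof. unfold m. rewrite S_INR. pose proof (pos_INR k). lra. Qed.

Lemma Lr_pos : 1 <= Lr.
Proof. pose proof m_ge1. unfold Lr. nra. Qed.

Lemma b0_lip x y : / 4 <= sq m x <= 1 -> / 4 <= sq m y <= 1 -> sdist (S n) (b0 x) (b0 y) <= Lr * sdist m x y.
Proof.
  intros Hx Hy. unfold b0, Lr. eapply Rle_trans; [apply Hlip; apply radial_sphere; unfold m in *; lra|].
  rewrite Rmult_assoc. apply Rmult_le_compat_l; [lra|]. now apply radial_lip.
Qed.

Lemma b0_le z i : / 4 <= sq m z -> (i < S n)%nat -> Rabs (b0 z i) <= 1.
Proof. intros Hz Hi. apply (sphere_le n); [|easy]. apply Hmap. now apply radial_sphere. Qed.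

Definition shell (j : nat) (a : vec) : Prop := shell_t j <= sq m a <= shell_t (S j).

Lemma shell_bounds j a : shell j a -> / 4 <= sq m a <= 1.
Proof. intros H. unfold shell, shell_t in H. pose proof (half_pow j). pose proof (half_pow (S j)). lra. Qed.

Definition netP (j : nat) (l : list vec) : Prop := (forall a, In a l -> shell j a) /\
  forall x, shell j x -> exists a, In a l /\ sdist m x a <= ep * (/ 2) ^ j.

Definition net (j : nat) : list vec := epsilon (inhabits nil) (netP j).

Lemma net_spec j : netP j (net j).
Proof.
  unfold net. apply epsilon_spec. apply (finite_net m (shell j)).
  - pose proof (half_pow j). nra.
  - intros x Hx. apply shell_bounds in Hx. apply supn_le; [lra|]. intros i Hi. now apply (coord_le_1 m).
Qed.

Fixpoint nets (M : nat) : list vec := match M with O => net O | S M' => net (S M') ++ nets M' end.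

Lemma nets_in j M a : (j <= M)%nat -> In a (net j) -> In a (nets M).
Proof.
  induction M as [|M IH]; intros Hj Ha; simpl; [now replace j with O in Ha by lia|].
  apply in_or_app. destruct (Nat.eq_dec j (S M)) as [->|Hne]; [now left|right; apply IH; [lia|easy]].
Qed.

Lemma nets_bounds M a : In a (nets M) -> / 4 <= sq m a <= 1.
Proof.
  induction M as [|M IH]; simpl; intros Ha; [apply net_spec in Ha; now apply shell_bounds in Ha|].
  apply in_app_or in Ha. destruct Ha as [Ha|Ha]; [apply net_spec in Ha; now apply shell_bounds in Ha|auto].
Qed.

(* The McShane extension from nets which are refined towards the sphere: away from the sphere it is a finite minimum. *)
Definition coll (M : nat) (z : vec) : vec := fun i => mcshane m (2 * Lr) 1 (fun a => b0 a i) (nets M) z.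

(** The slope is twice the Lipschitz constant of [b0], so a net point at distance d contributes at
    least Lr d above [b0 z]. Distant net points cannot attain the minimum. *)
Lemma term_ge z a i : / 4 <= sq m z <= 1 -> / 4 <= sq m a <= 1 -> (i < S n)%nat ->
  b0 z i + Lr * sdist m z a <= b0 a i + 2 * Lr * sdist m z a.
Proof.
  intros Hz Ha Hi. pose proof (b0_lip z a Hz Ha) as H. pose proof (sdist_ge (S n) (b0 z) (b0 a) i Hi) as H1.
  pose proof (Rle_abs (b0 z i - b0 a i)). lra.
Qed.

Lemma coll_ge M z i : / 4 <= sq m z <= 1 -> (i < S n)%nat -> b0 z i <= coll M z i.
Proof.
  intros Hz Hi. apply mcshane_ge.
  - pose proof (b0_le z i ltac:(lra) Hi). pose proof (Rle_abs (b0 z i)). lra.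
  - intros a Ha. pose proof (term_ge z a i Hz (nets_bounds M a Ha) Hi). pose proof Lr_pos.
    pose proof (sdist_nonneg m z a). nra.
Qed.

Lemma coll_le_of M z i a d : / 4 <= sq m z <= 1 -> (i < S n)%nat -> In a (nets M) -> sdist m z a <= d ->
  coll M z i <= b0 z i + 3 * Lr * d.
Proof.
  intros Hz Hi Ha Hd. pose proof Lr_pos.
  eapply Rle_trans; [apply (mcshane_le m (2 * Lr) 1 (fun a => b0 a i) (nets M) z a Ha)|].
  pose proof (b0_lip z a Hz (nets_bounds M a Ha)) as H1. pose proof (sdist_ge (S n) (b0 z) (b0 a) i Hi) as H2.
  pose proof (Rle_abs (- (b0 z i - b0 a i))) as H3. rewrite Rabs_Ropp in H3.
  assert (Lr * sdist m z a <= Lr * d) by (apply Rmult_le_compat_l; lra). lra.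
Qed.

Lemma coll_shell j M z i : (j <= M)%nat -> shell j z -> (i < S n)%nat ->
  coll M z i <= b0 z i + 3 * Lr * (ep * (/ 2) ^ j).
Proof.
  intros Hj Hz Hi. destruct (proj2 (net_spec j) z Hz) as [a [Ha Hd]].
  apply (coll_le_of M z i a); auto; [now apply (shell_bounds j)|now apply (nets_in j)].
Qed.

(** The newest net is at distance at least 3/(32 m) 2^-j from the shell j, beyond the range 3 ep
    2^-j in which a net point could matter; [Hep'] is exactly this comparison. *)
Lemma coll_stat j M z i : (j + 2 <= M)%nat -> shell j z -> (i < S n)%nat -> coll M z i = coll (M - 1) z i.
Proof.
  intros Hj Hz Hi. destruct M as [|M]; [lia|]. replace (S M - 1)%nat with M by lia.
  unfold coll. cbn [nets]. apply mcshane_app. intros a Ha. apply net_spec in Ha.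
  pose proof (coll_shell j M z i ltac:(lia) Hz Hi) as H1. unfold coll in H1. eapply Rle_trans; [exact H1|].
  pose proof (shell_bounds _ _ Hz) as Bz. pose proof (shell_bounds _ _ Ha) as Ba.
  eapply Rle_trans; [|apply (term_ge z a i Bz Ba Hi)].
  assert (Hd : 3 / (32 * INR m) * (/ 2) ^ j <= sdist m z a).
  { pose proof (sq_sdist m z a ltac:(lra) ltac:(lra)) as Hs. unfold shell, shell_t in Hz, Ha.
    pose proof (half_pow_mono (j + 2) (S M) ltac:(lia)) as Hp. rewrite pow_add in Hp.
    pose proof (half_pow j). simpl in Hz. simpl in Hp.
    assert (Hge : 3 / 16 * (/ 2) ^ j <= Rabs (sq m z - sq m a)).
    { rewrite Rabs_left1; simpl in Ha; lra. }
    pose proof m_ge1. apply (Rmult_le_reg_l (2 * INR m)); [lra|].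
    replace (2 * INR m * (3 / (32 * INR m) * (/ 2) ^ j)) with (3 / 16 * (/ 2) ^ j) by (field; lra). lra. }
  pose proof Lr_pos. pose proof (half_pow j).
  assert (3 * ep * (/ 2) ^ j <= sdist m z a) by nra. nra.
Qed.

Lemma coll_stat_all t : t < 1 -> exists M1, forall M z i, (M1 <= M)%nat -> / 4 <= sq m z <= t -> (i < S n)%nat ->
  coll M z i = coll M1 z i.
Proof.
  intros Ht. destruct (pow_small (/ 2) ((1 - t) / 2) 1) as [p Hp]; [lra|lra|lra|].
  exists (p + 2)%nat. intros M z i HM Hz Hi.
  assert (Hj : exists j, (j <= p)%nat /\ shell j z).
  { destruct (shell_dichotomy p (sq m z)) as [H|H]; [lra|easy|].
    exfalso. unfold shell_t in H. simpl in H. pose proof (half_pow p). lra. }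
  destruct Hj as [j [Hj Hsh]]. induction M as [|M IH]; [lia|].
  destruct (Nat.eq_dec (S M) (p + 2)) as [->|Hne]; [easy|].
  rewrite (coll_stat j (S M)) by (easy || lia). replace (S M - 1)%nat with M by lia. apply IH. lia.
Qed.

(** A point beyond the last shell is pulled back radially to its outer boundary, which moves it by
    at most 2^-M, and is then compared with the net of mesh ep 2^-M. *)
Lemma coll_far M z i : shell_t (S M) <= sq m z <= 1 -> (i < S n)%nat ->
  coll M z i <= b0 z i + 3 * Lr * ((ep + 1) * (/ 2) ^ M).
Proof.
  intros Hz Hi. pose proof (half_pow M) as Hp.
  assert (Ht : / 4 <= shell_t (S M) <= 1 - 3 / 8 * (/ 2) ^ M) by (unfold shell_t; simpl; lra).
  set (ta := sqrt (shell_t (S M) / sq m z)).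
  assert (Hq : 0 <= shell_t (S M) / sq m z <= 1).
  { split; [apply Rdiv_le_0_compat; lra|]. apply (Rmult_le_reg_r (sq m z)); [lra|].
    unfold Rdiv. rewrite Rmult_assoc, Rinv_l by lra. lra. }
  assert (Hta2 : ta * ta = shell_t (S M) / sq m z) by (apply sqrt_sqrt; lra).
  assert (Hta0 : 0 <= ta) by apply sqrt_pos.
  assert (Hta1 : ta <= 1) by (unfold ta; rewrite <- sqrt_1; apply sqrt_le_1_alt; lra).
  assert (Hqs : shell_t (S M) <= shell_t (S M) / sq m z).
  { apply (Rmult_le_reg_r (sq m z)); [lra|]. unfold Rdiv. rewrite Rmult_assoc, Rinv_l by lra. nra. }
  assert (Hsh : shell M (fun i => ta * z i)).
  { unfold shell. rewrite sq_scal. replace (ta ^ 2) with (ta * ta) by ring. rewrite Hta2.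
    replace (shell_t (S M) / sq m z * sq m z) with (shell_t (S M)) by (field; lra).
    split; [|lra]. unfold shell_t. simpl. lra. }
  destruct (proj2 (net_spec M) _ Hsh) as [a [Ha Hd]].
  apply (coll_le_of M z i a); auto; [lra|now apply (nets_in M)|].
  pose proof (sdist_tri m z (fun i => ta * z i) a) as Htri.
  assert (sdist m z (fun i => ta * z i) <= (/ 2) ^ M).
  { apply sdist_le; [lra|]. intros l Hl. replace (z l - ta * z l) with ((1 - ta) * z l) by ring.
    rewrite Rabs_mult, Rabs_pos_eq by lra. pose proof (coord_le_1 m z l ltac:(lra) Hl). pose proof (Rabs_pos (z l)).
    assert (1 - ta <= (/ 2) ^ M); [|nra].
    assert (shell_t (S M) <= ta) by nra. unfold shell_t in H1. simpl in H1. lra. }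
  lra.
Qed.

Lemma coll_near M z i : / 4 <= sq m z <= 1 -> (i < S n)%nat ->
  Rabs (coll M z i - b0 z i) <= 3 * Lr * (ep + (ep + 1) * (/ 2) ^ M).
Proof.
  intros Hz Hi. pose proof (coll_ge M z i Hz Hi) as Hge. rewrite Rabs_pos_eq by lra.
  pose proof Lr_pos. pose proof (half_pow M).
  assert (0 <= (ep + 1) * (/ 2) ^ M) by nra.
  destruct (shell_dichotomy M (sq m z)) as [[j [Hj Hsh]]|Hf]; [lra| |].
  - pose proof (coll_shell j M z i Hj Hsh Hi). pose proof (half_pow j).
    assert (3 * Lr * (ep * (/ 2) ^ j) <= 3 * Lr * (ep + (ep + 1) * (/ 2) ^ M)) by (apply Rmult_le_compat_l; nra). lra.
  - pose proof (coll_far M z i ltac:(lra) Hi).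
    assert (3 * Lr * ((ep + 1) * (/ 2) ^ M) <= 3 * Lr * (ep + (ep + 1) * (/ 2) ^ M)) by (apply Rmult_le_compat_l; nra). lra.
Qed.

End collar.

(** Piecewise smooth stages with one Lipschitz constant, stationary inside the open ball and
    convergent to [beta] on the sphere: their limit can be differentiated at a finite stage. *)
Lemma collar n k beta L e1 : 1 <= L -> 0 < e1 ->
  (forall x, sphere k x -> sphere n (beta x)) ->
  (forall x y, sphere k x -> sphere k y -> sdist (S n) (beta x) (beta y) <= L * sdist (S k) x y) ->
  exists (f : nat -> vec -> vec) (L1 : R), 0 <= L1 /\
    (forall M i, (i < S n)%nat -> PS (S k) (fun z => f M z i)) /\
    (forall M x y i, (i < S n)%nat -> Rabs (f M x i - f M y i) <= L1 * sdist (S k) x y) /\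
    (forall M z i, / 4 <= sq (S k) z <= 1 -> (i < S n)%nat -> Rabs (f M z i - beta (radial (S k) z) i) <= e1) /\
    (forall z i d, sphere k z -> (i < S n)%nat -> 0 < d -> exists M1, forall M, (M1 <= M)%nat -> Rabs (f M z i - beta z i) <= d) /\
    (forall t, t < 1 -> exists M1, forall M z i, (M1 <= M)%nat -> / 4 <= sq (S k) z <= t -> (i < S n)%nat -> f M z i = f M1 z i) /\
    (forall M z i, / 4 <= sq (S k) z <= 9 / 16 -> (i < S n)%nat -> f M z i = f O z i).
Proof.
  intros HL He Hmap Hlip. set (Lr := L * (2 + 4 * INR (S k))).
  assert (Hm : 1 <= INR (S k)) by (rewrite S_INR; pose proof (pos_INR k); lra).
  assert (HLr : 1 <= Lr) by (unfold Lr; nra).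
  set (ep := Rmin (/ (32 * INR (S k))) (e1 / (6 * Lr))).
  assert (Hep : 0 < ep) by (apply Rmin_pos; [apply Rinv_0_lt_compat; lra|apply Rdiv_lt_0_compat; lra]).
  assert (Hep1 : 3 * ep <= 3 / (32 * INR (S k))).
  { unfold Rdiv. apply Rmult_le_compat_l; [lra|apply Rmin_l]. }
  assert (Hep2 : 3 * Lr * ep <= e1 / 2).
  { apply Rle_trans with (3 * Lr * (e1 / (6 * Lr))); [apply Rmult_le_compat_l; [lra|apply Rmin_r]|].
    apply Req_le. field. lra. }
  destruct (pow_small (/ 2) (e1 / 2) (3 * Lr * (ep + 1))) as [M0 HM0]; [lra|lra|nra|].
  destruct (coll_stat_all n k beta L HL Hlip ep Hep Hep1 (9 / 16) ltac:(lra)) as [M2 HM2].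
  (* The shift by [M0] makes every stage [e1]-close to the radial extension, and the shift by [M2]
     makes all stages equal for |z|^2 <= 9/16. *)
  exists (fun M => coll k beta L ep (M + (M0 + M2))), (2 * Lr).
  split; [lra|]. split; [|split; [|split; [|split; [|split]]]].
  - intros M i Hi. apply mcshane_ps.
  - intros M x y i Hi. apply mcshane_lip. fold Lr. lra.
  - intros M z i Hz Hi. eapply Rle_trans; [apply (coll_near n k beta L HL Hmap Hlip ep Hep); auto|].
    fold Lr. pose proof (half_pow_mono M0 (M + (M0 + M2)) ltac:(lia)).
    assert (3 * Lr * (ep + 1) * (/ 2) ^ (M + (M0 + M2)) <= 3 * Lr * (ep + 1) * (/ 2) ^ M0) by (apply Rmult_le_compat_l; nra).
    lra.
  - intros z i d Hz Hi Hd. destruct (pow_small (/ 2) d (3 * Lr * (ep + 1))) as [M1 HM1]; [lra|lra|nra|].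
    exists M1. intros M HM. assert (Hz1 : sq (S k) z = 1) by now apply norm_1_sq.
    assert (E : beta z i = beta (radial (S k) z) i).
    { pose proof (Hlip z (radial (S k) z) Hz (radial_sphere k z ltac:(lra))) as H.
      rewrite (sdist_same (S k)), Rmult_0_r in H by (intros; symmetry; now apply radial_of_sphere).
      apply (sdist_eq0 (S n)); [|easy]. pose proof (sdist_nonneg (S n) (beta z) (beta (radial (S k) z))). lra. }
    rewrite E. pose proof (coll_ge n k beta L HL Hmap Hlip ep Hep (M + (M0 + M2)) z i ltac:(lra) Hi) as H1.
    assert (Hsh : shell_t (S (M + (M0 + M2))) <= sq (S k) z <= 1).
    { rewrite Hz1. unfold shell_t. pose proof (half_pow (S (M + (M0 + M2)))). lra. }
    pose proof (coll_far n k beta L HL Hlip ep Hep (M + (M0 + M2)) z i Hsh Hi) as H2. fold Lr in H2.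
    rewrite Rabs_pos_eq by lra. pose proof (half_pow_mono M1 (M + (M0 + M2)) ltac:(lia)).
    assert (3 * Lr * (ep + 1) * (/ 2) ^ (M + (M0 + M2)) <= 3 * Lr * (ep + 1) * (/ 2) ^ M1) by (apply Rmult_le_compat_l; nra).
    lra.
  - intros t Ht. destruct (coll_stat_all n k beta L HL Hlip ep Hep Hep1 t Ht) as [M1 HM1].
    exists M1. intros M z i HM Hz Hi. rewrite (HM1 (M + (M0 + M2))%nat), (HM1 (M1 + (M0 + M2))%nat) by (easy || lia). easy.
  - intros M z i Hz Hi. rewrite (HM2 (M + (M0 + M2))%nat), (HM2 (0 + (M0 + M2))%nat) by (easy || lia). easy.
Qed.

(** * Desuspension *)

Lemma radial_sphere_pos k z : 0 < norm (S k) z -> sphere k (radial (S k) z).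
Proof.
  intros H. apply norm_1_sq. unfold radial. rewrite sq_scal, <- norm_sq. field. lra.
Qed.

Definition unit_sup (m : nat) (x : vec) : vec := fun i => / supn m x * x i.

Lemma unit_sup_supn m x : 0 < supn m x -> supn m (unit_sup m x) = 1.
Proof.
  intros H. unfold unit_sup. rewrite supn_scal, Rabs_pos_eq by (left; now apply Rinv_0_lt_compat).
  apply Rinv_l. lra.
Qed.

Lemma unit_sup_sep m a b e c : 0 < supn m a <= 2 -> 0 < supn m b -> c = supn m a / supn m b ->
  e <= supn m (fun i => a i - c * b i) -> e / 2 <= sdist m (unit_sup m a) (unit_sup m b).
Proof.
  intros Ha Hb Hc He. unfold sdist.
  assert (E : supn m (vsub (unit_sup m a) (unit_sup m b)) = supn m (fun i => / supn m a * (a i - c * b i))).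
  { apply supn_ext. intros i _. unfold vsub, unit_sup. rewrite Hc. field. lra. }
  rewrite E, supn_scal, Rabs_pos_eq by (left; now apply Rinv_0_lt_compat).
  assert (/ 2 <= / supn m a) by (apply Rinv_le_contravar; lra).
  assert (0 < / supn m a) by (apply Rinv_0_lt_compat; lra).
  pose proof (supn_nonneg m (fun i => a i - c * b i)).
  apply Rle_trans with (/ 2 * supn m (fun i => a i - c * b i)); [lra|]. now apply Rmult_le_compat_r.
Qed.

Definition axis (k : nat) (r : vec) : vec := fun i => if Nat.eqb i k then 1 else r i.

(** A translation parallel to the axis (r,1), which leaves [obl k r] unchanged; [radial] brings the
    point back to the sphere, on the same meridian. *)
Definition slide (k : nat) (r : vec) (lam : vec -> R) (s : R) (e : vec) : vec := fun i => e i + s * lam e * axis k r i.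

Lemma obl_slide k r lam s e i : (i < k)%nat -> obl k r (slide k r lam s e) i = obl k r e i.
Proof.
  intros Hi. unfold obl, slide, axis. rewrite Nat.eqb_refl.
  rewrite (eqb_ne i k) by lia. ring.
Qed.

Lemma obl_supn_le k r x : (forall i, Rabs (r i) <= 1) -> supn k (obl k r x) <= 2 * supn (S k) x.
Proof.
  intros Hr. pose proof (supn_nonneg (S k) x). apply supn_le; [lra|]. intros i Hi. unfold obl.
  replace (x i - x k * r i) with (x i + - (x k * r i)) by ring.
  eapply Rle_trans; [apply Rabs_triang|]. rewrite Rabs_Ropp, Rabs_mult.
  pose proof (supn_ge (S k) x i ltac:(lia)). pose proof (supn_ge (S k) x k ltac:(lia)).
  pose proof (Rmult_le_compat_l (Rabs (x k)) _ _ (Rabs_pos _) (Hr i)). lra.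
Qed.

(* Sliding along the meridians joining -axis to axis moves the fibre over the north pole into the upper half space
   and the fibre over the south pole into the lower one. *)
Lemma push n k beta L s r e : 1 <= L ->
  (forall x, sphere k x -> sphere n (beta x)) ->
  (forall x y, sphere k x -> sphere k y -> sdist (S n) (beta x) (beta y) <= L * sdist (S k) x y) ->
  0 < e < 1 -> (forall i, Rabs (r i) <= 1) ->
  (forall v, fiber n k beta s e v -> e <= supn k (obl k r v)) ->
  (forall v1 v2 c, fiber n k beta s e v1 -> fiber n k beta s e v2 -> beta v1 n * beta v2 n < 0 -> 0 <= c <= 1 ->
     e <= supn k (obl k r (fun i => v1 i - c * v2 i))) ->
  exists (lam : vec -> R) (d2 : R), 0 < d2 /\ PS (S k) lam /\
    (forall x t, sphere k x -> d2 <= norm (S k) (slide k r lam t x)) /\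
    (forall x, sphere k x -> fiber n k beta s e (radial (S k) (slide k r lam 1 x)) ->
       (0 < beta (radial (S k) (slide k r lam 1 x)) n -> 0 < x k) /\
       (beta (radial (S k) (slide k r lam 1 x)) n < 0 -> x k < 0)).
Proof.
  intros HL Hmap Hlip He Hr Hpole Hsep.
  assert (Hk1 : 1 <= INR (S k)) by (rewrite S_INR; pose proof (pos_INR k); lra).
  set (U := fun (sg : R) v => fiber n k beta s e v /\ 0 < sg * beta v n).
  (* The meridians that carry a fibre point of height sign [sg], recorded by their directions around
     the axis. [Hsep] keeps the two families apart. *)
  set (A := fun (sg : R) y => exists v, U sg v /\ forall i, (i < k)%nat -> y i = unit_sup k (obl k r v) i).
  assert (Hob : forall v, sphere k v -> supn k (obl k r v) <= 2).
  { intros v Hv. eapply Rle_trans; [now apply obl_supn_le|]. pose proof (sphere_supn k v Hv). lra. }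
  destruct (ps_separation k (A 1) (A (-1)) (e / 2)) as [phi [Hphi [Hrange [Hp Hm]]]]; [lra| | |].
  { intros y [v [[Hv _] Hy]]. rewrite (supn_ext _ _ _ Hy), unit_sup_supn; [lra|]. specialize (Hpole v Hv). lra. }
  { intros y1 y2 [v1 [[Hv1 Hb1] Hy1]] [v2 [[Hv2 Hb2] Hy2]].
    assert (Ey : sdist k y2 y1 = sdist k (unit_sup k (obl k r v2)) (unit_sup k (obl k r v1))).
    { apply supn_ext. intros i Hi. unfold vsub. now rewrite Hy1, Hy2. }
    rewrite Ey. pose proof (Hpole v1 Hv1) as P1. pose proof (Hpole v2 Hv2) as P2.
    pose proof (Hob v1 (proj1 Hv1)) as Q1. pose proof (Hob v2 (proj1 Hv2)) as Q2.
    assert (Hop : beta v1 n * beta v2 n < 0) by nra.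
    assert (Elin : forall u v c i, obl k r u i - c * obl k r v i = obl k r (fun i => u i - c * v i) i) by (intros; unfold obl; ring).
    destruct (Rle_dec (supn k (obl k r v1)) (supn k (obl k r v2))) as [h|h].
    - rewrite sdist_sym. eapply unit_sup_sep; [lra|lra|reflexivity|].
      rewrite (supn_ext k _ _ (fun i _ => Elin v1 v2 _ i)). apply Hsep; auto.
      split; [apply Rdiv_le_0_compat; lra|]. apply (Rmult_le_reg_r (supn k (obl k r v2))); [lra|].
      unfold Rdiv. rewrite Rmult_assoc, Rinv_l by lra. lra.
    - eapply unit_sup_sep; [lra|lra|reflexivity|].
      rewrite (supn_ext k _ _ (fun i _ => Elin v2 v1 _ i)). apply Hsep; auto; [lra|].
      split; [apply Rdiv_le_0_compat; lra|]. apply (Rmult_le_reg_r (supn k (obl k r v1))); [lra|].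
      unfold Rdiv. rewrite Rmult_assoc, Rinv_l by lra. lra. }
  set (e1 := e / (4 * INR (S k))). assert (He1 : 0 < e1) by (apply Rdiv_lt_0_compat; lra).
  assert (He1k : e1 * (4 * INR (S k)) = e) by (unfold e1; field; lra).
  (* The slid point has norm at most 2/e when its direction lies in the fibre, so a translation by
     2/e + 1 has to start on the correct side. *)
  set (T := 2 / e + 1).
  (* Near the axis the direction of the meridian is not controlled, so the translation is cut off
     there. *)
  set (lam := fun x => - T * (clamp 0 1 (/ e1 * (supn k (obl k r x) - e1)) *
     phi (fun i => / Rmax (supn k (obl k r x)) e1 * obl k r x i))).
  assert (Hlow : forall x, supn k (obl k r x) <= e1 -> lam x = 0).
  { intros x Hx. unfold lam. rewrite clamp_lo; [ring|]. split; [|lra].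
    assert (0 < / e1) by now apply Rinv_0_lt_compat. nra. }
  assert (Hlam : forall x sg, (sg = 1 \/ sg = -1) -> e1 <= supn k (obl k r x) -> A sg (unit_sup k (obl k r x)) ->
     sg * lam x <= 0 /\ (2 * e1 <= supn k (obl k r x) -> lam x = - sg * T)).
  { intros x sg Hsg Hx HA.
    assert (E : phi (fun i => / Rmax (supn k (obl k r x)) e1 * obl k r x i) = sg).
    { rewrite Rmax_left by easy. destruct Hsg as [-> | ->]; [apply (Hp _ HA)|apply (Hm _ HA)]. }
    unfold lam. rewrite E. assert (0 < T) by (unfold T; pose proof (Rdiv_lt_0_compat 2 e); lra). split.
    - pose proof (clamp_range 0 1 (/ e1 * (supn k (obl k r x) - e1)) ltac:(lra)). destruct Hsg as [-> | ->]; nra.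
    - intros Hx2. rewrite clamp_hi; [ring|]. split; [lra|].
      apply (Rmult_le_reg_l e1); [easy|]. rewrite <- Rmult_assoc, Rinv_r by lra. lra. }
  assert (Hslide : forall t x, supn k (obl k r (slide k r lam t x)) = supn k (obl k r x)).
  { intros t x. apply supn_ext. intros; now apply obl_slide. }
  exists lam, (e1 / 2). split; [lra|]. split; [|split].
  - apply ps_scal, ps_mul.
    + apply ps_clamp, ps_scal, ps_sub; [|apply ps_const]. apply (ps_supn (S k) k (fun x => obl k r x)). intros i Hi.
      apply ps_sub; [apply ps_coord; lia|apply ps_mul; [apply ps_coord; lia|apply ps_const]].
    + apply (ps_subst (S k) k phi (fun x i => / Rmax (supn k (obl k r x)) e1 * obl k r x i)); [easy|].
      assert (Ho : forall i, (i < k)%nat -> PS (S k) (fun x => obl k r x i)).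
      { intros i Hi. apply ps_sub; [apply ps_coord; lia|apply ps_mul; [apply ps_coord; lia|apply ps_const]]. }
      intros i Hi. apply ps_mul; [|now apply Ho]. apply (ps_inv _ _ e1); [easy|intros; apply Rmax_r|].
      apply ps_max; [|apply ps_const]. now apply (ps_supn (S k) k (fun x => obl k r x)).
  - intros x t Hx. eapply Rle_trans; [|apply supn_le_norm].
    destruct (Rle_dec (supn k (obl k r x)) e1) as [h|h].
    + rewrite (supn_ext _ _ x).
      * pose proof (sphere_supn k x Hx).
        assert (e1 / 2 <= / INR (S k)); [|lra]. apply (Rmult_le_reg_r (INR (S k))); [lra|].
        rewrite Rinv_l by lra. nra.
      * intros i Hi. unfold slide. rewrite (Hlow x h). ring.
    + pose proof (obl_supn_le k r (slide k r lam t x) Hr) as H. rewrite Hslide in H. lra.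
  - intros x Hx. set (w := slide k r lam 1 x). set (v := radial (S k) w). intros Hf.
    assert (Hgen : forall sg, sg = 1 \/ sg = -1 -> 0 < sg * beta v n -> 0 < sg * x k).
    { intros sg Hsg Hb. set (nw := norm (S k) w) in *.
      pose proof (Hpole v Hf) as Hpv.
      assert (Hnw : 0 < nw).
      { destruct (Rle_lt_or_eq_dec _ _ (norm_nonneg (S k) w)) as [h|h]; [easy|exfalso].
        assert (Hw0 : supn (S k) w <= 0) by (rewrite h; apply supn_le_norm).
        pose proof (obl_supn_le k r w Hr) as H0. unfold w in H0 at 1. rewrite Hslide in H0.
        assert (Hw1 : supn (S k) w = supn (S k) x).
        { apply supn_ext. intros i Hi. unfold w, slide. rewrite (Hlow x) by lra. ring. }
        pose proof (sphere_supn k x Hx). pose proof (Rinv_0_lt_compat (INR (S k)) ltac:(lra)). lra. }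
      assert (Eo : forall i, (i < k)%nat -> obl k r x i = nw * obl k r v i).
      { intros i Hi. rewrite <- (obl_slide k r lam 1 x i Hi). fold w. unfold v, radial, obl. fold nw. field. lra. }
      assert (Es : supn k (obl k r x) = nw * supn k (obl k r v)).
      { rewrite (supn_ext _ _ _ Eo), supn_scal, Rabs_pos_eq by lra. easy. }
      assert (Hvk : w k = x k + lam x).
      { unfold w, slide, axis. rewrite Nat.eqb_refl. ring. }
      assert (Hwk : Rabs (w k) <= nw) by (apply norm_ge; lia).
      assert (HA : A sg (unit_sup k (obl k r x))).
      { exists v. split; [now split|]. intros i Hi. unfold unit_sup. rewrite Es, (Eo i Hi). field. lra. }
      destruct (Rle_dec (2 * e1) (supn k (obl k r x))) as [h|h].
      - destruct (Hlam x sg Hsg ltac:(lra) HA) as [_ Hl]. specialize (Hl h).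
        assert (nw <= 2 / e).
        { apply (Rmult_le_reg_r e); [lra|]. replace (2 / e * e) with 2 by (field; lra).
          pose proof (obl_supn_le k r x Hr). pose proof (sphere_supn k x Hx). nra. }
        apply Rabs_le_between in Hwk. unfold T in Hl. destruct Hsg as [-> | ->]; lra.
      (* Near the axis the translation may be incomplete but has the right sign. From the wrong side
         it would lead further out, to norm at least 1/(2(k+1)), and the slid direction would be too
         close to the axis for a fibre point. *)
      - assert (Hlx : sg * lam x <= 0).
        { destruct (Rle_dec e1 (supn k (obl k r x))) as [h'|h']; [now apply Hlam|]. rewrite Hlow by lra. lra. }
        destruct (Rlt_dec 0 (sg * x k)) as [g|g]; [easy|exfalso].
        assert (Hxk : / INR (S k) / 2 <= Rabs (x k)).
        { apply (obl_last k r x (/ INR (S k)) (2 * e1)); auto.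
          - now apply sphere_supn.
          - apply (Rmult_lt_reg_r (4 * INR (S k))); [lra|].
            replace (/ INR (S k) / 2 * (4 * INR (S k))) with 2 by (field; lra). lra.
          - apply Rinv_0_lt_compat; lra.
          - lra. }
        assert (Hw2 : Rabs (x k) <= nw).
        { eapply Rle_trans; [|exact Hwk]. rewrite Hvk.
          destruct Hsg as [-> | ->]; [rewrite !Rabs_left1|rewrite !Rabs_pos_eq]; lra. }
        assert (e <= 2 * e1 / nw).
        { apply (Rmult_le_reg_r nw); [easy|]. replace (2 * e1 / nw * nw) with (2 * e1) by (field; lra). nra. }
        assert (2 * e1 / nw < e).
        { apply (Rmult_lt_reg_r nw); [easy|]. replace (2 * e1 / nw * nw) with (2 * e1) by (field; lra).
          assert (e * (/ INR (S k) / 2) <= e * nw) by (apply Rmult_le_compat_l; lra).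
          replace (e * (/ INR (S k) / 2)) with (2 * e1) in H0 by (unfold e1; field; lra).
          assert (Hlt : supn k (obl k r x) < 2 * e1) by lra. nra. }
        lra. }
    split; intros Hb.
    + specialize (Hgen 1 (or_introl eq_refl)). lra.
    + specialize (Hgen (-1) (or_intror eq_refl)). lra.
Qed.

(** * Guarded normalization and the annulus *)

Definition nmax (m : nat) (d : R) (z : vec) : R := sqrt (Rmax (sq m z) (d * d)).

Lemma nmax_ge m d z : 0 <= d -> d <= nmax m d z.
Proof. intros Hd. unfold nmax. rewrite <- (sqrt_square d Hd) at 1. apply sqrt_le_1_alt, Rmax_r. Qed.

Lemma nmax_ge_norm m d z : norm m z <= nmax m d z.
Proof. apply sqrt_le_1_alt, Rmax_l. Qed.

Lemma nmax_eq m d z : 0 <= d -> d <= norm m z -> nmax m d z = norm m z.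
Proof.
  intros Hd H. unfold nmax. rewrite Rmax_left; [easy|]. rewrite <- norm_sq. nra.
Qed.

Lemma nmax_eq_d m d z : 0 <= d -> norm m z <= d -> nmax m d z = d.
Proof.
  intros Hd H. unfold nmax. rewrite Rmax_right; [now apply sqrt_square|]. rewrite <- norm_sq.
  pose proof (norm_nonneg m z). nra.
Qed.

(** The maximum is taken under the root, so that the radicand is bounded below as [ps_sqrt]
    demands. *)
Lemma nmax_ps m q d (G : vec -> vec) : 0 < d -> (forall i, (i < q)%nat -> PS m (fun x => G x i)) ->
  PS m (fun x => nmax q d (G x)).
Proof.
  intros Hd HG. unfold nmax. apply (ps_sqrt m _ (d * d)); [nra|intros; apply Rmax_r|].
  apply ps_max; [|apply ps_const]. unfold sq. apply (ps_vsum m q (fun i x => G x i ^ 2)).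
  intros i Hi. apply (ps_ext m (fun x => G x i * G x i)); [intros; ring|]. apply ps_mul; auto.
Qed.

Lemma nmax_inv_ps m q d (G : vec -> vec) : 0 < d -> (forall i, (i < q)%nat -> PS m (fun x => G x i)) ->
  PS m (fun x => / nmax q d (G x)).
Proof.
  intros Hd HG. apply (ps_inv m _ d); [easy|intros; apply nmax_ge; lra|]. now apply nmax_ps.
Qed.

Lemma norm_scal m c x : norm m (fun i => c * x i) = Rabs c * norm m x.
Proof.
  unfold norm. fold (sq m (fun i => c * x i)) (sq m x). rewrite sq_scal, sqrt_mult_alt by apply pow2_ge_0.
  f_equal. rewrite <- sqrt_Rsqr_abs. f_equal. unfold Rsqr. ring.
Qed.

Lemma radial_scal m c x : 0 < c -> 0 < norm m x -> radial m (fun i => c * x i) = radial m x.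
Proof.
  intros Hc Hx. apply FunctionalExtensionality.functional_extensionality. intros i. unfold radial.
  rewrite norm_scal, Rabs_pos_eq by lra. field. lra.
Qed.

Lemma clamp_mult_sign K a t : 0 < K -> 0 <= t <= 1 -> (1 - t) * a + t * clamp (-1) 1 (K * a) = 0 -> a = 0.
Proof.
  intros HK Ht H. destruct (Rtotal_order a 0) as [h|[h|h]]; [exfalso|easy|exfalso].
  - assert (clamp (-1) 1 (K * a) < 0).
    { unfold clamp. eapply Rle_lt_trans; [apply Rmin_r|]. apply Rmax_lub_lt; nra. }
    nra.
  - assert (0 < clamp (-1) 1 (K * a)).
    { unfold clamp. apply Rmin_pos; [lra|]. eapply Rlt_le_trans; [|apply Rmax_r]. nra. }
    nra.
Qed.

Lemma clamp_nz K a : 0 < K -> a <> 0 -> clamp (-1) 1 (K * a) <> 0.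
Proof. intros HK Ha H. apply Ha. apply (clamp_mult_sign K a 1); [easy|lra|]. rewrite H. ring. Qed.

Lemma mix_pos p a b : 0 <= p <= 1 -> 0 < a -> 0 < b -> 0 < (1 - p) * a + p * b.
Proof. intros Hp Ha Hb. destruct (Rle_dec p (/ 2)); nra. Qed.

Section annulus.

Context (n k : nat) (beta : vec -> vec) (L : R).
Context (Hmap : forall x, sphere k x -> sphere n (beta x)).
Context (Hlip : forall x y, sphere k x -> sphere k y -> sdist (S n) (beta x) (beta y) <= L * sdist (S k) x y).
Context (s r : vec) (es : R) (Hes : 0 < es < 1) (Hesn : es < / INR (S n) / 2) (Hs : forall i, Rabs (s i) <= 1).
Context (lam : vec -> R) (d2 : R) (Hd2 : 0 < d2) (Hlam : PS (S k) lam).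
Context (Hslide : forall x t, sphere k x -> d2 <= norm (S k) (slide k r lam t x)).
Context (Hpush : forall x, sphere k x -> fiber n k beta s es (radial (S k) (slide k r lam 1 x)) ->
       (0 < beta (radial (S k) (slide k r lam 1 x)) n -> 0 < x k) /\
       (beta (radial (S k) (slide k r lam 1 x)) n < 0 -> x k < 0)).
Context (e1 : R) (He1 : 0 < e1 <= es / 4).
Context (f : nat -> vec -> vec) (L1 : R) (HL1 : 0 <= L1).
Context (Hfps : forall M i, (i < S n)%nat -> PS (S k) (fun z => f M z i)).
Context (Hflip : forall M x y i, (i < S n)%nat -> Rabs (f M x i - f M y i) <= L1 * sdist (S k) x y).
Context (Hfnear : forall M z i, / 4 <= sq (S k) z <= 1 -> (i < S n)%nat -> Rabs (f M z i - beta (radial (S k) z) i) <= e1).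
Context (Hfstat0 : forall M z i, / 4 <= sq (S k) z <= 9 / 16 -> (i < S n)%nat -> f M z i = f O z i).
Context (d0 rho : R) (Hd0 : 0 < d0 <= rho) (Hrho : 0 < rho) (Hrhok : rho * (4 * INR (S k)) = 1).

Definition eu (z : vec) : vec := fun i => / nmax (S k) d0 z * z i.
Definition phase (t : R) (z : vec) : R := clamp 0 1 (16 * (t - sq (S k) z)).
Definition Wv (z : vec) : vec := slide k r lam (phase (4 / 16) z) (eu z).
(** The radius is not allowed to fall below 1/2, because [f] is compared with [beta] only for
    squared radius at least 1/4. *)
Definition zeta (z : vec) : vec := fun i => nmax (S k) (/ 2) z * (/ nmax (S k) d2 (Wv z) * Wv z i).
Definition emb (x : vec) : vec := fun i => if Nat.eqb i k then 0 else x i.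
Definition W1 (x : vec) : vec := slide k r lam 1 (eu (emb x)).
Definition zeta1 (x : vec) : vec := fun i => / 2 * (/ nmax (S k) d2 (W1 x) * W1 x i).
Definition equat (x : vec) : vec := obl n s (f O (zeta1 x)).
(** For |x| >= d0 the oblique projection on the equator has sup norm at least es/2 by [equat_lower];
    after scaling by 2/es, clamping puts it on the boundary of the cube. *)
Definition gmap (x : vec) : vec := fun i => clamp (-1) 1 (2 / es * equat x i).
(* Going inwards from |z| = 1/2: the first phase (4/16) slides the source along the meridians and shears the target; the
   second (3/16) replaces the height of the image by the height of z; the third (2/16) makes the horizontal part of the
   image depend on the horizontal part of z only. *)
Definition Amap (M : nat) (z : vec) : vec := fun i =>
  if Nat.eqb i n
  then (1 - phase (3 / 16) z) * f M (zeta z) n + phase (3 / 16) z * (/ rho * z k)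
  else (1 - phase (2 / 16) z) * (f M (zeta z) i - phase (4 / 16) z * f M (zeta z) n * s i)
       + phase (2 / 16) z * gmap (fun j => / rho * z j) i.

Lemma Sk_ge1 : 1 <= INR (S k).
Proof. rewrite S_INR. pose proof (pos_INR k). lra. Qed.

Lemma Sn_inv : 0 < / INR (S n) <= 1.
Proof.
  assert (1 <= INR (S n)) by (rewrite S_INR; pose proof (pos_INR n); lra).
  split; [apply Rinv_0_lt_compat; lra|]. rewrite <- Rinv_1. apply Rinv_le_contravar; lra.
Qed.

Lemma rho_le : rho <= / 4.
Proof. pose proof Sk_ge1. nra. Qed.

Lemma eu_radial z : d0 <= norm (S k) z -> eu z = radial (S k) z.
Proof. intros H. unfold eu, radial. now rewrite nmax_eq by lra. Qed.

Lemma phase_range t z : 0 <= phase t z <= 1.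
Proof. apply clamp_range. lra. Qed.

Lemma phase_0 t z : t <= sq (S k) z -> phase t z = 0.
Proof. intros H. apply clamp_lo. lra. Qed.

Lemma phase_1 t z : sq (S k) z <= t - / 16 -> phase t z = 1.
Proof. intros H. apply clamp_hi. lra. Qed.

Lemma coord_ps i : (i < S k)%nat -> PS (S k) (fun z => z i).
Proof. apply ps_coord. Qed.

Lemma phase_ps t : PS (S k) (phase t).
Proof.
  apply ps_clamp, ps_scal, ps_sub; [apply ps_const|]. apply (ps_vsum (S k) (S k) (fun i x => x i ^ 2)).
  intros i Hi. apply (ps_ext _ (fun x => x i * x i)); [intros; ring|]. apply ps_mul; now apply ps_coord.
Qed.

Lemma eu_ps m (G : vec -> vec) : (forall i, (i < S k)%nat -> PS m (fun x => G x i)) ->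
  forall i, (i < S k)%nat -> PS m (fun x => eu (G x) i).
Proof. intros H i Hi. apply ps_mul; [apply nmax_inv_ps; [lra|easy]|auto]. Qed.

Lemma slide_ps m (t : vec -> R) (G : vec -> vec) : PS m t -> (forall i, (i < S k)%nat -> PS m (fun x => G x i)) ->
  forall i, (i < S k)%nat -> PS m (fun x => slide k r lam (t x) (G x) i).
Proof.
  intros Ht H i Hi. apply ps_add; [auto|]. apply ps_mul; [|apply ps_const]. apply ps_mul; [easy|].
  now apply (ps_subst m (S k) lam).
Qed.

Lemma Wv_ps i : (i < S k)%nat -> PS (S k) (fun z => Wv z i).
Proof.
  apply (slide_ps (S k) (phase (4 / 16)) (fun z => eu z)); [apply phase_ps|].
  apply (eu_ps (S k) (fun z => z)). apply coord_ps.
Qed.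

Lemma zeta_ps i : (i < S k)%nat -> PS (S k) (fun z => zeta z i).
Proof.
  intros Hi. apply ps_mul; [apply (nmax_ps (S k) (S k) (/ 2) (fun z => z)); [lra|apply coord_ps]|].
  apply ps_mul; [apply nmax_inv_ps; [easy|apply Wv_ps]|now apply Wv_ps].
Qed.

Lemma equat_ps i : (i < n)%nat -> PS k (fun x => equat x i).
Proof.
  intros Hi.
  assert (HW : forall j, (j < S k)%nat -> PS k (fun x => W1 x j)).
  { apply (slide_ps k (fun _ => 1) (fun x => eu (emb x))); [apply ps_const|].
    apply (eu_ps k emb). intros j Hj. unfold emb. destruct (Nat.eqb_spec j k); [apply ps_const|apply ps_coord; lia]. }
  assert (Hf : forall j, (j < S n)%nat -> PS k (fun x => f O (zeta1 x) j)).
  { intros j Hj. apply (ps_subst k (S k) (fun z => f O z j)); [now apply Hfps|]. intros l Hl.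
    apply ps_scal, ps_mul; [now apply nmax_inv_ps|now apply HW]. }
  apply ps_sub; [apply Hf; lia|]. apply ps_mul; [apply Hf; lia|apply ps_const].
Qed.

Lemma gmap_ps i : (i < n)%nat -> PS k (fun x => gmap x i).
Proof. intros Hi. apply ps_clamp, ps_scal. now apply equat_ps. Qed.

Lemma Amap_ps M i : (i < S n)%nat -> PS (S k) (fun z => Amap M z i).
Proof.
  intros Hi. unfold Amap.
  assert (Hf : forall j, (j < S n)%nat -> PS (S k) (fun z => f M (zeta z) j)).
  { intros j Hj. apply (ps_subst (S k) (S k) (fun z => f M z j)); [now apply Hfps|apply zeta_ps]. }
  assert (Hph : forall t, PS (S k) (fun z => 1 - phase t z)).
  { intros t. apply ps_sub; [apply ps_const|apply phase_ps]. }
  destruct (Nat.eqb_spec i n) as [->|Hne].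
  - apply ps_add; apply ps_mul; try apply Hph; try apply phase_ps; [now apply Hf|]. apply ps_scal, coord_ps. lia.
  - apply ps_add; apply ps_mul; try apply Hph; try apply phase_ps.
    + apply ps_sub; [now apply Hf|]. apply ps_mul; [|apply ps_const]. apply ps_mul; [apply phase_ps|apply Hf; lia].
    + apply (ps_subst (S k) k (fun x => gmap x i)); [apply gmap_ps; lia|]. intros j Hj.
      apply ps_scal, coord_ps. lia.
Qed.

Lemma beta_ext x y i : sphere k x -> sphere k y -> (forall j, (j < S k)%nat -> x j = y j) -> (i < S n)%nat -> beta x i = beta y i.
Proof.
  intros Hx Hy H Hi. apply (sdist_eq0 (S n)); [|easy]. apply Rle_antisym; [|apply sdist_nonneg].
  eapply Rle_trans; [now apply Hlip|]. rewrite sdist_same by easy. lra.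
Qed.

Lemma near_beta_nz y v : sphere k v -> (forall i, (i < S n)%nat -> Rabs (y i - beta v i) <= e1) ->
  / INR (S n) / 2 <= supn (S n) y.
Proof.
  intros Hv H. pose proof (sphere_supn n _ (Hmap v Hv)) as [H1 _].
  pose proof (supn_sdist (S n) (beta v) y) as H2. pose proof Sn_inv.
  assert (sdist (S n) (beta v) y <= e1).
  { apply sdist_le; [lra|]. intros i Hi. rewrite Rabs_minus_sym. auto. }
  lra.
Qed.

(** Replacing y by [beta] changes the projection by at most 2 e1 <= es/2, so the slid point lies in
    the fibre. There the height of [beta] exceeds [e1], so y has the same sign of height. *)
Lemma side_of_height x y : sphere k x ->
  (forall i, (i < S n)%nat -> Rabs (y i - beta (radial (S k) (slide k r lam 1 x)) i) <= e1) ->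
  supn n (obl n s y) <= es / 2 -> y n <> 0 /\ (0 < y n -> 0 < x k) /\ (y n < 0 -> x k < 0).
Proof.
  intros Hx Hy Ho. set (v := radial (S k) (slide k r lam 1 x)) in *.
  assert (Hv : sphere k v) by (apply radial_sphere_pos; pose proof (Hslide x 1 Hx); lra).
  assert (Hf : fiber n k beta s es v).
  { split; [easy|]. pose proof (supn_sdist n (obl n s (beta v)) (obl n s y)) as H1.
    pose proof (obl_sdist n s (beta v) y (fun i _ => Hs i)) as H2.
    assert (sdist (S n) (beta v) y <= e1) by (apply sdist_le; [lra|]; intros; rewrite Rabs_minus_sym; auto). lra. }
  destruct (Hpush x Hx Hf) as [Hp Hm]. fold v in Hp, Hm. pose proof Sn_inv.
  assert (Hb : / INR (S n) / 2 <= Rabs (beta v n)).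
  { apply (obl_last n s (beta v) (/ INR (S n)) es); auto; [apply (sphere_supn n); auto|lra|apply Hf]. }
  specialize (Hy n ltac:(lia)). apply Rabs_le_between in Hy.
  destruct (Rle_dec 0 (beta v n)) as [h|h]; [rewrite Rabs_pos_eq in Hb by easy|rewrite Rabs_left in Hb by lra];
    repeat split; intros; try lra; auto; first [apply Hp; lra | apply Hm; lra].
Qed.

Lemma zeta_spec M z : d0 <= norm (S k) z -> sq (S k) z <= 1 ->
  sphere k (eu z) /\ zeta z = (fun i => nmax (S k) (/ 2) z * radial (S k) (Wv z) i) /\
  / 4 <= sq (S k) (zeta z) <= 1 /\ sphere k (radial (S k) (Wv z)) /\
  forall i, (i < S n)%nat -> Rabs (f M (zeta z) i - beta (radial (S k) (Wv z)) i) <= e1.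
Proof.
  intros Hz Hz1. assert (He : sphere k (eu z)) by (rewrite eu_radial by easy; apply radial_sphere_pos; lra).
  pose proof (Hslide (eu z) (phase (4 / 16) z) He) as Hw. fold (Wv z) in Hw.
  assert (HR : / 2 <= nmax (S k) (/ 2) z <= 1).
  { split; [apply nmax_ge; lra|]. destruct (Rle_dec (/ 2) (norm (S k) z)).
    - rewrite nmax_eq by lra. now apply norm_le_1.
    - rewrite nmax_eq_d; lra. }
  assert (Hzeta : zeta z = (fun i => nmax (S k) (/ 2) z * radial (S k) (Wv z) i)).
  { unfold zeta, radial. now rewrite (nmax_eq _ d2) by lra. }
  assert (Hsp : sphere k (radial (S k) (Wv z))) by (apply radial_sphere_pos; lra).
  assert (Hsq : / 4 <= sq (S k) (zeta z) <= 1).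
  { rewrite Hzeta, sq_scal. apply norm_1_sq in Hsp. rewrite Hsp. nra. }
  split; [easy|]. split; [easy|]. split; [easy|]. split; [easy|]. intros i Hi.
  pose proof (Hfnear M (zeta z) i Hsq Hi) as Hn.
  replace (beta (radial (S k) (Wv z)) i) with (beta (radial (S k) (zeta z)) i); [easy|].
  apply beta_ext; auto; [now apply radial_sphere|]. intros j Hj. rewrite Hzeta, radial_scal.
  - now apply radial_of_sphere.
  - lra.
  - unfold sphere in Hsp. rewrite Hsp. lra.
Qed.

Lemma zeta_outer z i : / 4 <= sq (S k) z <= 1 -> zeta z i = z i.
Proof.
  intros Hz. pose proof (norm_half (S k) z ltac:(lra)) as Hn. pose proof rho_le.
  assert (Hd : d0 <= norm (S k) z) by lra.
  destruct (zeta_spec O z Hd ltac:(lra)) as [He [-> _]]. rewrite nmax_eq by lra.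
  assert (HW : Wv z = eu z).
  { apply FunctionalExtensionality.functional_extensionality. intros j. unfold Wv, slide. rewrite phase_0 by lra. ring. }
  rewrite HW. unfold radial at 1. unfold sphere in He. rewrite He, eu_radial by easy. unfold radial. field. lra.
Qed.

Lemma Amap_outer M z i : / 4 <= sq (S k) z <= 1 -> (i < S n)%nat -> Amap M z i = f M z i.
Proof.
  intros Hz Hi.
  assert (E : forall j, (j < S n)%nat -> f M (zeta z) j = f M z j).
  { intros j Hj. apply (ps_dep (S k) (fun z => f M z j)); [now apply Hfps|]. intros l _. now apply zeta_outer. }
  unfold Amap. rewrite !phase_0 by lra. destruct (Nat.eqb_spec i n) as [->|Hne]; rewrite !E by lia; ring.
Qed.

Lemma norm_of_supn z d : d <= supn (S k) z -> d <= norm (S k) z.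
Proof. intros H. pose proof (supn_le_norm (S k) z). lra. Qed.

Lemma Amap_inner M z i : sq (S k) z <= 1 / 16 -> Amap M z i = patF k n gmap (fun j => / rho * z j) i.
Proof.
  intros Hz. unfold Amap, patF. rewrite !phase_1 by lra. destruct (Nat.eqb_spec i n) as [->|Hne]; ring.
Qed.

Lemma Amap_stat0 M z i : sq (S k) z <= 9 / 16 -> (i < S n)%nat -> Amap M z i = Amap O z i.
Proof.
  intros Hz Hi. destruct (Rle_dec (sq (S k) z) (1 / 16)) as [h|h]; [now rewrite !Amap_inner|].
  assert (Hd : d0 <= norm (S k) z).
  { pose proof rho_le. pose proof (norm_sq (S k) z). pose proof (norm_nonneg (S k) z).
    destruct (Rle_dec d0 (norm (S k) z)); [easy|exfalso]. nra. }
  destruct (zeta_spec M z Hd ltac:(lra)) as [_ [Hze [Hsq [Hsp _]]]].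
  assert (E : forall j, (j < S n)%nat -> f M (zeta z) j = f O (zeta z) j).
  { intros j Hj. apply Hfstat0; [|easy]. split; [easy|]. rewrite Hze, sq_scal.
    apply norm_1_sq in Hsp. rewrite Hsp, Rmult_1_r.
    destruct (Rle_dec (/ 2) (norm (S k) z)).
    - rewrite nmax_eq by lra. simpl. rewrite Rmult_1_r, norm_sq. lra.
    - rewrite nmax_eq_d by lra. lra. }
  unfold Amap. destruct (Nat.eqb_spec i n) as [->|Hne]; rewrite !E by lia; easy.
Qed.

Lemma emb_lt x i : (i < k)%nat -> emb x i = x i.
Proof. intros H. unfold emb. now rewrite (eqb_ne i k) by lia. Qed.

Lemma emb_last x : emb x k = 0.
Proof. unfold emb. now rewrite Nat.eqb_refl. Qed.

Lemma norm_emb x d : d <= supn k x -> d <= norm (S k) (emb x).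
Proof.
  intros H. apply norm_of_supn. eapply Rle_trans; [exact H|]. apply supn_le; [apply supn_nonneg|]. intros i Hi.
  rewrite <- (emb_lt x i Hi). apply supn_ge; lia.
Qed.

(** Otherwise [side_of_height] would put an equatorial point strictly above or below the equator. *)
Lemma equat_lower x : d0 <= supn k x -> es / 2 <= supn n (equat x).
Proof.
  intros Hx. apply norm_emb in Hx.
  assert (He : sphere k (eu (emb x))) by (rewrite eu_radial by easy; apply radial_sphere_pos; lra).
  pose proof (Hslide _ 1 He) as Hw. fold (W1 x) in Hw.
  assert (Hsp : sphere k (radial (S k) (W1 x))) by (apply radial_sphere_pos; lra).
  assert (Hz1 : zeta1 x = (fun i => / 2 * radial (S k) (W1 x) i)).
  { unfold zeta1, radial. now rewrite nmax_eq by lra. }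
  assert (Hsq : sq (S k) (zeta1 x) = / 4).
  { rewrite Hz1, sq_scal. apply norm_1_sq in Hsp. rewrite Hsp. field. }
  destruct (Rle_dec (es / 2) (supn n (equat x))) as [h|h]; [easy|exfalso].
  destruct (side_of_height (eu (emb x)) (f O (zeta1 x)) He) as [Hne [Hp Hm]].
  - intros i Hi. pose proof (Hfnear O (zeta1 x) i ltac:(lra) Hi) as Hn. fold (W1 x).
    replace (beta (radial (S k) (W1 x)) i) with (beta (radial (S k) (zeta1 x)) i); [easy|].
    apply beta_ext; auto; [apply radial_sphere; lra|]. intros j Hj. rewrite Hz1, radial_scal.
    + now apply radial_of_sphere.
    + lra.
    + unfold sphere in Hsp. rewrite Hsp. lra.
  - change (supn n (equat x) <= es / 2). lra.
  - assert (Hk0 : eu (emb x) k = 0) by (unfold eu; rewrite emb_last; ring). rewrite Hk0 in *.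
    destruct (Rtotal_order (f O (zeta1 x) n) 0) as [h'|[h'|h']]; [apply Hm in h'|easy|apply Hp in h']; lra.
Qed.

Lemma gmap_le x : supn n (gmap x) <= 1.
Proof. apply supn_le; [lra|]. intros i _. apply Rabs_le, clamp_range. lra. Qed.

Lemma gmap_bd x : d0 <= 1 -> 1 <= supn k x -> supn n (gmap x) = 1.
Proof.
  intros Hd Hx. pose proof (equat_lower x ltac:(lra)) as He.
  change (supn n (clampv (fun i => 2 / es * equat x i)) = 1). apply clampv_bd.
  rewrite supn_scal, Rabs_pos_eq by (left; apply Rdiv_lt_0_compat; lra).
  apply (Rmult_le_compat_l (2 / es)) in He; [|left; apply Rdiv_lt_0_compat; lra].
  replace (2 / es * (es / 2)) with 1 in He by (field; lra). easy.
Qed.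

Lemma gmap_nz x : d0 <= supn k x -> exists i, (i < n)%nat /\ gmap x i <> 0.
Proof.
  intros Hx. pose proof (equat_lower x Hx) as He. destruct (supn_pos_ex n (equat x)) as [i [Hi Hne]]; [lra|].
  exists i. split; [easy|]. apply clamp_nz; [apply Rdiv_lt_0_compat; lra|easy].
Qed.

(** On the equator z and its rescaled embedding have the same direction, and for |z|^2 <= 3/16 the
    slide is complete and the radius is frozen at 1/2. *)
Lemma equat_eq z i : d0 <= norm (S k) z -> sq (S k) z <= 3 / 16 -> z k = 0 -> (i < n)%nat ->
  equat (fun j => / rho * z j) i = obl n s (f O (zeta z)) i.
Proof.
  intros Hz Hz1 Hk Hi. pose proof rho_le.
  assert (Hrho1 : 1 <= / rho) by (rewrite <- Rinv_1; apply Rinv_le_contravar; lra).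
  assert (Hex : forall j, (j < S k)%nat -> emb (fun j => / rho * z j) j = / rho * z j).
  { intros j Hj. destruct (Nat.eq_dec j k) as [->|Hne]; [rewrite emb_last, Hk; ring|apply emb_lt; lia]. }
  assert (Hn : norm (S k) (emb (fun j => / rho * z j)) = / rho * norm (S k) z).
  { rewrite (norm_ext _ _ _ Hex), norm_scal, Rabs_pos_eq by lra. easy. }
  pose proof (norm_nonneg (S k) z) as Hnn.
  assert (Heu : forall j, (j < S k)%nat -> eu (emb (fun j => / rho * z j)) j = eu z j).
  { intros j Hj. rewrite !eu_radial by (try rewrite Hn; nra). unfold radial. rewrite Hn, Hex by easy. field. lra. }
  assert (HW : forall j, (j < S k)%nat -> W1 (fun j => / rho * z j) j = Wv z j).
  { intros j Hj. unfold W1, Wv, slide. rewrite phase_1 by lra. rewrite Heu by easy.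
    now rewrite (ps_dep (S k) lam _ (eu z) Hlam Heu). }
  assert (Hnz : nmax (S k) (/ 2) z = / 2).
  { apply nmax_eq_d; [lra|]. destruct (Rle_dec (norm (S k) z) (/ 2)); [easy|exfalso].
    pose proof (norm_sq (S k) z). nra. }
  assert (Hze : forall j, (j < S k)%nat -> zeta1 (fun j => / rho * z j) j = zeta z j).
  { intros j Hj. unfold zeta1, zeta. rewrite HW, Hnz by easy. unfold nmax. now rewrite (sq_ext _ _ _ HW). }
  assert (E : forall j, (j < S n)%nat -> f O (zeta1 (fun j => / rho * z j)) j = f O (zeta z) j).
  { intros j Hj. apply (ps_dep (S k) (fun z => f O z j)); auto. }
  unfold equat, obl. rewrite !E by lia. easy.
Qed.

(** A zero is excluded in each phase. While the image is sheared, the height vanishes, so the shear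
    disappears and all of y vanishes. While the height is exchanged, the projection vanishes, so y n
    and z k have the same strict sign. In the last phase z k = 0, and the projection and its clamp
    have the same sign, so the projection vanishes and an equatorial point would lie in the
    fibre. *)
Lemma Amap_nz z : d0 <= norm (S k) z -> sq (S k) z <= 9 / 16 -> 0 < supn (S n) (Amap O z).
Proof.
  intros Hz Hz1. destruct (zeta_spec O z Hz ltac:(lra)) as [He [Hze [Hsq [Hsp Hnear]]]].
  set (y := f O (zeta z)) in *. set (V := radial (S k) (Wv z)) in *.
  pose proof (near_beta_nz y V Hsp Hnear) as Hy. pose proof Sn_inv.
  apply NNPP. intros Hno.
  assert (HA : forall i, (i < S n)%nat -> Amap O z i = 0).
  { intros i Hi. apply NNPP. intros Hne. apply Hno. now apply (supn_pos _ _ i). }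
  assert (HAn := HA n ltac:(lia)). unfold Amap in HAn. rewrite Nat.eqb_refl in HAn. fold y in HAn.
  assert (HAi : forall i, (i < n)%nat -> (1 - phase (2 / 16) z) * (y i - phase (4 / 16) z * y n * s i)
       + phase (2 / 16) z * gmap (fun j => / rho * z j) i = 0).
  { intros i Hi. specialize (HA i ltac:(lia)). unfold Amap in HA.
    now rewrite (eqb_ne i n) in HA by lia. }
  destruct (Rle_dec (3 / 16) (sq (S k) z)) as [h|h].
  - rewrite (phase_0 (3 / 16)) in HAn by lra. rewrite (phase_0 (2 / 16)) in HAi by lra.
    assert (Hyn : y n = 0) by lra.
    destruct (supn_pos_ex (S n) y) as [i [Hi Hne]]; [lra|]. apply Hne.
    destruct (Nat.eq_dec i n) as [->|Hin]; [easy|]. specialize (HAi i ltac:(lia)). rewrite Hyn in HAi. lra.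
  - assert (Hph : phase (4 / 16) z = 1) by (apply phase_1; lra).
    assert (HWs : Wv z = slide k r lam 1 (eu z)) by (unfold Wv; now rewrite Hph).
    assert (Hside : supn n (obl n s y) <= es / 2 -> y n <> 0 /\ (0 < y n -> 0 < eu z k) /\ (y n < 0 -> eu z k < 0)).
    { apply side_of_height; [easy|]. rewrite <- HWs. exact Hnear. }
    rewrite Hph in HAi.
    assert (Hzk : z k = norm (S k) z * eu z k) by (rewrite eu_radial by easy; unfold radial; field; lra).
    assert (Hir : 0 < / rho) by now apply Rinv_0_lt_compat.
    destruct (Rle_dec (2 / 16) (sq (S k) z)) as [h2|h2].
    + rewrite (phase_0 (2 / 16)) in HAi by lra.
      assert (Ho : supn n (obl n s y) <= es / 2).
      { apply supn_le; [lra|]. intros i Hi. specialize (HAi i Hi). unfold obl.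
        replace (y i - y n * s i) with 0 by lra. rewrite Rabs_R0. lra. }
      destruct (Hside Ho) as [Hyn [Hp Hm]]. pose proof (phase_range (3 / 16) z) as Hpr.
      destruct (Rtotal_order (y n) 0) as [g|[g|g]]; [|easy|].
      * specialize (Hm g). assert (z k < 0) by (rewrite Hzk; nra).
        pose proof (mix_pos (phase (3 / 16) z) (- y n) (/ rho * - z k) Hpr ltac:(lra)
          ltac:(apply Rmult_lt_0_compat; lra)). lra.
      * specialize (Hp g). assert (0 < z k) by (rewrite Hzk; nra).
        pose proof (mix_pos (phase (3 / 16) z) (y n) (/ rho * z k) Hpr g
          ltac:(apply Rmult_lt_0_compat; lra)). lra.
    + rewrite (phase_1 (3 / 16)) in HAn by lra.
      assert (Hk0 : z k = 0).
      { assert (E : / rho * z k = 0) by lra. destruct (Rmult_integral _ _ E); lra. }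
      assert (Heq0 : forall i, (i < n)%nat -> obl n s y i = 0).
      { intros i Hi. specialize (HAi i Hi). unfold gmap in HAi. rewrite equat_eq in HAi by (auto; lra). fold y in HAi.
        apply (clamp_mult_sign (2 / es) (obl n s y i) (phase (2 / 16) z)); [apply Rdiv_lt_0_compat; lra|apply phase_range|].
        rewrite <- HAi. unfold obl. ring. }
      assert (Ho : supn n (obl n s y) <= es / 2).
      { apply supn_le; [lra|]. intros i Hi. rewrite Heq0, Rabs_R0 by easy. lra. }
      destruct (Hside Ho) as [Hyn [Hp Hm]].
      assert (Hek : eu z k = 0).
      { rewrite Hk0 in Hzk. symmetry in Hzk. destruct (Rmult_integral _ _ Hzk); lra. }
      rewrite Hek in *. destruct (Rtotal_order (y n) 0) as [g|[g|g]]; [apply Hm in g|easy|apply Hp in g]; lra.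
Qed.

(** For |z|^2 <= 9/16 all stages coincide with stage 0, to which compactness applies; beyond that
    the value is close to the unit vector [beta]. *)
Lemma Amap_lower : exists d, 0 < d /\ forall M z, rho <= supn (S k) z -> sq (S k) z <= 1 -> d <= norm (S n) (Amap M z).
Proof.
  destruct (ps_pos_lower_bound (S k) (fun z => supn (S n) (Amap O z))
    (fun z => Rmin (supn (S k) z - rho) (9 / 16 - sq (S k) z)) 1) as [d [Hd H]]; [lra| | | |].
  - apply (ps_supn (S k) (S n) (Amap O)). apply Amap_ps.
  - apply ps_min.
    + apply ps_sub; [|apply ps_const]. apply (ps_supn (S k) (S k) (fun z => z)). apply coord_ps.
    + apply ps_sub; [apply ps_const|]. apply (ps_vsum (S k) (S k) (fun i x => x i ^ 2)).
      intros i Hi. apply (ps_ext _ (fun x => x i * x i)); [intros; ring|]. apply ps_mul; now apply ps_coord.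
  - intros z _ Hz. pose proof (Rmin_l (supn (S k) z - rho) (9 / 16 - sq (S k) z)).
    pose proof (Rmin_r (supn (S k) z - rho) (9 / 16 - sq (S k) z)).
    apply Amap_nz; [|lra]. apply norm_of_supn. lra.
  - pose proof Sn_inv. exists (Rmin d (/ INR (S n) / 2)). split; [apply Rmin_pos; lra|]. intros M z Hz Hz1.
    eapply Rle_trans; [|apply supn_le_norm]. destruct (Rle_dec (sq (S k) z) (9 / 16)) as [h|h].
    + rewrite (supn_ext _ _ (Amap O z)) by (intros; now apply Amap_stat0).
      eapply Rle_trans; [apply Rmin_l|]. apply H.
      * apply supn_le; [lra|]. intros i Hi. now apply (coord_le_1 (S k)).
      * apply Rmin_glb; lra.
    + eapply Rle_trans; [apply Rmin_r|]. apply near_beta_nz with (radial (S k) z).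
      * apply radial_sphere. lra.
      * intros i Hi. rewrite Amap_outer by (easy || lra). apply Hfnear; [lra|easy].
Qed.

End annulus.

(** * The extension *)

Definition lims (u : nat -> R) : R := real (LimSup_seq u).

Lemma lims_spec u B : (forall M, Rabs (u M) <= B) -> is_LimSup_seq u (Finite (lims u)).
Proof.
  intros HB. destruct (ex_LimSup_seq u) as [l Hl]. unfold lims. rewrite (is_LimSup_seq_unique u l Hl).
  destruct l as [l| |]; [easy|exfalso|exfalso].
  - destruct (Hl B O) as [N [_ HN]]. specialize (HB N). apply Rabs_le_between in HB. lra.
  - destruct (Hl (- B)) as [N HN]. specialize (HN N (Nat.le_refl _)). specialize (HB N). apply Rabs_le_between in HB. lra.
Qed.

Lemma lims_le u v B c N0 : (forall M, Rabs (u M) <= B) -> (forall M, Rabs (v M) <= B) ->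
  (forall M, (N0 <= M)%nat -> u M <= v M + c) -> lims u <= lims v + c.
Proof.
  intros Hu Hv H. apply lims_spec in Hu, Hv. apply Rnot_lt_le. intros Hlt.
  assert (He : 0 < (lims u - lims v - c) / 2) by lra.
  destruct (Hv (mkposreal _ He)) as [_ [N HN]]. destruct (Hu (mkposreal _ He)) as [H1 _].
  destruct (H1 (Nat.max N N0)) as [p [Hp Hup]]. simpl in *.
  specialize (HN p ltac:(lia)). specialize (H p ltac:(lia)). lra.
Qed.

Lemma lims_near u v B c N0 : (forall M, Rabs (u M) <= B) -> (forall M, Rabs (v M) <= B) ->
  (forall M, (N0 <= M)%nat -> Rabs (u M - v M) <= c) -> Rabs (lims u - lims v) <= c.
Proof.
  intros Hu Hv H. apply Rabs_le.
  assert (lims u <= lims v + c).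
  { apply (lims_le u v B c N0 Hu Hv). intros M HM. specialize (H M HM). apply Rabs_le_between in H. lra. }
  assert (lims v <= lims u + c).
  { apply (lims_le v u B c N0 Hv Hu). intros M HM. specialize (H M HM). apply Rabs_le_between in H. lra. }
  lra.
Qed.

Lemma lims_const c : lims (fun _ => c) = c.
Proof. unfold lims. now rewrite LimSup_seq_const. Qed.

Lemma lims_eventually u B c N0 : (forall M, Rabs (u M) <= B) -> (forall M, (N0 <= M)%nat -> u M = c) -> lims u = c.
Proof.
  intros HB H. assert (Hc : Rabs c <= B) by (rewrite <- (H N0 (Nat.le_refl _)); apply HB).
  assert (E : Rabs (lims u - lims (fun _ => c)) <= 0).
  { apply (lims_near u (fun _ => c) B 0 N0); auto. intros M HM. rewrite H, Rminus_diag, Rabs_R0 by easy. lra. }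
  rewrite lims_const in E. pose proof (Rle_abs (lims u - c)). pose proof (Rle_abs (- (lims u - c))).
  rewrite Rabs_Ropp in *. lra.
Qed.

Lemma sq_continuous m x t : sq m x < t -> exists d, 0 < d /\ forall y, sdist m y x < d -> sq m y < t.
Proof.
  intros H. set (B := supn m x + 1). pose proof (supn_nonneg m x) as Hn. pose proof (pos_INR m) as Hm.
  set (C := INR m * (2 * B)). assert (HC : 0 <= C) by (unfold C, B; nra).
  exists (Rmin 1 ((t - sq m x) / (C + 1))). split; [apply Rmin_pos; [lra|apply Rdiv_lt_0_compat; lra]|].
  intros y Hy. assert (Hy1 : sdist m y x < 1) by (eapply Rlt_le_trans; [exact Hy|apply Rmin_l]).
  assert (Hy2 : sdist m y x < (t - sq m x) / (C + 1)) by (eapply Rlt_le_trans; [exact Hy|apply Rmin_r]).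
  pose proof (supn_sdist m y x) as Hs.
  assert (Hl : Rabs (sq m y - sq m x) <= C * sdist m y x).
  { apply sq_lip; intros i Hi.
    - eapply Rle_trans; [apply (supn_ge m y i Hi)|unfold B; lra].
    - eapply Rle_trans; [apply (supn_ge m x i Hi)|unfold B; lra]. }
  apply (Rmult_lt_compat_l (C + 1)) in Hy2; [|lra].
  replace ((C + 1) * ((t - sq m x) / (C + 1))) with (t - sq m x) in Hy2 by (field; lra).
  pose proof (sdist_nonneg m y x). apply Rabs_le_between in Hl. nra.
Qed.

Lemma sq_lt_1 m x : norm m x < 1 -> sq m x < 1.
Proof. intros H. rewrite <- norm_sq. pose proof (norm_nonneg m x). nra. Qed.

Lemma sq_le_1 m x : norm m x <= 1 -> sq m x <= 1.
Proof. intros H. rewrite <- norm_sq. pose proof (norm_nonneg m x). nra. Qed.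

(* The limit superior, rather than the limit, dispenses with proving convergence on the exceptional Cantor set. *)
Lemma limit_map n k (v : nat -> vec -> vec) (beta : vec -> vec) Lv (K : vec -> Prop) : 0 <= Lv ->
  (forall M i, (i < S n)%nat -> PS (S k) (fun x => v M x i)) ->
  (forall M x i, (i < S n)%nat -> Rabs (v M x i) <= 1) ->
  (forall M x y i, sq (S k) x <= 1 -> sq (S k) y <= 1 -> (i < S n)%nat -> Rabs (v M x i - v M y i) <= Lv * sdist (S k) x y) ->
  (forall z i, sphere k z -> (i < S n)%nat -> Rabs (beta z i) <= 1) ->
  (forall z i d, sphere k z -> (i < S n)%nat -> 0 < d -> exists M1, forall M, (M1 <= M)%nat -> Rabs (v M z i - beta z i) <= d) ->
  null_set (S k) K ->
  (forall x, sq (S k) x < 1 -> ~ K x -> exists M rho, 0 < rho /\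
     (forall y, sdist (S k) y x < rho -> forall p, (M <= p)%nat -> forall i, (i < S n)%nat -> v p y i = v M y i) /\
     forall Mx, (forall i, (i < S n)%nat -> hasd (S k) (fun y => v M y i) x (Mx i)) -> rank_le (S k) (S n) Mx n) ->
  exists F : vec -> vec,
    lipschitz_on (S k) (S n) (ball (S k)) F /\
    (forall x, sphere k x -> forall i, (i < S n)%nat -> F x i = beta x i) /\
    exists N : vec -> Prop, null_set (S k) N /\
      forall x, norm (S k) x < 1 -> ~ N x ->
        exists M : mat, has_derivative (S k) (S n) F x M /\ rank_le (S k) (S n) M n.
Proof.
  intros HLv Hps Hbd Hlip Hbb Hbeta HK Hstat.
  set (F := fun x i => if (i <? S n)%nat then lims (fun M => v M x i) else 0).
  assert (HF : forall x i, (i < S n)%nat -> F x i = lims (fun M => v M x i)).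
  { intros x i Hi. unfold F. apply Nat.ltb_lt in Hi. now rewrite Hi. }
  exists F. split; [|split].
  - exists (INR (S n) * Lv). intros x y Hx Hy.
    eapply Rle_trans; [apply dist_sdist|]. rewrite Rmult_assoc. apply Rmult_le_compat_l; [apply pos_INR|].
    apply Rle_trans with (Lv * sdist (S k) x y); [|apply Rmult_le_compat_l; [easy|apply sdist_dist]].
    apply sdist_le; [apply Rmult_le_pos; [easy|apply sdist_nonneg]|]. intros i Hi. rewrite !HF by easy.
    apply (lims_near _ _ 1 _ O); auto. intros M _. apply Hlip; auto; now apply sq_le_1.
  - intros x Hx i Hi. rewrite HF by easy.
    destruct (Req_dec (lims (fun M => v M x i)) (beta x i)) as [h|h]; [easy|exfalso].
    assert (Hd : 0 < Rabs (lims (fun M => v M x i) - beta x i) / 2).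
    { assert (0 < Rabs (lims (fun M => v M x i) - beta x i)) by (apply Rabs_pos_lt; lra). lra. }
    destruct (Hbeta x i _ Hx Hi Hd) as [M1 HM1].
    pose proof (lims_near (fun M => v M x i) (fun _ => beta x i) 1 _ M1 (fun M => Hbd M x i Hi) (fun _ => Hbb x i Hx Hi) HM1) as H.
    rewrite lims_const in H. lra.
  (* The coordinates of all stages form a countable family; the pairing lists it, and one null set
     serves them all. *)
  - assert (HP : forall p, exists N, null_set (S k) N /\ ((snd (Cantor.of_nat p) < S n)%nat -> forall x, supn (S k) x <= 1 -> ~ N x ->
       exists g, hasd (S k) (fun y => v (fst (Cantor.of_nat p)) y (snd (Cantor.of_nat p))) x g)).
    { intros p. destruct (le_lt_dec (S n) (snd (Cantor.of_nat p))) as [h|h].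
      - exists (fun _ => False). split; [apply null_empty; lia|]. intros; lia.
      - destruct (ps_diff (S k) _ ltac:(lia) (Hps (fst (Cantor.of_nat p)) _ h)) as [N [HN H]]. exists N. auto. }
    set (NN := fun p => proj1_sig (constructive_indefinite_description _ (HP p))).
    assert (HNN := fun p => proj2_sig (constructive_indefinite_description _ (HP p))).
    change (forall p, null_set (S k) (NN p) /\ ((snd (Cantor.of_nat p) < S n)%nat -> forall x, supn (S k) x <= 1 -> ~ NN p x ->
       exists g, hasd (S k) (fun y => v (fst (Cantor.of_nat p)) y (snd (Cantor.of_nat p))) x g)) in HNN.
    clearbody NN.
    exists (fun x => K x \/ exists p, NN p x). split.
    { apply null_or; [easy|]. apply null_union. intros p. apply HNN. }
    intros x Hx HN. pose proof (sq_lt_1 _ _ Hx) as Hsq.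
    destruct (Hstat x Hsq) as [M [rho [Hrho [Hst Hrank]]]]; [tauto|].
    assert (Hg : forall i, exists g, (i < S n)%nat -> hasd (S k) (fun y => v M y i) x g).
    { intros i. destruct (le_lt_dec (S n) i) as [h|h]; [exists (fun _ => 0); lia|].
      destruct (HNN (Cantor.to_nat (M, i))) as [_ H]. rewrite Cantor.cancel_of_to in H. simpl fst in H; simpl snd in H.
      destruct (H h x) as [g Hg].
      - pose proof (supn_le_norm (S k) x). lra.
      - intros h'. apply HN. right. eauto.
      - now exists g. }
    set (Mx := fun i => proj1_sig (constructive_indefinite_description _ (Hg i))).
    assert (HMx : forall i, (i < S n)%nat -> hasd (S k) (fun y => v M y i) x (Mx i)).
    { intros i. apply (proj2_sig (constructive_indefinite_description _ (Hg i))). }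
    clearbody Mx. exists Mx. split; [|now apply Hrank].
    apply has_derivative_intro. intros i Hi. apply (hasd_local _ (fun y => v M y i) _ _ _ rho Hrho); [|now apply HMx].
    intros y Hy. rewrite HF by easy. symmetry. apply (lims_eventually _ 1 _ M).
    + intros p. now apply Hbd.
    + intros p Hp. now apply Hst.
Qed.

(** From the two defining powers, (lam mu)^((n+1)(k+1)) = 2^(n-k) and 2 lam^(k+1) = lam^(k-n). So
    the holes fit and the Cantor set is null for the same reason, n < k. *)
Lemma scaling_factors n k : (n < k)%nat -> exists lam mu, 0 < lam < 1 /\ 1 <= mu /\ lam ^ S n = / 2 /\ mu ^ S k = 2 /\
  lam * mu < 1 /\ 2 * lam ^ S k < 1.
Proof.
  intros Hnk.
  assert (Hn : 0 < INR (S n)) by (apply lt_0_INR; lia). assert (Hk : 0 < INR (S k)) by (apply lt_0_INR; lia).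
  assert (Hroot : forall a p, 0 < a -> (0 < p)%nat -> exists b, 0 < b /\ b ^ p = a).
  { intros a p Ha Hp. exists (Rpower a (/ INR p)). assert (0 < INR p) by (apply lt_0_INR; lia). split.
    - unfold Rpower. apply exp_pos.
    - rewrite <- Rpower_pow by (unfold Rpower; apply exp_pos). rewrite Rpower_mult, Rinv_l, Rpower_1; lra. }
  destruct (Hroot (/ 2) (S n)) as [lam [Hl Hln]]; [lra|lia|].
  destruct (Hroot 2 (S k)) as [mu [Hm Hmk]]; [lra|lia|].
  assert (Hge1 : forall a p, 1 <= a -> 1 <= a ^ p) by (intros; now apply pow_R1_Rle).
  assert (Hlt1 : forall a p, 0 < a -> a < 1 -> a ^ p <= 1).
  { intros a p H1 H2. rewrite <- (pow1 p). apply pow_incr. lra. }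
  assert (Hl1 : lam < 1).
  { destruct (Rlt_dec lam 1); [easy|]. specialize (Hge1 lam (S n)). lra. }
  assert (Hm1 : 1 <= mu).
  { destruct (Rlt_dec mu 1); [|lra]. specialize (Hlt1 mu (S k)). lra. }
  exists lam, mu. repeat split; auto.
  - destruct (Rlt_dec (lam * mu) 1) as [h|h]; [easy|exfalso].
    pose proof (Hge1 (lam * mu) (S n * S k)%nat ltac:(lra)) as H.
    rewrite Rpow_mult_distr, pow_mult, Hln, (Nat.mul_comm (S n) (S k)), (pow_mult mu), Hmk in H.
    replace (S k) with (k - n + S n)%nat in H by lia. rewrite pow_add, Rmult_assoc, <- Rpow_mult_distr in H.
    replace (/ 2 * 2) with 1 in H by field. rewrite pow1 in H.
    replace (k - n)%nat with (S (k - n - 1)) in H by lia. simpl in H. pose proof (half_pow (k - n - 1)). lra.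
  - replace (S k) with (S n + S (k - n - 1))%nat by lia. rewrite pow_add, Hln. simpl.
    specialize (Hlt1 lam (k - n - 1)%nat Hl Hl1). pose proof (pow_lt lam (k - n - 1) Hl). nra.
Qed.

Record annulus_ok (n k : nat) (beta g : vec -> vec) (c0 rho delta L1 : R) (A : nat -> vec -> vec) : Prop := {
  an_rho : 0 < rho /\ rho * (4 * INR (S k)) = 1;
  an_delta : 0 < delta <= 1;
  an_L1 : 0 <= L1;
  an_gps : forall i, (i < n)%nat -> PS k (fun x => g x i);
  an_gle : forall x, supn n (g x) <= 1;
  an_gbd : forall x, 1 <= supn k x -> supn n (g x) = 1;
  an_gnz : forall x, c0 <= supn k x -> exists i, (i < n)%nat /\ g x i <> 0;
  an_ps : forall M i, (i < S n)%nat -> PS (S k) (fun z => A M z i);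
  an_inner : forall M z i, sq (S k) z <= 1 / 16 -> A M z i = patF k n g (fun j => / rho * z j) i;
  an_stat0 : forall M z i, sq (S k) z <= 9 / 16 -> (i < S n)%nat -> A M z i = A O z i;
  an_lip : forall M x y i, / 4 <= sq (S k) x <= 1 -> / 4 <= sq (S k) y <= 1 -> (i < S n)%nat ->
    Rabs (A M x i - A M y i) <= L1 * sdist (S k) x y;
  an_stat : forall t, t < 1 -> exists M1, forall M z i, (M1 <= M)%nat -> / 4 <= sq (S k) z <= t -> (i < S n)%nat ->
    A M z i = A M1 z i;
  an_bound : forall M z i, / 4 <= sq (S k) z <= 1 -> (i < S n)%nat -> Rabs (A M z i) <= 2;
  an_limit : forall z i d, sphere k z -> (i < S n)%nat -> 0 < d ->
    exists M1, forall M, (M1 <= M)%nat -> Rabs (A M z i - beta z i) <= d;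
  an_lower : forall M z, rho <= supn (S k) z -> sq (S k) z <= 1 -> delta <= norm (S n) (A M z)
}.

Lemma annulus_exists n k beta L c0 : (n <= k)%nat -> (k + 1 < 2 * n)%nat -> 1 <= L -> 0 < c0 ->
  (forall x, sphere k x -> sphere n (beta x)) ->
  (forall x y, sphere k x -> sphere k y -> sdist (S n) (beta x) (beta y) <= L * sdist (S k) x y) ->
  exists g rho delta L1 A, annulus_ok n k beta g c0 rho delta L1 A.
Proof.
  intros Hnk Hk HL Hc0 Hmap Hlip.
  assert (Hk1 : 1 <= INR (S k)) by (rewrite S_INR; pose proof (pos_INR k); lra).
  pose proof (Sn_inv n) as Hn1.
  destruct (separation n k beta L Hnk Hk HL Hmap Hlip) as [s [r [es [Hes [Hesn [Hs [Hr [Hpole Hsep]]]]]]]].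
  assert (Hes1 : 0 < es < 1) by lra.
  destruct (push n k beta L s r es HL Hmap Hlip Hes1 Hr Hpole Hsep) as [lam [d2 [Hd2 [Hlam [Hslide Hpush]]]]].
  set (e1 := es / 4). assert (He1 : 0 < e1 <= es / 4) by (unfold e1; lra).
  destruct (collar n k beta L e1 HL (proj1 He1) Hmap Hlip) as [f [L1 [HL1 [Hfps [Hflip [Hfnear [Hfsph [Hfstat Hfstat0]]]]]]]].
  set (rho := / (4 * INR (S k))).
  assert (Hrho : 0 < rho) by (apply Rinv_0_lt_compat; lra).
  assert (Hrhok : rho * (4 * INR (S k)) = 1) by (unfold rho; apply Rinv_l; lra).
  assert (Hrho1 : rho <= 1) by nra.
  (* Below [c0], so that [g] has no zeros where the shell homotopy evaluates it at height 0; below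
     [rho], so that normalization is exact outside the inner cube. *)
  set (d0 := Rmin c0 rho). assert (Hd0 : 0 < d0 <= rho) by (split; [apply Rmin_pos; lra|apply Rmin_r]).
  assert (Hd0c : d0 <= c0) by apply Rmin_l.
  destruct (Amap_lower n k beta L Hmap Hlip s r es Hes1 Hesn Hs lam d2 Hd2 Hlam Hslide Hpush e1 He1 f Hfps Hfnear Hfstat0
    d0 rho Hd0 Hrho Hrhok) as [d [Hd Hlow]].
  assert (Hout : forall M z i, / 4 <= sq (S k) z <= 1 -> (i < S n)%nat -> Amap n k s r es lam d2 f d0 rho M z i = f M z i).
  { now apply (Amap_outer n k beta L Hlip s r es Hes1 lam d2 Hd2 Hslide e1 He1 f Hfps Hfnear). }
  exists (gmap n k s r es lam d2 f d0), rho, (Rmin d 1), L1, (Amap n k s r es lam d2 f d0 rho).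
  constructor; auto.
  - split; [apply Rmin_pos; lra|apply Rmin_r].
  - now apply (gmap_ps n k s r es lam d2 Hd2 Hlam f Hfps d0 rho Hd0).
  - intros x. apply gmap_le.
  - intros x Hx. apply (gmap_bd n k beta L Hmap Hlip s r es Hes1 Hesn Hs lam d2 Hd2 Hslide Hpush e1 He1 f Hfnear d0 rho Hd0); lra.
  - intros x Hx. apply (gmap_nz n k beta L Hmap Hlip s r es Hes1 Hesn Hs lam d2 Hd2 Hslide Hpush e1 He1 f Hfnear d0 rho Hd0); lra.
  - now apply (Amap_ps n k s r es lam d2 Hd2 Hlam f Hfps d0 rho Hd0).
  - intros M z i Hz. now apply Amap_inner.
  - intros M z i Hz Hi. now apply (Amap_stat0 n k beta L Hlip s r es Hes1 lam d2 Hd2 Hslide e1 He1 f Hfnear Hfstat0 d0 rho Hd0 Hrho Hrhok).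
  - intros M x y i Hx Hy Hi. rewrite !Hout by easy. now apply Hflip.
  - intros t Ht. destruct (Hfstat t Ht) as [M1 HM1]. exists M1. intros M z i HM Hz Hi. rewrite !Hout by (easy || lra). now apply HM1.
  - intros M z i Hz Hi. rewrite Hout by easy. pose proof (Hfnear M z i Hz Hi) as H.
    pose proof (sphere_le n _ i (Hmap _ (radial_sphere k z (proj1 Hz))) Hi) as H1.
    apply Rabs_le_between in H, H1. apply Rabs_le. lra.
  - intros z i e Hz Hi He. destruct (Hfsph z i e Hz Hi He) as [M1 HM1]. exists M1. intros M HM.
    assert (Hz1 : sq (S k) z = 1) by now apply norm_1_sq. rewrite Hout by (easy || lra). now apply HM1.
  - intros M z Hz Hz1. eapply Rle_trans; [apply Rmin_l|auto].
Qed.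

(** * Gluing the annulus to the self-similar core *)

Lemma eventually_all (m : nat) (P : nat -> nat -> Prop) : (forall i, (i < m)%nat -> exists M1, forall M, (M1 <= M)%nat -> P M i) ->
  exists M1, forall M, (M1 <= M)%nat -> forall i, (i < m)%nat -> P M i.
Proof.
  induction m as [|m IH]; intros H; [exists O; intros; lia|].
  destruct IH as [M1 H1]; [auto|]. destruct (H m) as [M2 H2]; [lia|]. exists (Nat.max M1 M2).
  intros M HM i Hi. destruct (Nat.eq_dec i m) as [->|Hne]; [apply H2; lia|apply H1; lia].
Qed.

Lemma sdist_vadd m (a b a' b' : vec) : sdist m (vadd a b) (vadd a' b') <= sdist m a a' + sdist m b b'.
Proof.
  pose proof (sdist_nonneg m a a'). pose proof (sdist_nonneg m b b'). apply sdist_le; [lra|]. intros i Hi. unfold vadd.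
  replace (a i + b i - (a' i + b' i)) with ((a i - a' i) + (b i - b' i)) by ring.
  eapply Rle_trans; [apply Rabs_triang|]. pose proof (sdist_ge m a a' i Hi). pose proof (sdist_ge m b b' i Hi). lra.
Qed.

Lemma sdist_vsub m (a b a' b' : vec) : sdist m (vsub a b) (vsub a' b') <= sdist m a a' + sdist m b b'.
Proof.
  pose proof (sdist_nonneg m a a'). pose proof (sdist_nonneg m b b'). apply sdist_le; [lra|]. intros i Hi. unfold vsub.
  replace (a i - b i - (a' i - b' i)) with ((a i - a' i) + - (b i - b' i)) by ring.
  eapply Rle_trans; [apply Rabs_triang|]. rewrite Rabs_Ropp.
  pose proof (sdist_ge m a a' i Hi). pose proof (sdist_ge m b b' i Hi). lra.
Qed.

(** Sends |y| >= delta to the unit sphere and is division by [delta] on the smaller ball. *)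
Definition retract (m : nat) (d : R) (y : vec) : vec := fun i => / nmax m d y * y i.

Lemma retract_ps m d i : 0 < d -> (i < m)%nat -> PS m (fun y => retract m d y i).
Proof.
  intros Hd Hi. apply ps_mul; [|now apply ps_coord]. apply (nmax_inv_ps m m d (fun y => y)); [easy|].
  intros; now apply ps_coord.
Qed.

Lemma retract_norm m d y : 0 < d -> norm m (retract m d y) <= 1.
Proof.
  intros Hd. unfold retract. pose proof (nmax_ge m d y ltac:(lra)). pose proof (nmax_ge_norm m d y).
  rewrite norm_scal, Rabs_pos_eq by (left; apply Rinv_0_lt_compat; lra).
  apply (Rmult_le_reg_l (nmax m d y)); [lra|]. rewrite <- Rmult_assoc, Rinv_r, Rmult_1_l, Rmult_1_r by lra. easy.
Qed.

Lemma retract_norm_eq m d y : 0 < d -> d <= norm m y -> norm m (retract m d y) = 1.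
Proof.
  intros Hd Hy. unfold retract. rewrite nmax_eq by lra.
  rewrite norm_scal, Rabs_pos_eq by (left; apply Rinv_0_lt_compat; lra). field. lra.
Qed.

Section assembly.

Context (n k : nat) (beta g : vec -> vec) (c0 rho delta L1 : R) (A : nat -> vec -> vec).
Context (Hmap : forall x, sphere k x -> sphere n (beta x)).
Context (AN : annulus_ok n k beta g c0 rho delta L1 A).
Context (lam mu : R) (Hlam : 0 < lam < 1) (Hmu : 1 <= mu) (Hlamn : lam ^ S n = / 2) (Hmuk : mu ^ S k = 2).
Context (Hlm : lam * mu < 1) (Hlam2 : 2 * lam ^ S k < 1).
Context (G : vec -> vec) (OK : ifs_ok k n (lam * mu) (patF k n g) G).

Let th := lam * mu.
Let F0 := patF k n g.
Let u := uN k n th F0 G.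
Definition scl (z : vec) : vec := fun j => / rho * z j.
(** Outside the inner cube the clamped argument is on the boundary, where u = F0, and only [A]
    remains; inside, [A] equals F0 and the sum is u. A single formula keeps the glued map piecewise
    smooth. *)
Definition wN (M : nat) (z : vec) : vec := vadd (A M z) (vsub (u M (clampv (scl z))) (F0 (clampv (scl z)))).
Definition vN (M : nat) (z : vec) : vec := retract (S n) delta (wN M z).

Lemma rho_pos : 0 < rho.
Proof. apply (an_rho _ _ _ _ _ _ _ _ _ AN). Qed.

Lemma wN_ps M i : (i < S n)%nat -> PS (S k) (fun z => wN M z i).
Proof.
  intros Hi. assert (Hc : forall j, (j < S k)%nat -> PS (S k) (fun z => clampv (scl z) j)).
  { apply (clampv_ps (S k) (S k) scl). intros j Hj. apply ps_scal. now apply ps_coord. }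
  apply ps_add; [now apply (an_ps _ _ _ _ _ _ _ _ _ AN)|]. apply ps_sub.
  - apply (ps_subst (S k) (S k) (fun z => u M z i)); [now apply uN_ps|easy].
  - apply (ps_subst (S k) (S k) (fun z => F0 z i)); [apply (ifs_F _ _ _ _ _ OK); easy|easy].
Qed.

Lemma vN_ps M i : (i < S n)%nat -> PS (S k) (fun z => vN M z i).
Proof.
  intros Hi. apply (ps_subst (S k) (S n) (fun y => retract (S n) delta y i)); [|apply wN_ps].
  apply retract_ps; [apply (an_delta _ _ _ _ _ _ _ _ _ AN)|easy].
Qed.

Lemma supn_scl z : supn (S k) (scl z) = / rho * supn (S k) z.
Proof.
  pose proof rho_pos. unfold scl. rewrite supn_scal, Rabs_pos_eq; [easy|]. left. now apply Rinv_0_lt_compat.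
Qed.

Lemma scl_ge z : rho <= supn (S k) z -> 1 <= supn (S k) (scl z).
Proof.
  intros H. pose proof rho_pos. rewrite supn_scl. apply (Rmult_le_reg_l rho); [easy|].
  rewrite <- Rmult_assoc, Rinv_r by lra. lra.
Qed.

Lemma scl_le z : supn (S k) z <= rho -> supn (S k) (scl z) <= 1.
Proof.
  intros H. pose proof rho_pos. rewrite supn_scl. apply (Rmult_le_reg_l rho); [easy|].
  rewrite <- Rmult_assoc, Rinv_r by lra. lra.
Qed.

Lemma wN_outer M z i : rho <= supn (S k) z -> (i < S n)%nat -> wN M z i = A M z i.
Proof.
  intros Hz Hi. unfold wN, vadd, vsub. apply scl_ge, clampv_bd in Hz.
  unfold u. rewrite uN_bd by easy. unfold F0. ring.
Qed.

Lemma sq_small z : supn (S k) z <= rho -> sq (S k) z <= 1 / 16.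
Proof.
  intros H. destruct (an_rho _ _ _ _ _ _ _ _ _ AN) as [Hr Hrk]. pose proof (Sk_ge1 k).
  eapply Rle_trans; [apply (sq_le (S k) z rho); intros i Hi; eapply Rle_trans; [apply (supn_ge (S k) z i Hi)|easy]|].
  assert (rho <= / 4) by nra. replace (INR (S k) * rho ^ 2) with (rho * (4 * INR (S k)) * rho / 4) by field.
  rewrite Hrk. lra.
Qed.

Lemma supn_large z : / 4 <= sq (S k) z -> rho <= supn (S k) z.
Proof.
  intros H. destruct (Rle_dec rho (supn (S k) z)) as [h|h]; [easy|exfalso].
  pose proof (sq_small z ltac:(lra)). lra.
Qed.

Lemma wN_inner M z i : supn (S k) z <= rho -> (i < S n)%nat -> wN M z i = u M (scl z) i.
Proof.
  intros Hz Hi. unfold wN, vadd, vsub. rewrite (an_inner _ _ _ _ _ _ _ _ _ AN) by (now apply sq_small).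
  pose proof (scl_le z Hz) as Hs.
  assert (E : forall j, (j < S k)%nat -> clampv (scl z) j = scl z j) by (intros; now apply (clampv_id (S k))).
  unfold u. rewrite (uN_ext k n th F0 G M _ (scl z)) by easy.
  assert (EF : F0 (clampv (scl z)) i = F0 (scl z) i).
  { apply (ps_dep (S k) (fun z => F0 z i)); [apply (ifs_F _ _ _ _ _ OK); easy|easy]. }
  rewrite EF. unfold F0, scl. ring.
Qed.

(** The regions |z|^2 <= 9/16, where [A] is the fixed stage 0, and |z|^2 >= 1/4, where [A] has the
    constant [L1], overlap. A pair in neither region is separated by a gap, and boundedness alone
    gives the estimate. *)
Lemma wN_lip_bound : exists Lw Bw, 0 <= Lw /\ 0 <= Bw /\
  (forall M z, sq (S k) z <= 1 -> supn (S n) (wN M z) <= Bw) /\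
  (forall M x y, sq (S k) x <= 1 -> sq (S k) y <= 1 -> sdist (S n) (wN M x) (wN M y) <= Lw * sdist (S k) x y).
Proof.
  destruct (uN_lip k n lam mu F0 G Hlam Hmu Hlamn Hmuk OK) as [Lu [HLu Hu]].
  destruct (psv_lip (S k) (S n) F0 1 ltac:(lra) (ifs_F _ _ _ _ _ OK)) as [LF [HLF HF]].
  destruct (psv_lip (S k) (S n) (A O) 1 ltac:(lra) (an_ps _ _ _ _ _ _ _ _ _ AN O)) as [LA [HLA HA]].
  pose proof rho_pos as Hr. assert (Hri : 0 < / rho) by now apply Rinv_0_lt_compat.
  pose proof (an_L1 _ _ _ _ _ _ _ _ _ AN) as HL1. pose proof (Sk_ge1 k) as Hk1.
  assert (Hball : forall z, sq (S k) z <= 1 -> supn (S k) z <= 1).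
  { intros z Hz. apply supn_le; [lra|]. intros; now apply (coord_le_1 (S k)). }
  set (zero := fun _ : nat => 0 : R).
  set (B := supn (S n) (A O zero) + LA + 2). pose proof (supn_nonneg (S n) (A O zero)) as HB0.
  assert (HwB : forall M z, sq (S k) z <= 1 -> supn (S n) (wN M z) <= B).
  { intros M z Hz. apply supn_le; [unfold B; lra|]. intros i Hi.
    destruct (Rle_dec (sq (S k) z) (9 / 16)) as [h|h].
    - unfold wN, vadd, vsub. rewrite (an_stat0 _ _ _ _ _ _ _ _ _ AN) by easy.
      pose proof (supn_ge (S n) (u M (clampv (scl z))) i Hi) as H1.
      pose proof (uN_le k n th F0 G OK M _ (clampv_le (S k) (scl z))) as H2. fold u in H2.
      pose proof (supn_ge (S n) (F0 (clampv (scl z))) i Hi) as H3.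
      pose proof (ifs_Fle _ _ _ _ _ OK _ (clampv_le (S k) (scl z))) as H4. fold F0 in H4.
      assert (Hz0 : supn (S k) zero <= 1) by (apply supn_le; [lra|]; intros; unfold zero; rewrite Rabs_R0; lra).
      assert (H5 : sdist (S n) (A O z) (A O zero) <= LA).
      { eapply Rle_trans; [apply HA; auto|]. assert (sdist (S k) z zero <= 1); [|nra].
        eapply Rle_trans; [|apply (Hball z Hz)]. apply supn_mono. intros; unfold vsub, zero. rewrite Rminus_0_r. lra. }
      pose proof (supn_sdist (S n) (A O z) (A O zero)) as H6. pose proof (supn_ge (S n) (A O z) i Hi) as H7.
      set (a := A O z i) in *. set (b := u M (clampv (scl z)) i) in *. set (c := F0 (clampv (scl z)) i) in *.
      pose proof (Rabs_triang a (b - c)). pose proof (Rabs_triang b (- c)) as H9. rewrite Rabs_Ropp in H9.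
      unfold Rminus in *. unfold B. lra.
    - rewrite wN_outer by (easy || apply supn_large; lra).
      pose proof (an_bound _ _ _ _ _ _ _ _ _ AN M z i ltac:(lra) Hi). unfold B. lra. }
  assert (HB : 0 <= B) by (unfold B; lra).
  (* The last term is for separated pairs: a difference of at least 5/16 in |z|^2 forces 1 <= 4 (2
     (k+1)) times their distance. *)
  set (Lw := LA + (Lu + LF) * / rho + L1 + 2 * B * (2 * INR (S k) * 4)).
  assert (Ha : 0 <= (Lu + LF) * / rho) by (apply Rmult_le_pos; lra).
  assert (Hb : 0 <= 2 * B * (2 * INR (S k) * 4)) by (apply Rmult_le_pos; lra).
  assert (Hmon : forall c x y, c <= Lw -> forall w, w <= c * sdist (S k) x y -> w <= Lw * sdist (S k) x y).
  { intros c x y Hc w Hw. eapply Rle_trans; [exact Hw|]. apply Rmult_le_compat_r; [apply sdist_nonneg|easy]. }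
  assert (Hfar : forall M x y, sq (S k) x <= 1 / 4 -> 9 / 16 <= sq (S k) y <= 1 ->
    sdist (S n) (wN M x) (wN M y) <= Lw * sdist (S k) x y).
  { intros M x y Hx Hy. apply (Hmon (2 * B * (2 * INR (S k) * 4))); [unfold Lw; lra|].
    pose proof (sq_sdist (S k) x y ltac:(lra) ltac:(lra)) as Hs. rewrite Rabs_left in Hs by lra.
    assert (H1 : 1 <= 2 * INR (S k) * 4 * sdist (S k) x y) by lra.
    apply Rle_trans with (2 * B * 1); [|rewrite (Rmult_assoc (2 * B)); apply Rmult_le_compat_l; lra].
    apply sdist_le; [lra|]. intros i Hi.
    pose proof (supn_ge (S n) (wN M x) i Hi) as H2. pose proof (supn_ge (S n) (wN M y) i Hi) as H3.
    pose proof (HwB M x ltac:(lra)). pose proof (HwB M y ltac:(lra)).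
    pose proof (Rabs_triang (wN M x i) (- wN M y i)) as H6. rewrite Rabs_Ropp in H6. unfold Rminus. lra. }
  exists Lw, B. split; [unfold Lw; lra|]. split; [easy|]. split; [easy|].
  intros M x y Hx Hy.
  destruct (Rle_dec (sq (S k) x) (9 / 16)) as [hx|hx], (Rle_dec (sq (S k) y) (9 / 16)) as [hy|hy].
  - apply (Hmon (LA + (Lu + LF) * / rho)); [unfold Lw; lra|].
    assert (Hc : sdist (S k) (clampv (scl x)) (clampv (scl y)) <= / rho * sdist (S k) x y).
    { apply sdist_le; [apply Rmult_le_pos; [lra|apply sdist_nonneg]|]. intros i Hi.
      eapply Rle_trans; [apply clamp_lip|]. unfold scl. rewrite <- Rmult_minus_distr_l, Rabs_mult, (Rabs_pos_eq (/ rho)) by lra.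
      apply Rmult_le_compat_l; [lra|now apply sdist_ge]. }
    eapply Rle_trans; [apply sdist_vadd|].
    pose proof (sdist_vsub (S n) (u M (clampv (scl x))) (F0 (clampv (scl x))) (u M (clampv (scl y))) (F0 (clampv (scl y)))) as H1.
    pose proof (Hu M _ _ (clampv_le (S k) (scl x)) (clampv_le (S k) (scl y))) as H2. fold th in H2. fold u in H2.
    pose proof (HF _ _ (clampv_le (S k) (scl x)) (clampv_le (S k) (scl y))) as H3.
    assert (H4 : sdist (S n) (A M x) (A M y) <= LA * sdist (S k) x y).
    { assert (E : sdist (S n) (A M x) (A M y) = sdist (S n) (A O x) (A O y)).
      { apply supn_ext. intros i Hi. unfold vsub. now rewrite !(an_stat0 _ _ _ _ _ _ _ _ _ AN M). }
      rewrite E. apply HA; auto. }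
    set (D := sdist (S k) (clampv (scl x)) (clampv (scl y))) in *.
    assert (Lu * D <= Lu * (/ rho * sdist (S k) x y)) by (apply Rmult_le_compat_l; lra).
    assert (LF * D <= LF * (/ rho * sdist (S k) x y)) by (apply Rmult_le_compat_l; lra). lra.
  - destruct (Rle_dec (sq (S k) x) (1 / 4)) as [hx'|hx']; [apply Hfar; lra|].
    apply (Hmon L1); [unfold Lw; lra|]. apply sdist_le; [apply Rmult_le_pos; [easy|apply sdist_nonneg]|]. intros i Hi.
    rewrite !wN_outer by (easy || apply supn_large; lra). apply (an_lip _ _ _ _ _ _ _ _ _ AN); easy || lra.
  - destruct (Rle_dec (sq (S k) y) (1 / 4)) as [hy'|hy'].
    + rewrite (sdist_sym (S n)), (sdist_sym (S k)). apply Hfar; lra.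
    + apply (Hmon L1); [unfold Lw; lra|]. apply sdist_le; [apply Rmult_le_pos; [easy|apply sdist_nonneg]|]. intros i Hi.
      rewrite !wN_outer by (easy || apply supn_large; lra). apply (an_lip _ _ _ _ _ _ _ _ _ AN); easy || lra.
  - apply (Hmon L1); [unfold Lw; lra|]. apply sdist_le; [apply Rmult_le_pos; [easy|apply sdist_nonneg]|]. intros i Hi.
    rewrite !wN_outer by (easy || apply supn_large; lra). apply (an_lip _ _ _ _ _ _ _ _ _ AN); easy || lra.
Qed.

Lemma vN_le M z i : (i < S n)%nat -> Rabs (vN M z i) <= 1.
Proof.
  intros Hi. eapply Rle_trans; [apply (norm_ge (S n) (vN M z) i Hi)|]. apply retract_norm.
  apply (an_delta _ _ _ _ _ _ _ _ _ AN).
Qed.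

Lemma vN_stationary x : sq (S k) x < 1 -> ~ (forall m, deep k th m (scl x)) ->
  exists M r, 0 < r /\
   (forall y, sdist (S k) y x < r -> forall p, (M <= p)%nat -> forall i, (i < S n)%nat -> vN p y i = vN M y i) /\
   forall Mx, (forall i, (i < S n)%nat -> hasd (S k) (fun y => vN M y i) x (Mx i)) -> rank_le (S k) (S n) Mx n.
Proof.
  intros Hx HK. pose proof (ifs_th _ _ _ _ _ OK) as Hth. fold th in Hth. pose proof rho_pos as Hr.
  assert (Hri : 0 < / rho) by now apply Rinv_0_lt_compat.
  pose proof (an_delta _ _ _ _ _ _ _ _ _ AN) as Hdl.
  (* The lemmas on stationarity ask for a positive generation; a point outside generation 0 is also
     outside generation 1. *)
  assert (Hm : exists m, ~ deep k th (S m) (scl x)).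
  { apply not_all_ex_not in HK. destruct HK as [[|m] Hm]; [exists O|now exists m].
    intros Hd. apply Hm. now apply deep_le in Hd. }
  destruct Hm as [m Hm]. destruct (deep_closed k th (S m) (scl x) ltac:(lra) Hm) as [r1 [Hr1 Hdeep]].
  set (t := (1 + sq (S k) x) / 2).
  destruct (an_stat _ _ _ _ _ _ _ _ _ AN t ltac:(unfold t; lra)) as [M1 HM1].
  destruct (sq_continuous (S k) x t ltac:(unfold t; lra)) as [r2 [Hr2 Hsq]].
  set (M := Nat.max (S m) M1).
  assert (Hnear : forall y, sdist (S k) y x < r1 * rho -> ~ deep k th (S m) (scl y)).
  { intros y Hy. apply Hdeep. apply Rle_lt_trans with (/ rho * sdist (S k) y x).
    - apply sdist_le; [apply Rmult_le_pos; [lra|apply sdist_nonneg]|]. intros i Hi. unfold scl.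
      rewrite <- Rmult_minus_distr_l, Rabs_mult, Rabs_pos_eq by lra. apply Rmult_le_compat_l; [lra|now apply sdist_ge].
    - apply (Rmult_lt_compat_l (/ rho)) in Hy; [|easy]. replace (/ rho * (r1 * rho)) with r1 in Hy by (field; lra). easy. }
  assert (HA : forall y, sdist (S k) y x < r2 -> forall p, (M <= p)%nat -> forall i, (i < S n)%nat -> A p y i = A M y i).
  { intros y Hy p Hp i Hi. apply Hsq in Hy. destruct (Rle_dec (sq (S k) y) (9 / 16)) as [h|h].
    - rewrite (an_stat0 _ _ _ _ _ _ _ _ _ AN p), (an_stat0 _ _ _ _ _ _ _ _ _ AN M) by easy. easy.
    - rewrite (HM1 p), (HM1 M) by (easy || lra || (unfold M in *; lia)). easy. }
  assert (Hw : forall y, sdist (S k) y x < Rmin (r1 * rho) r2 -> forall p, (M <= p)%nat -> forall i, (i < S n)%nat -> wN p y i = wN M y i).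
  { intros y Hy p Hp i Hi.
    assert (Hy1 : sdist (S k) y x < r1 * rho) by (eapply Rlt_le_trans; [exact Hy|apply Rmin_l]).
    assert (Hy2 : sdist (S k) y x < r2) by (eapply Rlt_le_trans; [exact Hy|apply Rmin_r]).
    destruct (Rle_dec rho (supn (S k) y)) as [h|h]; [rewrite !wN_outer by easy; now apply HA|].
    rewrite !wN_inner by (easy || lra). unfold u, M in *.
    destruct p as [|p]; [lia|]. destruct (Nat.max (S m) M1) as [|q] eqn:E; [lia|].
    rewrite (uN_stationary k n th F0 G OK m (scl y) (Hnear y Hy1) p) by (easy || lia).
    now rewrite (uN_stationary k n th F0 G OK m (scl y) (Hnear y Hy1) q) by (easy || lia). }
  assert (Hr0 : 0 < Rmin (r1 * rho) r2) by (apply Rmin_pos; nra).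
  exists M, (Rmin (r1 * rho) r2). split; [easy|]. split.
  { intros y Hy p Hp i Hi. unfold vN. apply (ps_dep (S n) (fun y => retract (S n) delta y i)); [apply retract_ps; easy || lra|].
    intros j Hj. now apply Hw. }
  intros Mx HMx. destruct (Rle_dec delta (norm (S n) (wN M x))) as [h|h].
  (* The retracted value has norm 1, the largest that the retraction takes. *)
  - apply (rank_le_sphere (S k) n (vN M) x Mx 1); [lra|easy| |].
    + intros y _. apply sq_le_1. apply retract_norm; lra.
    + apply norm_1_sq. apply retract_norm_eq; lra.
  - apply Rnot_le_lt in h.
    assert (Hxr : supn (S k) x < rho).
    { apply Rnot_le_lt. intros Hge. apply (Rlt_not_le _ _ h).
      rewrite (norm_ext _ _ (A M x)) by (intros; now apply wN_outer). apply (an_lower _ _ _ _ _ _ _ _ _ AN); lra. }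
    destruct wN_lip_bound as [Lw [Bw [HLw [_ [_ Hwl]]]]].
    destruct (sq_continuous (S n) (wN M x) (delta * delta)) as [r3 [Hr3 Hsq3]].
    { rewrite <- norm_sq. pose proof (norm_nonneg (S n) (wN M x)). nra. }
    destruct (uN_hyperplanes k n th F0 G OK m) as [V HV].
    set (r4 := Rmin (Rmin (r1 * rho) r2) (Rmin (rho - supn (S k) x) (r3 / (Lw + 1)))).
    assert (Hr4 : 0 < r4) by (apply Rmin_pos; [easy|apply Rmin_pos; [lra|apply Rdiv_lt_0_compat; lra]]).
    (* Below [delta] the point lies in the core and, near x, the retraction is division by [delta],
       which merely rescales the hyperplanes. *)
    apply (rank_le_hyperplanes (S k) n (vN M) x Mx r4 (map (fun v => / delta * v) V)); [easy|easy|].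
    intros y Hy.
    assert (H1 : sdist (S k) y x < Rmin (r1 * rho) r2) by (eapply Rlt_le_trans; [exact Hy|apply Rmin_l]).
    assert (H2 : sdist (S k) y x < Rmin (rho - supn (S k) x) (r3 / (Lw + 1))) by (eapply Rlt_le_trans; [exact Hy|apply Rmin_r]).
    assert (H3 : sdist (S k) y x < rho - supn (S k) x) by (eapply Rlt_le_trans; [exact H2|apply Rmin_l]).
    assert (H4 : sdist (S k) y x < r3 / (Lw + 1)) by (eapply Rlt_le_trans; [exact H2|apply Rmin_r]).
    assert (H5 : sdist (S k) y x < r1 * rho) by (eapply Rlt_le_trans; [exact H1|apply Rmin_l]).
    assert (H6 : sdist (S k) y x < r2) by (eapply Rlt_le_trans; [exact H1|apply Rmin_r]).
    pose proof (supn_sdist (S k) y x) as H7.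
    assert (Hyw : norm (S n) (wN M y) <= delta).
    { assert (Hs : sq (S n) (wN M y) < delta * delta).
      { apply Hsq3. apply Rle_lt_trans with (Lw * sdist (S k) y x).
        - apply Hwl; [|lra]. apply Hsq in H6. unfold t in H6. lra.
        - apply (Rmult_lt_compat_l (Lw + 1)) in H4; [|lra].
          replace ((Lw + 1) * (r3 / (Lw + 1))) with r3 in H4 by (field; lra). pose proof (sdist_nonneg (S k) y x). lra. }
      rewrite <- norm_sq in Hs. pose proof (norm_nonneg (S n) (wN M y)). nra. }
    destruct (HV (scl y)) as [i [Hi Hin]]; [apply scl_le; lra|now apply Hnear|].
    exists i. split; [easy|]. unfold vN, retract. rewrite nmax_eq_d by lra.
    rewrite wN_inner by (easy || lra). unfold u, M. destruct (Nat.max (S m) M1) as [|q] eqn:E; [lia|].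
    rewrite (uN_stationary k n th F0 G OK m (scl y) (Hnear y H5) q) by (easy || lia).
    now apply (in_map (fun v => / delta * v)).
Qed.

Lemma assemble : exists F : vec -> vec,
    lipschitz_on (S k) (S n) (ball (S k)) F /\
    (forall x, sphere k x -> forall i, (i < S n)%nat -> F x i = beta x i) /\
    exists N : vec -> Prop, null_set (S k) N /\
      forall x, norm (S k) x < 1 -> ~ N x ->
        exists M : mat, has_derivative (S k) (S n) F x M /\ rank_le (S k) (S n) M n.
Proof.
  destruct wN_lip_bound as [Lw [Bw [HLw [HBw [HwB Hwl]]]]].
  pose proof (an_delta _ _ _ _ _ _ _ _ _ AN) as Hdl.
  destruct (psv_lip (S n) (S n) (retract (S n) delta) (Rmax Bw 1)) as [Lr [HLr Hret]].
  { eapply Rle_trans; [exact HBw|apply Rmax_l]. }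
  { intros i Hi. apply retract_ps; [lra|easy]. }
  assert (HwB' : forall M z, sq (S k) z <= 1 -> supn (S n) (wN M z) <= Rmax Bw 1).
  { intros M z Hz. eapply Rle_trans; [now apply HwB|apply Rmax_l]. }
  apply (limit_map n k vN beta (Lr * Lw) (fun z => forall m, deep k th m (scl z))).
  - now apply Rmult_le_pos.
  - apply vN_ps.
  - intros; now apply vN_le.
  - intros M x y i Hx Hy Hi. eapply Rle_trans; [apply (sdist_ge (S n) (vN M x) (vN M y) i Hi)|].
    eapply Rle_trans; [apply Hret; auto|]. rewrite Rmult_assoc. apply Rmult_le_compat_l; [easy|]. now apply Hwl.
  - intros z i Hz Hi. now apply (sphere_le n); [apply Hmap|].
  - intros z i d Hz Hi Hd. assert (Hz1 : sq (S k) z = 1) by now apply norm_1_sq.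
    (* [retract] fixes [beta z] and has Lipschitz constant [Lr], so the error before retraction has
       to be smaller by that factor. *)
    assert (Hd' : 0 < d / (Lr + 1)) by (apply Rdiv_lt_0_compat; lra).
    destruct (eventually_all (S n) (fun M i => Rabs (A M z i - beta z i) <= d / (Lr + 1))) as [M1 HM1].
    { intros j Hj. now apply (an_limit _ _ _ _ _ _ _ _ _ AN). }
    exists M1. intros M HM.
    assert (Hb : beta z i = retract (S n) delta (beta z) i).
    { pose proof (Hmap z Hz) as Hs. unfold sphere in Hs. unfold retract. rewrite nmax_eq, Hs by lra. field. }
    rewrite Hb. eapply Rle_trans; [apply (sdist_ge (S n) (vN M z) (retract (S n) delta (beta z)) i Hi)|].
    eapply Rle_trans; [apply Hret|].
    + apply HwB'. lra.
    + eapply Rle_trans; [|apply Rmax_r]. apply (sphere_supn n). auto.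
    + assert (Hs : sdist (S n) (wN M z) (beta z) <= d / (Lr + 1)).
      { apply sdist_le; [lra|]. intros j Hj. rewrite wN_outer by (easy || apply supn_large; lra). now apply HM1. }
      apply Rle_trans with ((Lr + 1) * (d / (Lr + 1))); [|apply Req_le; field; lra].
      apply Rmult_le_compat; try lra. apply sdist_nonneg.
  - apply deep_null; auto; try lra. apply rho_pos.
  - intros x Hx HK. destruct (vN_stationary x Hx HK) as [M [r H]]. now exists M, r.
Qed.

End assembly.

Theorem theorem2 (n k : nat) (hnk : (n + 1 <= k)%nat) (hk : (k + 1 < 2 * n)%nat)
  (beta : vec -> vec)
  (hmap : forall x, sphere k x -> sphere n (beta x))
  (hlip : lipschitz_on (S k) (S n) (sphere k) beta) :
  exists F : vec -> vec,
    lipschitz_on (S k) (S n) (ball (S k)) F /\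
    (forall x, sphere k x -> forall i, (i < S n)%nat -> F x i = beta x i) /\
    exists N : vec -> Prop, null_set (S k) N /\
      forall x, norm (S k) x < 1 -> ~ N x ->
        exists M : mat, has_derivative (S k) (S n) F x M /\ rank_le (S k) (S n) M n.
Proof.
  (* The given constant may be negative; the absolute value, the comparison of norms and the summand
     1 provide a constant at least 1 for the sup distance. *)
  destruct hlip as [L0 HL0]. set (L := Rabs L0 * INR (S k) + 1).
  assert (HL : 1 <= L).
  { unfold L. pose proof (Rabs_pos L0). pose proof (pos_INR (S k)). nra. }
  assert (Hlip : forall x y, sphere k x -> sphere k y -> sdist (S n) (beta x) (beta y) <= L * sdist (S k) x y).
  { intros x y Hx Hy. eapply Rle_trans; [apply sdist_dist|]. eapply Rle_trans; [now apply HL0|].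
    pose proof (dist_sdist (S k) x y) as H. pose proof (sdist_nonneg (S k) x y) as H0.
    pose proof (Rle_abs L0). pose proof (Rabs_pos L0). assert (0 <= dist (S k) x y) by apply norm_nonneg.
    apply Rle_trans with (Rabs L0 * dist (S k) x y); [nra|].
    apply Rle_trans with (Rabs L0 * (INR (S k) * sdist (S k) x y)); [now apply Rmult_le_compat_l|]. unfold L. nra. }
  destruct (scaling_factors n k ltac:(lia)) as [lam [mu [Hl [Hm [Hln [Hmk [Hlm Hl2]]]]]]].
  assert (Hth : 0 < lam * mu < 1) by (split; [nra|easy]).
  (* The order matters: [c0] comes from the ratios, [g] is then made free of zeros beyond [c0], and
     only then can the pattern be filled. *)
  destruct (cyc_inv_mix_lower k (lam * mu) Hth) as [c0 [Hc0 Hc]].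
  destruct (annulus_exists n k beta L c0 ltac:(lia) hk HL Hc0 hmap Hlip) as [g [rho [delta [L1 [A AN]]]]].
  destruct (pattern_ifs k n (lam * mu) c0 g Hth Hc (an_gps _ _ _ _ _ _ _ _ _ AN) (an_gle _ _ _ _ _ _ _ _ _ AN)
    (an_gbd _ _ _ _ _ _ _ _ _ AN) (an_gnz _ _ _ _ _ _ _ _ _ AN)) as [G OK].
  exact (assemble n k beta g c0 rho delta L1 A hmap AN lam mu Hl Hm Hln Hmk Hlm Hl2 G OK).
Qed.
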